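(* Let $d\ge2$ be a fixed integer and let $(G_n=(V_n,E_n))_{n\ge d}$ be a sequence of $d$-regular digraphs with $|V_n|=n$. For each $n$, let $\pi_n$ be a uniformly random permutation of $V_n$ and let $k_n$ be a positive integer. Let $M_n$ be the transition matrix of the simple random walk on $G_n$, let $\Pi_n$ be the permutation matrix of $\pi_n$, and let $Q_n=M_n^{k_n}\Pi_n$. If $k_n=o\left(\frac{\log n}{\log\log n}\right)$ as $n\to\infty$, then the sequence of chains $(Q_n)$ has cutoff at time $\frac{\log n}{\mathbf H_n}$, where $$\mathbf H_n=\frac1n\sum_{u,v\in V_n}M_n^{k_n}(u,v)\log\frac{1}{M_n^{k_n}(u,v)} ;$$ that is, for every $\varepsilon\in(0,1)$, $$\frac{\mathbf H_n\,t_{\mathrm{mix}}^{(n)}(\varepsilon)}{\log n}\longrightarrow1\quad\text{in probability as }n\to\infty,$$ where $t_{\mathrm{mix}}^{(n)}(\varepsilon)$ is the $\varepsilon$-mixing time of $Q_n$.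
   Context: A $d$-regular digraph is a directed graph (without multiple edges, $E_n\subset V_n\times V_n$) in which every vertex has in-degree and out-degree both equal to $d$. The simple random walk has $M_n(u,v)=\frac1d\mathbf 1_{\{(u,v)\in E_n\}}$. The convention $0\log\frac10=0$ is used. The permutation matrix is $\Pi_n(i,j)=\mathbf 1_{\{j=\pi_n(i)\}}$. The uniform distribution on $V_n$ is stationary for $Q_n$. Define $\mathcal D^{(n)}(t)=\max_{x\in V_n}\sum_{y\in V_n}\left(\frac1n-Q_n^t(x,y)\right)_+$, with $a_+=\max(a,0)$, and $t_{\mathrm{mix}}^{(n)}(\varepsilon)=\min\{t\ge0:\ \mathcal D^{(n)}(t)\le\varepsilon\}$, with $t$ ranging over integers (and $\min\emptyset=+\infty$). Probability refers to the choice of $\pi_n$. *)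

(* Defs.v *)
(* MathComp / MathComp-Analysis world. *)
From HB Require Import structures.
From mathcomp Require Import all_boot all_order all_algebra all_fingroup.
From mathcomp Require Import all_classical all_reals all_analysis.

Set Implicit Arguments.
Unset Strict Implicit.
Unset Printing Implicit Defensive.

Import Order.TTheory GRing.Theory Num.Theory.
Import numFieldNormedType.Exports.

Local Open Scope classical_set_scope.
Local Open Scope ring_scope.

(* Loops are allowed; multiple edges are excluded by the encoding. *)
Definition regular_digraph (n d : nat) (E : rel 'I_n) : Prop :=
  (forall u, #|[set v | E u v]%SET| = d) /\
  (forall v, #|[set u | E u v]%SET| = d).

Definition srw (R : realType) (n d : nat) (E : rel 'I_n) : 'M[R]_n :=
  \matrix_(u, v) (d%:R^-1 * (E u v)%:R).

(* [perm_mx s i j] is 1 if [s i = j] and 0 otherwise. *)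
Definition permuted_chain (R : realType) (n : nat) (M : 'M[R]_n) (k : nat)
    (s : 'S_n) : 'M[R]_n :=
  M ^+ k *m perm_mx s.

(* The convention 0 log (1/0) = 0 holds since the first factor vanishes. *)
Definition avg_entropy (R : realType) (n : nat) (P : 'M[R]_n) : R :=
  n%:R^-1 * \sum_(u < n) \sum_(v < n) P u v * ln ((P u v)^-1).

(* All the sums are nonnegative, so the default value 0 of the maximum is
   harmless for n > 0. *)
Definition unif_dist (R : realType) (n : nat) (Q : 'M[R]_n) (t : nat) : R :=
  \big[Num.max/0]_(x < n) \sum_(y < n) Num.max (n%:R^-1 - (Q ^+ t) x y) 0.

Definition mixing_time (R : realType) (n : nat) (Q : 'M[R]_n) (eps : R) :
    \bar R :=
  match pselect (exists t, unif_dist Q t <= eps) with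
  | left ex_t => ((ex_minn ex_t)%:R)%:E
  | right _ => +oo%E
  end.

Definition unif_prob (R : realType) (T : finType) (A : pred T) : R :=
  #|A|%:R / #|T|%:R.

(* Each X n lives on its own finite uniform probability space; since the limit
   is a constant, no coupling of these spaces is involved. *)
Definition cvg_in_unif_prob (R : realType) (T : nat -> finType)
    (X : forall n, T n -> \bar R) (l : R) : Prop :=
  forall delta : R, 0 < delta ->
    (fun n : nat =>
       unif_prob R [pred s | (delta%:E < `|X n s - l%:E|)%E]) @ \oo --> (0 : R).

(* Main.v *)
(* A walk from [x] picks [V] with law [P x], P = M^k, and moves to [p V]; as long
   as its picks are fresh, its path has a probability whose logarithm is minus a
   sum of almost independent terms with mean H, and this sum concentrates.

   Lower bound: while the typical path has probability at least e^{-c} with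
   c < log n, the walk stays on at most e^c vertices up to an error, too few to
   be equidistributed.

   Upper bound: explore the ball of height h of order log log n around [x].  It
   is a tree up to few dead branches, and its frontier carries weights at most
   2^{-h-1}.  Exchanging the images of the frontier with those of independent
   uniform seeds is an involution for each fixed seed, so these images may be
   resampled.  If typical paths of length b have probability below 1/n, a
   variance computation makes the walk of length h+1+b equidistributed from most
   starting points, on average.  Resampling again, a Chernoff bound shows that
   with high probability the frontier of every vertex carries little weight on
   bad starting points, and at most one dead branch, so that every further
   exploration step halves the worst distance up to an error. *)

Require Import Defs.
From mathcomp Require Import boolp constructive_ereal reals sequences exp.
From mathcomp Require Import all_boot all_order all_algebra all_fingroup.
From mathcomp Require Import ring lra zify.

Set Implicit Arguments.
Unset Strict Implicit.
Unset Printing Implicit Defensive.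

Import Order.TTheory GRing.Theory Num.Theory.

Local Open Scope ring_scope.

(** * Path expectations of the permuted chain *)

(** The maximum over starting points forces a union bound over [n] vertices, so a local accident is
    affordable only if its probability is $o(1/n)$. A single dead branch, or a single frontier walk
    running into a foreign seed, has probability of order $n^{-1+o(1)}$, which is too much; two
    nearly independent ones have $n^{-2+o(1)}$. Hence isolated accidents are tolerated and only
    pairs are excluded. Entries of [P] are merely known to be at most 1/2, so a tolerated dead
    branch may destroy half of the mass: this is why the worst distance is halved repeatedly instead
    of dropping at once to its typical value.

    The hypothesis on $k_n$ enters through $\Delta=d^{k_n}$ and $L=\log\Delta$. It gives
    $(\Delta+1)^{O(\log\log n)}=n^{o(1)}$, which keeps all collision probabilities small, and it
    makes the variance of the logarithm of the path probability, at most about $L\log n$ at the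
    relevant times, negligible against $\log^2 n$.

    Conditioning is done by counting: a conditioning class consists of the permutations that agree
    with a given one on a set [D]. *)

Section Walk.
Variables (R : realFieldType) (n : nat) (P : 'I_n -> 'I_n -> R).
Hypothesis P_ge0 : forall x v, 0 <= P x v.
Hypothesis P_row : forall x, \sum_v P x v = 1.
Hypothesis P_col : forall v, \sum_x P x v = 1.
Implicit Types (p q : 'S_n) (x y z v : 'I_n) (s : seq 'I_n) (S T : {set 'I_n}).

(* Expectation over the picks [V_1, ..., V_k] of the walk from [x]: a step picks
   [v] with law [P x], then moves to [p v]. *)
Fixpoint ex p k x (Phi : seq 'I_n -> R) : R :=
  if k is k'.+1 then \sum_v P x v * ex p k' (p v) (fun s => Phi (v :: s))
  else Phi [::].

Fixpoint endp p x s := if s is v :: s' then endp p (p v) s' else x.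

Lemma exS p k x Phi :
  ex p k.+1 x Phi = \sum_v P x v * ex p k (p v) (fun s => Phi (v :: s)).
Proof. by []. Qed.

Lemma ex_le p k x (Phi Psi : seq 'I_n -> R) :
  (forall s, size s = k -> Phi s <= Psi s) -> ex p k x Phi <= ex p k x Psi.
Proof.
elim: k x Phi Psi => [|k IH] x Phi Psi h /=; first exact: h.
apply: ler_sum => v _; apply: ler_wpM2l => //; apply: IH => s hs.
by apply: h; rewrite /= hs.
Qed.

Lemma ex_eq p k x (Phi Psi : seq 'I_n -> R) :
  (forall s, size s = k -> Phi s = Psi s) -> ex p k x Phi = ex p k x Psi.
Proof.
elim: k x Phi Psi => [|k IH] x Phi Psi h /=; first exact: h.
apply: eq_bigr => v _; congr (_ * _); apply: IH => s hs.
by apply: h; rewrite /= hs.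
Qed.

Lemma exD p k x (Phi Psi : seq 'I_n -> R) :
  ex p k x (fun s => Phi s + Psi s) = ex p k x Phi + ex p k x Psi.
Proof.
elim: k x Phi Psi => [//|k IH] x Phi Psi /=.
by rewrite -big_split; apply: eq_bigr => v _ /=; rewrite IH mulrDr.
Qed.

Lemma exZ p k x c (Phi : seq 'I_n -> R) :
  ex p k x (fun s => c * Phi s) = c * ex p k x Phi.
Proof.
elim: k x Phi => [//|k IH] x Phi /=.
by rewrite mulr_sumr; apply: eq_bigr => v _ /=; rewrite IH mulrCA.
Qed.

Lemma ex_cst p k x c : ex p k x (fun=> c) = c.
Proof.
elim: k x => [//|k IH] x /=.
by under eq_bigr do rewrite IH; rewrite -mulr_suml P_row mul1r.
Qed.

Lemma exB p k x (Phi Psi : seq 'I_n -> R) :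
  ex p k x (fun s => Phi s - Psi s) = ex p k x Phi - ex p k x Psi.
Proof.
rewrite -[X in _ - X]mul1r -mulNr -exZ -exD.
by apply: ex_eq => s _; rewrite mulN1r.
Qed.

Lemma ex_ge0 p k x (Phi : seq 'I_n -> R) :
  (forall s, size s = k -> 0 <= Phi s) -> 0 <= ex p k x Phi.
Proof. by move=> h; rewrite -(ex_cst p k x 0); apply: ex_le. Qed.

Lemma ex_sum (I : finType) (A : pred I) p k x (Phi : I -> seq 'I_n -> R) :
  ex p k x (fun s => \sum_(i | A i) Phi i s) = \sum_(i | A i) ex p k x (Phi i).
Proof.
elim: k x Phi => [//|k IH] x Phi /=.
rewrite exchange_big /=; apply: eq_bigr => v _.
by rewrite IH mulr_sumr.
Qed.

Lemma ex_cat p k j x Phi :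
  ex p (k + j) x Phi =
  ex p k x (fun s => ex p j (endp p x s) (fun s' => Phi (s ++ s'))).
Proof.
elim: k x Phi => [//|k IH] x Phi /=.
by apply: eq_bigr => v _; rewrite IH.
Qed.

Lemma endp_cat p x s s' : endp p x (s ++ s') = endp p (endp p x s) s'.
Proof. by elim: s x => //= v s IH x; rewrite IH. Qed.

Lemma endp_last p x v s : endp p x (v :: s) = p (last v s).
Proof. by elim: s x v => //= w s IH x v; rewrite -IH. Qed.

Lemma sum_perm p (g : 'I_n -> R) : \sum_v g (p v) = \sum_v g v.
Proof. by rewrite [RHS](reindex_inj (@perm_inj _ p)). Qed.

Lemma sum_step (g : 'I_n -> R) : \sum_x \sum_v P x v * g v = \sum_v g v.
Proof.
rewrite exchange_big /=; apply: eq_bigr => v _.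
by rewrite -mulr_suml P_col mul1r.
Qed.

Lemma ex_stationary p k (g : 'I_n -> R) :
  \sum_x ex p k x (fun s => g (endp p x s)) = \sum_x g x.
Proof.
elim: k => [//|k IH] /=.
rewrite (sum_step (fun v => ex p k (p v) (fun s => g (endp p (p v) s)))).
by rewrite (sum_perm p (fun z => ex p k z (fun s => g (endp p z s)))).
Qed.

Lemma has_mem_cons S v s : has (mem S) (v :: s) = (v \in S) || has (mem S) s.
Proof. by []. Qed.

(* [mem S] counts the vertices picked before [p] is applied. *)
Definition hit p S k x : R := ex p k x (fun s => (has (mem S) s)%:R).

Lemma hit_ge0 p S k x : 0 <= hit p S k x.
Proof. by apply: ex_ge0 => s _; rewrite ler0n. Qed.

Lemma hitS_le p S k x :
  hit p S k.+1 x <= \sum_v P x v * ((v \in S)%:R + hit p S k (p v)).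
Proof.
rewrite /hit /=; apply: ler_sum => v _; apply: ler_wpM2l => //.
case: (v \in S) => /=; last by rewrite add0r.
by rewrite ex_cst lerDl hit_ge0.
Qed.

(** From a uniform start every pick is uniform, because the columns of [P] sum to 1 and [p] is a
    bijection; a union bound over the [k] picks concludes. The sum over starts carries no factor
    [1/n]. *)
Lemma hit_stationary p S k : \sum_x hit p S k x <= (k * #|S|)%:R.
Proof.
elim: k => [|k IH]; first by rewrite mul0n /hit /= big1.
apply: le_trans (_ : \sum_x \sum_v P x v * ((v \in S)%:R + hit p S k (p v)) <= _).
  by apply: ler_sum => x _; exact: hitS_le.
rewrite (sum_step (fun v => (v \in S)%:R + hit p S k (p v))) big_split /=.
rewrite (sum_perm p (fun z => hit p S k z)) mulSn natrD lerD //.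
by rewrite -natr_sum ler_nat -sum1_card [leqRHS]big_mkcond.
Qed.

Lemma hit_stationary_perm p S k : \sum_u hit p S k (p u) <= (k * #|S|)%:R.
Proof. by rewrite (sum_perm p (hit p S k)) hit_stationary. Qed.

Lemma hitU p S T k x : hit p (S :|: T) k x <= hit p S k x + hit p T k x.
Proof.
rewrite /hit -exD; apply: ex_le => s _.
have -> : has (mem (S :|: T)) s = has (mem S) s || has (mem T) s.
  by rewrite -has_predU; apply: eq_has => z /=; rewrite in_setU.
by case: has; case: has; rewrite /= ?addr0 ?add0r ?lerDl.
Qed.

Lemma ex_endpE p k x (phi : seq 'I_n -> R) (g : 'I_n -> R) :
  \sum_y ex p k x (fun s => phi s * (endp p x s == y)%:R) * g y =
  ex p k x (fun s => phi s * g (endp p x s)).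
Proof.
under eq_bigr => y _ do rewrite mulrC -exZ.
rewrite -ex_sum; apply: ex_eq => s _.
rewrite (bigD1 (endp p x s)) //= eqxx mulr1 big1 ?addr0 1?mulrC // => y.
by rewrite eq_sym => /negbTE ->; rewrite !mulr0.
Qed.

(** A walk whose picks avoid [S] never evaluates the permutation on [S], so changing it there is
    invisible. Every comparison between a permutation and its resampling rests on this. *)
Lemma ex_avoid_agree p q S k x (phi : 'I_n -> R) :
  (forall v, v \notin S -> p v = q v) ->
  ex p k x (fun s => (~~ has (mem S) s)%:R * phi (endp p x s)) =
  ex q k x (fun s => (~~ has (mem S) s)%:R * phi (endp q x s)).
Proof.
move=> pq; elim: k x => [//|k IH] x.
rewrite !exS; apply: eq_bigr => v _; congr (_ * _).
have [vS|vS] := boolP (v \in S).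
  rewrite (@ex_eq p k (p v) _ (fun=> 0)); last by move=> s _; rewrite has_mem_cons vS mul0r.
  rewrite (@ex_eq q k (q v) _ (fun=> 0)); last by move=> s _; rewrite has_mem_cons vS mul0r.
  by rewrite !ex_cst.
rewrite (@ex_eq p k (p v) _ (fun s => (~~ has (mem S) s)%:R * phi (endp p (p v) s)));
  last by move=> s _; rewrite has_mem_cons (negbTE vS).
rewrite (@ex_eq q k (q v) _ (fun s => (~~ has (mem S) s)%:R * phi (endp q (q v) s)));
  last by move=> s _; rewrite has_mem_cons (negbTE vS).
by rewrite -(pq _ vS) IH.
Qed.

Lemma hitE p S k x :
  hit p S k x = 1 - ex p k x (fun s => (~~ has (mem S) s)%:R * 1).
Proof.
rewrite -[X in X - _](ex_cst p k x 1) -exB; apply: ex_eq => s _.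
by case: (has _ s); rewrite /= ?(mulr0n, mulr1n) ?mul0r ?mulr1 ?subr0 ?subrr.
Qed.

Lemma hit_agree p q S k x :
  (forall v, v \notin S -> p v = q v) -> hit p S k x = hit q S k x.
Proof.
by move=> pq; rewrite !hitE (ex_avoid_agree _ _ (fun=> 1) pq).
Qed.

Definition pp (a : R) := Num.max a 0.

Lemma pp_ge0 a : 0 <= pp a. Proof. by rewrite /pp le_max lexx orbT. Qed.
Lemma le_pp a : a <= pp a. Proof. by rewrite /pp le_max lexx. Qed.
Lemma pp_leP a b : 0 <= b -> a <= b -> pp a <= b.
Proof. by move=> b0 ab; rewrite /pp ge_max ab b0. Qed.
Lemma pp_le a b : a <= b -> pp a <= pp b.
Proof. by move=> ab; apply: pp_leP; rewrite ?pp_ge0 // (le_trans ab) // le_pp. Qed.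
Lemma ppD a b : pp (a + b) <= pp a + pp b.
Proof. by apply: pp_leP; rewrite ?addr_ge0 ?pp_ge0 // lerD // le_pp. Qed.

Lemma pp_ex p k x (Phi : seq 'I_n -> R) :
  pp (ex p k x Phi) <= ex p k x (fun s => pp (Phi s)).
Proof.
apply: pp_leP; first by apply: ex_ge0 => s _; exact: pp_ge0.
by apply: ex_le => s _; exact: le_pp.
Qed.

(** Killing the walk when it picks in [S] only increases the deficit with respect to the uniform
    law, and makes it independent of the values of [p] on [S] once the start is given. With [S]
    empty this is the distance that defines the mixing time. *)
Definition dist p S k x : R :=
  \sum_y pp (n%:R^-1 -
    ex p k x (fun s => (~~ has (mem S) s)%:R * (endp p x s == y)%:R)).

Lemma dist_ge0 p S k x : 0 <= dist p S k x.
Proof. by apply: sumr_ge0 => y _; exact: pp_ge0. Qed.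

Lemma sum_unif (x : 'I_n) : \sum_(y < n) (n%:R^-1 : R) = 1.
Proof.
rewrite sumr_const card_ord -[X in X *+ _]mul1r -mulrnAr -mulr_natr mul1r.
by rewrite mulVf // pnatr_eq0 -lt0n (leq_ltn_trans _ (ltn_ord x)).
Qed.

Lemma dist_le1 p S k x : dist p S k x <= 1.
Proof.
rewrite -(sum_unif x); apply: ler_sum => y _; apply: pp_leP.
  by rewrite invr_ge0 ler0n.
rewrite gerBl; apply: ex_ge0 => s _.
by rewrite mulr_ge0 ?ler0n.
Qed.

Lemma dist_agree p q S k x :
  (forall v, v \notin S -> p v = q v) -> dist p S k x = dist q S k x.
Proof.
move=> pq; apply: eq_bigr => y _.
by rewrite (ex_avoid_agree _ _ (fun z => (z == y)%:R) pq).
Qed.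

Lemma dist_sub p S T k x : S \subset T -> dist p S k x <= dist p T k x.
Proof.
move=> /subsetP ST; apply: ler_sum => y _; apply: pp_le; apply: lerB => //.
apply: ex_le => s _; rewrite ler_wpM2r // ler_nat.
case: (boolP (has (mem S) s)) => [/hasP[v vs vS]|_]; last exact: leq_b1.
suff -> : has (mem T) s by [].
by apply/hasP; exists v => //; exact: ST.
Qed.

(** Killing on [T] as well removes only the mass of walks that meet [T]. *)
Lemma dist_hit p S T k x :
  dist p (S :|: T) k x <= dist p S k x + hit p T k x.
Proof.
have -> : hit p T k x =
    \sum_y ex p k x (fun s => (has (mem T) s)%:R * (endp p x s == y)%:R) * 1.
  by rewrite ex_endpE; apply: ex_eq => s _; rewrite mulr1.
rewrite -big_split /=; apply: ler_sum => y _; rewrite mulr1.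
apply: pp_leP.
  rewrite addr_ge0 ?pp_ge0 //; apply: ex_ge0 => s _.
  by rewrite mulr_ge0.
apply: le_trans (_ : n%:R^-1 -
    ex p k x (fun s => (~~ has (mem S) s)%:R * (endp p x s == y)%:R) +
    ex p k x (fun s => (has (mem T) s)%:R * (endp p x s == y)%:R) <= _).
  rewrite -addrA lerD2l -[leRHS]opprK opprD opprK lerN2 -exB; apply: ex_le => s _.
  rewrite -mulrBl ler_wpM2r //.
  have -> : has (mem (S :|: T)) s = has (mem S) s || has (mem T) s.
    by rewrite -has_predU; apply: eq_has => z /=; rewrite in_setU.
  by case: (has (mem S) s); case: (has (mem T) s);
    rewrite /= ?(mulr0n, mulr1n) ?subr0 ?sub0r ?subrr ?lerN10.
by rewrite lerD2r le_pp.
Qed.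

Lemma ex_set0 p k x (phi : seq 'I_n -> R) :
  ex p k x (fun s => (~~ has (mem (set0 : {set 'I_n})) s)%:R * phi s) = ex p k x phi.
Proof.
apply: ex_eq => s _; suff -> : has (mem (set0 : {set 'I_n})) s = false by rewrite mul1r.
by apply/negbTE/hasPn => v _; rewrite /= inE.
Qed.

Lemma dist0E p k x : dist p set0 k x =
  \sum_y pp (n%:R^-1 - ex p k x (fun s => (endp p x s == y)%:R)).
Proof. by apply: eq_bigr => y _; rewrite ex_set0. Qed.

(** Convexity of the positive part, applied to the law of the point reached after [j] steps. *)
Lemma dist_convex p j t x :
  dist p set0 (j + t) x <=
  ex p j x (fun s => dist p set0 t (endp p x s)).
Proof.
rewrite dist0E.
under [leRHS]ex_eq => s _ do rewrite dist0E.
rewrite ex_sum; apply: ler_sum => y _.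
rewrite -[X in X - _](ex_cst p j x) ex_cat -exB.
apply: le_trans (pp_ex _ _ _ _) _; apply: ex_le => s _; apply: pp_le.
rewrite lerD2l lerN2; apply: ex_le => s' _.
by rewrite endp_cat.
Qed.

(** One more step applies the doubly stochastic kernel [Q]: its column sums reproduce the uniform
    law, and its row sums show that the positive parts do not grow. *)
Lemma dist_mono p t x : dist p set0 t.+1 x <= dist p set0 t x.
Proof.
rewrite -addn1 !dist0E.
pose a z := ex p t x (fun s => (endp p x s == z)%:R).
pose Q z y := ex p 1 z (fun s => (endp p z s == y)%:R).
have Q0 z y : 0 <= Q z y by apply: ex_ge0 => s _; rewrite ler0n.
have aE z : a z = ex p t x (fun s => 1 * (endp p x s == z)%:R).
  by apply: ex_eq => s _; rewrite mul1r.
have eq y : ex p (t + 1) x (fun s => (endp p x s == y)%:R) = \sum_z a z * Q z y.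
  rewrite ex_cat; under [RHS]eq_bigr => z _ do rewrite aE.
  rewrite (ex_endpE p t x (fun=> 1) (fun z => Q z y)).
  apply: ex_eq => s _; rewrite mul1r; apply: ex_eq => s' _.
  by rewrite endp_cat.
have Qc y : \sum_z Q z y = 1.
  rewrite (ex_stationary p 1 (fun z => (z == y)%:R)).
  rewrite (bigD1 y) //= eqxx big1 ?addr0 // => z.
  by move=> /negbTE ->.
have Qr z : \sum_y Q z y = 1.
  rewrite -ex_sum -[RHS](ex_cst p 1 z); apply: ex_eq => s _.
  rewrite (bigD1 (endp p z s)) //= eqxx big1 ?addr0 // => y.
  by rewrite eq_sym => /negbTE ->.
apply: le_trans (_ : \sum_y \sum_z pp (n%:R^-1 - a z) * Q z y <= _).
  apply: ler_sum => y _; rewrite eq -[X in X - _]mulr1 -(Qc y) mulr_sumr -sumrB.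
  apply: pp_leP; first by apply: sumr_ge0 => z _; rewrite mulr_ge0 ?pp_ge0.
  by apply: ler_sum => z _; rewrite -mulrBl ler_wpM2r // le_pp.
rewrite exchange_big /=; apply: ler_sum => z _.
by rewrite -mulr_sumr Qr mulr1.
Qed.

Lemma dist_mono_le p t t' x : (t <= t')%N ->
  dist p set0 t' x <= dist p set0 t x.
Proof.
move=> /subnKC <-; elim: (t' - t)%N => [|k IH]; first by rewrite addn0.
by rewrite addnS; exact: le_trans (dist_mono _ _ _) IH.
Qed.

End Walk.

(** * Revealing the permutation along walks *)

Section Cosets.
Variables (R : realFieldType) (n : nat).
Implicit Types (p q : 'S_n) (v : 'I_n) (D : {set 'I_n}).

Definition agree D p q := [forall v in D, p v == q v].

Lemma agreeP D p q : reflect (forall v, v \in D -> p v = q v) (agree D p q).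
Proof. by apply: (iffP forall_inP) => h v vD; apply/eqP/h. Qed.

Lemma agree_refl D p : agree D p p. Proof. exact/agreeP. Qed.

Lemma agree_sym D p q : agree D p q = agree D q p.
Proof. by apply/agreeP/agreeP => h v vD; rewrite h. Qed.

Lemma agree_trans D p q r : agree D p q -> agree D q r -> agree D p r.
Proof. by move=> /agreeP h /agreeP g; apply/agreeP => v vD; rewrite h ?g. Qed.

Lemma agree_sub D D' p q : D \subset D' -> agree D' p q -> agree D p q.
Proof. by move=> /subsetP sD /agreeP h; apply/agreeP => v /sD /h. Qed.

Definition nag D p : R := #|[pred q | agree D p q]|%:R.

Lemma nag_gt0 D p : 0 < nag D p.
Proof.
by rewrite /nag ltr0n; apply/card_gt0P; exists p; rewrite inE agree_refl.
Qed.

Lemma nagE D p : nag D p = \sum_(q | agree D p q) 1.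
Proof. by rewrite /nag -sum1_card natr_sum. Qed.

Lemma agree_eql D p q r : agree D p q -> agree D p r = agree D q r.
Proof.
move=> pq; apply/idP/idP; apply: agree_trans => //.
by rewrite agree_sym.
Qed.

(** Tower property: a class for [D] is a disjoint union of finer classes for [D'], so a bound
    proportional to the class size passes from the finer to the coarser ones. *)
Lemma agree_avg D D' p0 (Phi : 'S_n -> R) c : D \subset D' ->
  (forall p1, agree D p0 p1 -> \sum_(q | agree D' p1 q) Phi q <= c * nag D' p1) ->
  \sum_(q | agree D p0 q) Phi q <= c * nag D p0.
Proof.
move=> sD h; have N0 p : nag D' p != 0 by rewrite gt_eqF ?nag_gt0.
(* Each [q] is counted once for every member of its finer class, with the inverse size of that class
   as weight. *)
have -> : \sum_(q | agree D p0 q) Phi q =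
    \sum_(p1 | agree D p0 p1) (nag D' p1)^-1 * \sum_(q | agree D' p1 q) Phi q.
  under [RHS]eq_bigr => p1 _ do rewrite mulr_sumr.
  rewrite (exchange_big_dep (fun q => agree D p0 q)) /=; last first.
    by move=> p1 q pp /(agree_sub sD); apply: agree_trans.
  apply: eq_bigr => q pq.
  rewrite (eq_big (fun p1 => agree D' q p1) (fun p1 => (nag D' q)^-1 * Phi q)).
  - rewrite -mulr_suml -[X in _ = X * _](_ : 1 = _) ?mul1r //.
    by rewrite -[X in \sum_(_ | _) X]mulr1 -mulr_sumr -nagE mulVf.
  - move=> p1; rewrite (agree_sym D' p1); case: (boolP (agree D' q p1)) => [qp|]; last by rewrite andbF.
    by rewrite andbT (agree_trans pq) // (agree_sub sD).
  - move=> p1 /andP[_ p1q]; rewrite /nag; congr (_%:R^-1 * _).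
    by apply: eq_card => r; rewrite !inE; apply: agree_eql.
rewrite nagE mulr_sumr; apply: ler_sum => p1 pp1; rewrite mulr1.
by rewrite mulrC ler_pdivrMr ?nag_gt0 // h.
Qed.

Lemma tperm_agree D p0 q u v : u \notin D -> v \notin D ->
  agree D p0 (tperm v u * q)%g = agree D p0 q.
Proof.
move=> uD vD; apply/agreeP/agreeP => h w wD; rewrite h // permM tpermD //;
  by apply: contraTneq wD => <-.
Qed.

(** Given the values on [D], the image of [v] is uniform over the remaining values: composing with
    the transposition of [v] and [u], for [u] outside [D], preserves the class and turns [q v] into
    [q u]. Summed over [u], these values are distinct and contribute at most the full sum of [g]. *)
Lemma agree_swap D p0 v (g : 'I_n -> R) : (forall z, 0 <= g z) -> v \notin D ->
  (\sum_(q | agree D p0 q) g (q v)) * (n - #|D|)%:R <=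
  nag D p0 * \sum_z g z.
Proof.
move=> g0 vD.
have <- : \sum_(u | u \notin D) 1 = (n - #|D|)%:R :> R.
  rewrite sumr_const; congr (_%:R); have := cardC (mem D); rewrite card_ord.
  by move=> /(congr1 (subn^~ #|D|)); rewrite addKn.
rewrite mulr_sumr nagE mulr_suml.
have eqg u : u \notin D -> \sum_(q | agree D p0 q) g (q v) * 1 =
    \sum_(q | agree D p0 q) g (q u).
  move=> uD; rewrite (reindex_inj (@mulgI _ (tperm v u))) /=.
  by apply: eq_big => q; rewrite ?tperm_agree // => _; rewrite mulr1 permM tpermL.
rewrite (eq_bigr (fun u => \sum_(q | agree D p0 q) g (q u))); last first.
  by move=> u uD; rewrite mulr_suml; exact: eqg.
rewrite exchange_big /=; apply: ler_sum => q _; rewrite mul1r.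
rewrite -[leRHS](sum_perm q) [leRHS](bigID (fun u => u \in D)) /=.
by rewrite lerDr sumr_ge0.
Qed.

End Cosets.

(** [S] holds the vertices seen so far and grows with the picks. As long as there is no collision,
    each pick is a vertex whose image has not been revealed by the walk. *)
Fixpoint coll (n : nat) (S : {set 'I_n}) (s : seq 'I_n) : bool :=
  if s is w :: s' then (w \in S) || coll (w |: S) s' else false.

Fixpoint addset (n : nat) (S : {set 'I_n}) (s : seq 'I_n) : {set 'I_n} :=
  if s is w :: s' then addset (w |: S) s' else S.

(* Two walks from the same vertex that pick the same vertices until they
   separate: a collision is any coincidence other than that common start. *)
Fixpoint pcoll (n : nat) (S : {set 'I_n}) (s s' : seq 'I_n) : bool :=
  match s, s' with
  | v :: t, v' :: t' =>
    [|| v \in S, v' \in S | if v == v' then pcoll (v |: S) t t'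
      else let S1 := v |: (v' |: S) in coll S1 t || coll (addset S1 t) t']
  | _, _ => false
  end.

Lemma has_coll (n : nat) (S T : {set 'I_n}) s : T \subset S ->
  has (mem T) s -> coll S s.
Proof.
elim: s S => //= w s IH S TS /orP[wT|h]; first by rewrite (subsetP TS _ wT).
by rewrite IH ?orbT // (subset_trans TS) // subsetU1.
Qed.

Lemma mem_addset (n : nat) (S : {set 'I_n}) s v :
  (v \in addset S s) = (v \in S) || (v \in s).
Proof.
elim: s S => [|w s IH] S /=; first by rewrite in_nil orbF.
by rewrite IH in_setU1 in_cons orbA [(_ == _) || _]orbC.
Qed.

Lemma last_coll (n : nat) (S : {set 'I_n}) w s : last w s \in S -> coll S (w :: s).
Proof. by move=> h; apply: (@has_coll _ S S) => //; apply/hasP; exists (last w s); rewrite ?mem_last. Qed.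

(** Distinct paths separate somewhere, and a common last pick is then a coincidence after or at the
    separation. Equal end points reduce to equal last picks because a permutation is injective. *)
Lemma pcoll_last (n : nat) (S : {set 'I_n}) v s v' s' : size s = size s' ->
  v :: s != v' :: s' -> last v s = last v' s' -> pcoll S (v :: s) (v' :: s').
Proof.
elim: s s' v v' S => [|w s IH] [|w' s'] v v' S //=.
  by move=> _; rewrite eqseq_cons eqxx andbT => /eqP.
move=> [hs]; rewrite eqseq_cons; case: (eqVneq v v') => [_ /= ne e|vv _ e].
  by have := IH _ _ _ (v |: S) hs ne e => /= ->; rewrite !orbT.
set S1 := v |: _.
suff h : coll (addset S1 (w :: s)) (w' :: s') by rewrite -/(coll _ (w' :: s')) h !orbT.
by apply: last_coll; rewrite mem_addset -e mem_last orbT.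
Qed.

Section Annealed.
Variables (R : realFieldType) (n : nat) (P : 'I_n -> 'I_n -> R).
Hypothesis P_ge0 : forall x v, 0 <= P x v.
Hypothesis P_row : forall x, \sum_v P x v = 1.
Hypothesis P_col : forall v, \sum_x P x v = 1.
Implicit Types (p q : 'S_n) (x y z v : 'I_n) (s : seq 'I_n) (S T D K : {set 'I_n}).
Local Notation ex := (ex P).
Local Notation nag := (nag R).

(** The image of [v] is uniform over at least [n - r] vertices, and a given [w] receives total mass
    1 from all vertices, the columns of [P] being normalised. *)
Lemma annealed_step p0 D S v r : v \notin D -> (#|D| <= r)%N -> (#|S| <= r)%N ->
  (r < n)%N ->
  \sum_(q | agree D p0 q) \sum_(w in S) P (q v) w <= (r%:R / (n - r)%:R) * nag D p0.
Proof.
move=> vD Dr Sr rn.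
have nr0 : 0 < (n - r)%:R :> R by rewrite ltr0n subn_gt0.
rewrite mulrAC ler_pdivlMr //.
apply: le_trans (_ : _ * (n - #|D|)%:R <= _).
  apply: ler_wpM2l; last by rewrite ler_nat leq_sub2l.
  by apply: sumr_ge0 => q _; apply: sumr_ge0.
have g0 z : 0 <= \sum_(w in S) P z w by apply: sumr_ge0.
apply: le_trans (agree_swap p0 g0 vD) _.
rewrite mulrC ler_wpM2r ?(ltW (nag_gt0 _ _ _)) //.
rewrite exchange_big /=; under eq_bigr do rewrite P_col.
by rewrite sumr_const ler_nat.
Qed.

(** Principle of deferred decisions. [D] contains the vertices whose images are revealed, [S] those
    seen, and [v] is the current pick, seen but not revealed. Until the first collision each step
    reveals one new image and pays [c] times the probability of picking in [S]; [G] is the payoff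
    when no collision occurs. [K] is a reserve of seen vertices kept unrevealed, from which another
    walk can start later. *)
Lemma annealed (r r' : nat) K (c g : R) (G : 'S_n -> {set 'I_n} -> 'I_n -> R) :
  0 <= c -> 0 <= g -> (r' <= r)%N -> (r < n)%N ->
  (forall p0 D S v, D \subset S -> K \subset S -> [disjoint K & D] ->
    v \in S -> v \notin D -> v \notin K -> (#|S| <= r')%N ->
    \sum_(q | agree D p0 q) G q S (q v) <= g * nag D p0) ->
  forall k p0 D S v, D \subset S -> K \subset S -> [disjoint K & D] ->
    v \in S -> v \notin D -> v \notin K -> (#|S| + k <= r')%N ->
  \sum_(q | agree D p0 q) ex q k (q v) (fun s => if coll S s then c else
     G q (addset S s) (endp q (q v) s)) <=
  (g + k%:R * (c * (r%:R / (n - r)%:R))) * nag D p0.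
Proof.
move=> c0 g0 rr rn hG; elim=> [|k IH] p0 D S v DS KS KD vS vD vK Sr.
  by rewrite mul0r addr0 hG // -[X in (X <= _)%N]addn0.
have Sr' : (#|S| <= r)%N by apply: leq_trans rr; apply: leq_trans Sr; rewrite leq_addr.
pose E q w := ex q k (q w) (fun s => if coll (w |: S) s then c else
  G q (addset (w |: S) s) (endp q (q w) s)).
have eqE q : ex q k.+1 (q v) (fun s => if coll S s then c else
     G q (addset S s) (endp q (q v) s)) =
  c * \sum_(w in S) P (q v) w + \sum_(w | w \notin S) P (q v) w * E q w.
  rewrite exS (bigID (fun w => w \in S)) /= mulr_sumr; congr (_ + _).
    apply: eq_bigr => w wS; rewrite mulrC -[X in _ = X * _](ex_cst P_row q k (q w)).
    by congr (_ * _); apply: ex_eq => // s _; rewrite wS.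
  apply: eq_bigr => w wS; congr (_ * _).
  by apply: ex_eq => // s _; rewrite (negbTE wS).
under eq_bigr do rewrite eqE.
rewrite big_split /= -mulr_sumr.
set a := r%:R / _; have -> : (g + k.+1%:R * (c * a)) * nag D p0 =
  c * (a * nag D p0) + (g + k%:R * (c * a)) * nag D p0 by rewrite -natr1; ring.
apply: lerD.
  rewrite ler_wpM2l // annealed_step // (leq_trans _ Sr') //.
  exact: subset_leq_card.
apply: (agree_avg (D' := v |: D)); first exact: subsetU1.
move=> p1 pp1.
have -> : \sum_(q | agree (v |: D) p1 q) \sum_(w | w \notin S) P (q v) w * E q w =
  \sum_(w | w \notin S) P (p1 v) w * \sum_(q | agree (v |: D) p1 q) E q w.
  rewrite exchange_big /=; apply: eq_bigr => w _; rewrite mulr_sumr.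
  by apply: eq_bigr => q /agreeP ->; rewrite ?setU11.
set b := _ + _.
have b0 : 0 <= b * nag (v |: D) p1.
  by rewrite mulr_ge0 ?(ltW (nag_gt0 _ _ _)) // addr_ge0 ?mulr_ge0 ?invr_ge0.
apply: le_trans (_ : \sum_(w | w \notin S) P (p1 v) w * (b * nag (v |: D) p1) <= _).
  apply: ler_sum => w wS; apply: ler_wpM2l => //; apply: IH.
  - by rewrite subUset sub1set !inE vS orbT /= (subset_trans DS) // subsetU1.
  - by rewrite (subset_trans KS) // subsetU1.
  - by rewrite -setI_eq0 setIUr setU_eq0 !setI_eq0 KD andbT disjoint_sym disjoints1.
  - by rewrite setU11.
  - rewrite !inE negb_or; apply/andP; split.
      by apply: contraNneq wS => ->.
    by apply: contra wS; apply: (subsetP DS).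
  - by apply: contra wS; apply: (subsetP KS).
  - by rewrite cardsU1 wS /= -addnA add1n -addnS.
rewrite -mulr_suml ler_piMl // -(P_row (p1 v)) [leRHS](bigID (fun w => w \in S)) /=.
by rewrite lerDr sumr_ge0.
Qed.

Lemma annealed_coll (r k : nat) p0 D S v : (r < n)%N ->
  D \subset S -> v \in S -> v \notin D -> (#|S| + k <= r)%N ->
  \sum_(q | agree D p0 q) ex q k (q v) (fun s => (coll S s)%:R) <=
  k%:R * (r%:R / (n - r)%:R) * nag D p0.
Proof.
move=> rn DS vS vD Sr.
have := @annealed r r set0 1 0 (fun _ _ _ => 0) ler01 (lexx _) (leqnn _) rn _
  k p0 D S v DS (sub0set _) _ vS vD _ Sr.
rewrite add0r mul1r; move=> h; apply: le_trans (h _ _ _).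
- by apply: ler_sum => q _; apply: ex_le => // s _; case: coll.
- by move=> *; rewrite mul0r big1.
- by rewrite -setI_eq0 set0I.
- by rewrite inE.
Qed.

(** While the walks coincide, one image is revealed per step and two picks must be fresh. Once they
    separate, the first walk is run to its end with the pick of the second one in the reserve [K],
    then the second walk is run from the enlarged seen set. The factor 4 per step leaves room in
    both regimes. *)
Lemma annealed_pcoll (r k : nat) p0 D S v : (r < n)%N ->
  D \subset S -> v \in S -> v \notin D -> (#|S| + k.*2 <= r)%N ->
  \sum_(q | agree D p0 q) ex q k (q v) (fun s =>
    ex q k (q v) (fun s' => (pcoll S s s')%:R)) <=
  k.*2.*2%:R * (r%:R / (n - r)%:R) * nag D p0.
Proof.
move=> rn; set a := r%:R / _.
have a0 : 0 <= a by rewrite mulr_ge0 ?invr_ge0.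
elim: k p0 D S v => [|k IH] p0 D S v DS vS vD Sr.
  by rewrite mul0r mul0r big1.
pose c2 : R := k.*2%:R * a.
have c20 : 0 <= c2 by rewrite mulr_ge0.
have Sr0 : (#|S| + k.+1 <= r)%N.
  by apply: leq_trans Sr; rewrite leq_add2l -addnn -[X in (X <= _)%N]addn0 leq_add2l.
have SrS : (#|S| <= r)%N by apply: leq_trans Sr0; rewrite leq_addr.
have Dr : (#|D| <= r)%N by apply: leq_trans (subset_leq_card DS) SrS.
pose E q w w' := ex q k (q w) (fun s => ex q k (q w') (fun s' =>
  (if w == w' then pcoll (w |: S) s s' else
   let S1 := w |: (w' |: S) in coll S1 s || coll (addset S1 s) s')%:R)).
pose b : R := k.*2.*2%:R * a.
have b0 : 0 <= b by rewrite mulr_ge0.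
have step q : ex q k.+1 (q v) (fun s => ex q k.+1 (q v) (fun s' => (pcoll S s s')%:R))
   <= 2 * \sum_(w in S) P (q v) w +
      \sum_(w | w \notin S) \sum_(w' | w' \notin S) P (q v) w * P (q v) w' * E q w w'.
  have -> : ex q k.+1 (q v) (fun s => ex q k.+1 (q v) (fun s' => (pcoll S s s')%:R))
    = \sum_w \sum_w' P (q v) w * P (q v) w' * ex q k (q w) (fun s => ex q k (q w') (fun s' =>
       (pcoll S (w :: s) (w' :: s'))%:R)).
    rewrite exS; apply: eq_bigr => w _; rewrite -exZ.
    under [LHS]ex_eq => s _ do rewrite exS mulr_sumr.
    rewrite ex_sum; apply: eq_bigr => w' _; rewrite -exZ.
    by apply: ex_eq => // s _; rewrite mulrA.
  rewrite (bigID (fun w => w \in S)) /= mulr_natl mulr2n -addrA.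
  apply: lerD.
    apply: ler_sum => w wS; apply: le_trans (_ : \sum_w' P (q v) w * P (q v) w' <= _).
      apply: ler_sum => w' _; rewrite ler_piMr ?mulr_ge0 //.
      rewrite -[leRHS](ex_cst P_row q k (q w)); apply: ex_le => // s _.
      by rewrite -[leRHS](ex_cst P_row q k (q w')); apply: ex_le => // s' _; rewrite lern1 leq_b1.
    by rewrite -mulr_sumr P_row mulr1.
  apply: le_trans (_ : \sum_(w | w \notin S) (P (q v) w * (\sum_(w' in S) P (q v) w') +
     \sum_(w' | w' \notin S) P (q v) w * P (q v) w' * E q w w') <= _).
    apply: ler_sum => w wS; rewrite (bigID (fun w => w \in S)) /=; apply: lerD.
      rewrite mulr_sumr; apply: ler_sum => w' w'S; rewrite ler_piMr ?mulr_ge0 //.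
      rewrite -[leRHS](ex_cst P_row q k (q w)); apply: ex_le => // s _.
      by rewrite -[leRHS](ex_cst P_row q k (q w')); apply: ex_le => // s' _; rewrite lern1 leq_b1.
    apply: ler_sum => w' w'S; apply: ler_wpM2l; first by rewrite mulr_ge0.
    apply: ex_le => // s _; apply: ex_le => // s' _.
    by rewrite /= (negbTE wS) (negbTE w'S).
  rewrite big_split /= lerD2r -mulr_suml ler_piMl ?sumr_ge0 //.
  rewrite -(P_row (q v)) [leRHS](bigID (fun w => w \in S)) /=.
  by rewrite lerDr sumr_ge0.
apply: le_trans (ler_sum _ _) _; first by move=> q _; exact: step.
rewrite big_split /= -mulr_sumr.
have -> : k.+1.*2.*2%:R * a * nag D p0 =
  2 * (a * nag D p0) + (2 * a + b) * nag D p0.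
  by rewrite /b -!muln2 !natrM -natr1; ring.
apply: lerD; first by rewrite ler_wpM2l // annealed_step.
apply: (agree_avg (D' := v |: D)); first exact: subsetU1.
move=> p1 pp1.
have -> : \sum_(q | agree (v |: D) p1 q) \sum_(w | w \notin S) \sum_(w' | w' \notin S)
    P (q v) w * P (q v) w' * E q w w' =
  \sum_(w | w \notin S) \sum_(w' | w' \notin S)
    P (p1 v) w * P (p1 v) w' * \sum_(q | agree (v |: D) p1 q) E q w w'.
  rewrite exchange_big /=; apply: eq_bigr => w _.
  rewrite exchange_big /=; apply: eq_bigr => w' _; rewrite mulr_sumr.
  by apply: eq_bigr => q /agreeP ->; rewrite ?setU11.
have hE w w' : w \notin S -> w' \notin S ->
    \sum_(q | agree (v |: D) p1 q) E q w w' <= b * nag (v |: D) p1.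
  move=> wS w'S.
  have DS' : v |: D \subset w |: S.
    by rewrite subUset sub1set !inE vS orbT /= (subset_trans DS) // subsetU1.
  have wD z : z \notin S -> z \notin v |: D.
    move=> zS; rewrite !inE negb_or; apply/andP; split.
      by apply: contraNneq zS => ->.
    by apply: contra zS; apply: (subsetP DS).
  have Dw := wD w wS; have Dw' := wD w' w'S.
  rewrite /E; case: (eqVneq w w') => [<-|ww'].
    apply: IH; rewrite ?setU11 //.
    rewrite cardsU1 wS /= -addnA; apply: leq_trans Sr.
    by rewrite addnCA leq_add2l doubleS -add2n leq_add2r.
  set S1 := w |: (w' |: S).
  have S1c : (#|S1| = #|S| + 2)%N.
    by rewrite !cardsU1 !inE negb_or ww' w'S wS addnA addnC.
  have kr : (k <= r)%N by apply: leq_trans Sr0; rewrite -addSnnS leq_addl.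
  pose G q (T : {set 'I_n}) (z : 'I_n) := ex q k (q w') (fun s' => (coll T s')%:R).
  have hG p2 D0 T z : D0 \subset T -> [set w'] \subset T -> [disjoint [set w'] & D0] ->
      z \in T -> z \notin D0 -> z \notin [set w'] -> (#|T| <= r - k)%N ->
      \sum_(q | agree D0 p2 q) G q T (q z) <= k%:R * a * nag D0 p2.
    rewrite sub1set disjoints1 => DT w'T w'D _ _ _ Tr.
    apply: annealed_coll => //.
    by rewrite addnC -leq_subRL.
  have ka0 : 0 <= k%:R * a by rewrite mulr_ge0.
  have := annealed ler01 ka0 (leq_subr k r) rn hG (k := k) p1 (D := v |: D) (S := S1) (v := w).
  rewrite mul1r; move=> h; apply: le_trans (le_trans (h _ _ _ _ _ _ _) _).
  - apply: ler_sum => q _; apply: ex_le => // s _.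
    rewrite /=; case: (coll S1 s) => /=.
      by rewrite -[leRHS](ex_cst P_row q k (q w')); apply: ex_le => // s' _; rewrite lern1 leq_b1.
    by apply: ex_le.
  - by rewrite (subset_trans DS') // setUS // subsetU1.
  - by rewrite sub1set !inE eqxx orbT.
  - by rewrite disjoints1.
  - by rewrite setU11.
  - by [].
  - by rewrite inE.
  - rewrite S1c; move: Sr kr; rewrite -!muln2; move: #|S| => m; clear; lia.
  rewrite ler_wpM2r ?(ltW (nag_gt0 _ _ _)) // -mulrDl ler_wpM2r //.
  by rewrite -natrD addnn ler_nat -[leqRHS]addnn leq_addr.
apply: le_trans (_ : b * nag (v |: D) p1 <= _); last first.
  by rewrite ler_wpM2r ?(ltW (nag_gt0 _ _ _)) // lerDr mulr_ge0.
set bn := b * _; have bn0 : 0 <= bn by rewrite mulr_ge0 ?(ltW (nag_gt0 _ _ _)).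
have le1 : \sum_(w | w \notin S) P (p1 v) w <= 1.
  rewrite -(P_row (p1 v)) [leRHS](bigID (fun w => w \in S)) /=.
  by rewrite lerDr sumr_ge0.
apply: le_trans (_ : \sum_(w | w \notin S) P (p1 v) w * bn <= _); last first.
  by rewrite -mulr_suml ler_piMl.
apply: ler_sum => w wS.
apply: le_trans (_ : \sum_(w' | w' \notin S) P (p1 v) w * (P (p1 v) w' * bn) <= _).
  by apply: ler_sum => w' w'S; rewrite mulrA ler_wpM2l ?hE // mulr_ge0.
by rewrite -mulr_sumr ler_wpM2l // -mulr_suml ler_piMl.
Qed.

End Annealed.

(** * Exploration of the ball around a vertex *)

Section Explore.
Variables (R : realFieldType) (n : nat) (P : 'I_n -> 'I_n -> R).
Hypothesis P_ge0 : forall x v, 0 <= P x v.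
Hypothesis P_row : forall x, \sum_v P x v = 1.
Variable Delta : nat.
Hypothesis P_supp_row : forall x, (#|[set v | P x v != 0%R]| <= Delta)%N.
Hypothesis P_supp_col : forall v, (#|[set x | P x v != 0%R]| <= Delta)%N.
Hypothesis P_half : forall x v, P x v <= 2^-1.
Implicit Types (p q : 'S_n) (x y z v : 'I_n) (s : seq 'I_n) (S T D K : {set 'I_n}).
Local Notation ex := (ex P).
Local Notation nag := (nag R).

Definition supp z : {set 'I_n} := [set v | P z v != 0].

Definition children p (j : nat) v (w : R) :=
  [seq (j, (v', w * P (p v) v')) | v' <- enum (supp (p v))].

(* An item [(j, (v, w))] is a vertex [v], reached with path weight [w], that
   still has [j] levels to go.  A queried vertex whose children meet the seen
   set is dropped; the last component counts these dead vertices. *)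
Fixpoint dfs p fuel (todo : seq (nat * ('I_n * R))) S :
    seq ('I_n * R) * {set 'I_n} * nat :=
  if fuel is f.+1 then
    match todo with
    | [::] => ([::], S, 0%N)
    | (j, (v, w)) :: td =>
      if j is j'.+1 then
        if [disjoint supp (p v) & S] then
          dfs p f (children p j' v w ++ td) (S :|: supp (p v))
        else let r := dfs p f td S in (r.1, r.2.+1)
      else let r := dfs p f td S in ((v, w) :: r.1.1, r.1.2, r.2)
    end
  else ([::], S, 0%N).

Definition verts (todo : seq (nat * ('I_n * R))) := [seq i.2.1 | i <- todo].

Definition wf_todo todo S := uniq (verts todo) /\ {subset verts todo <= S}.

Lemma verts_children p j v w : verts (children p j v w) = enum (supp (p v)).
Proof. by rewrite /verts -map_comp map_id_in. Qed.

Lemma wf_cons j v w td S : wf_todo ((j, (v, w)) :: td) S ->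
  [/\ v \in S, v \notin verts td & wf_todo td S].
Proof.
move=> [/= /andP[vt ut] sub]; split=> //; first by apply: sub; rewrite inE eqxx.
by split=> // u ut'; apply: sub; rewrite inE ut' orbT.
Qed.

Lemma wf_children p j v w td S : wf_todo td S -> [disjoint supp (p v) & S] ->
  wf_todo (children p j v w ++ td) (S :|: supp (p v)).
Proof.
move=> [ut sub] dis; split.
  rewrite /verts map_cat -/(verts td) -/(verts _) verts_children cat_uniq enum_uniq ut.
  rewrite andbT /=; apply/hasPn => u /sub uS; rewrite /= mem_enum.
  by apply: contraL uS => /(disjointFr dis) ->.
move=> u; rewrite /verts map_cat mem_cat -/(verts td) -/(verts (children _ _ _ _)).
rewrite verts_children mem_enum in_setU => /orP[->|/sub ->] //; exact: orbT.
Qed.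

Lemma dfs_S p f todo S : S \subset (dfs p f todo S).1.2.
Proof.
elim: f todo S => //= f IH [|[[|j] [v w]] td] S //=.
by case: ifP => _ //=; rewrite (subset_trans _ (IH _ _)) // subsetUl.
Qed.

(** Children join the queue only if all of them are unseen, so a seen vertex that is not waiting
    never comes back. *)
Lemma dfs_F p f todo S u : wf_todo todo S -> u \in S -> u \notin verts todo ->
  u \notin [seq i.1 | i <- (dfs p f todo S).1.1].
Proof.
elim: f todo S => //= f IH [|[[|j] [v w]] td] S //= wf uS.
  have [vS vt wf'] := wf_cons wf.
  rewrite !inE !negb_or => /andP[-> ut]; exact: IH.
have [vS vt wf'] := wf_cons wf.
rewrite inE negb_or => /andP[uv ut]; case: ifP => dis; last exact: IH.
apply: IH; first exact: wf_children.
  by rewrite inE uS.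
rewrite /verts map_cat mem_cat -/(verts td) -/(verts (children _ _ _ _)).
rewrite verts_children mem_enum negb_or ut andbT.
by apply: contraL uS => /(disjointFr dis) ->.
Qed.

Lemma dfs_F_sub p f todo S : wf_todo todo S ->
  {subset [seq i.1 | i <- (dfs p f todo S).1.1] <= (dfs p f todo S).1.2}.
Proof.
elim: f todo S => //= f IH [|[[|j] [v w]] td] S //= wf;
  have [vS vt wf'] := wf_cons wf.
  move=> u; rewrite inE => /orP[/eqP->|]; last exact: IH.
  exact: (subsetP (dfs_S _ _ _ _)).
by case: ifP => dis; apply: IH => //; apply: wf_children.
Qed.

Lemma dfs_F_uniq p f todo S : wf_todo todo S ->
  uniq [seq i.1 | i <- (dfs p f todo S).1.1].
Proof.
elim: f todo S => //= f IH [|[[|j] [v w]] td] S //= wf;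
  have [vS vt wf'] := wf_cons wf.
  by rewrite IH // andbT dfs_F.
by case: ifP => dis; apply: IH => //; apply: wf_children.
Qed.

(* [X] collects the frontier vertices already emitted: they are seen but never
   queried. *)
Lemma dfs_agree_gen p q f todo S (X : pred 'I_n) : wf_todo todo S ->
  (forall v, v \in verts todo -> ~~ X v) -> (forall v, X v -> v \in S) ->
  (forall v, v \in (dfs p f todo S).1.2 -> ~~ X v ->
     v \notin [seq i.1 | i <- (dfs p f todo S).1.1] -> p v = q v) ->
  dfs q f todo S = dfs p f todo S.
Proof.
elim: f todo S X => //= f IH [|[[|j] [v w]] td] S X //= wf hX XS h;
  have [vS vt wf'] := wf_cons wf.
  rewrite (IH _ _ (fun u => X u || (u == v))) //.
  - move=> u ut; rewrite negb_or hX ?inE ?ut ?orbT //=.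
    by apply: contraNneq vt => <-.
  - by move=> u /orP[/XS//|/eqP->].
  - move=> u uS; rewrite negb_or => /andP[uX uv] uF; apply: h => //.
    by rewrite inE negb_or uv.
have vX : ~~ X v by apply: hX; rewrite inE eqxx.
have tX u : u \in verts td -> ~~ X u by move=> ut; apply: hX; rewrite inE ut orbT.
have pq : p v = q v.
  move: h; case: ifP => dis h; last by apply: h; rewrite ?(subsetP (dfs_S _ _ _ _)) ?dfs_F.
  apply: h => //; first by rewrite (subsetP (dfs_S _ _ _ _)) // in_setU vS.
  apply: dfs_F; [exact: wf_children | by rewrite in_setU vS |].
  rewrite /verts map_cat mem_cat -/(verts td) -/(verts (children _ _ _ _)).
  rewrite verts_children mem_enum negb_or vt andbT.
  by apply: contraL vS => /(disjointFr dis) ->.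
rewrite /children -pq; move: h; case: ifP => dis h; last first.
  by rewrite (IH _ _ X).
apply: (IH _ _ X) => //; first exact: wf_children.
  move=> u; rewrite /verts map_cat mem_cat -/(verts td) -/(verts (children _ _ _ _)).
  rewrite verts_children mem_enum => /orP[us|]; last exact: tX.
  by apply/negP => /XS; rewrite (disjointFr dis us).
by move=> u /XS uS; rewrite in_setU uS.
Qed.

(** The exploration never evaluates [p] on its frontier, whose images are therefore free to be
    resampled. *)
Lemma dfs_agree p q f todo S : wf_todo todo S ->
  (forall v, v \in (dfs p f todo S).1.2 ->
     v \notin [seq i.1 | i <- (dfs p f todo S).1.1] -> p v = q v) ->
  dfs q f todo S = dfs p f todo S.
Proof.
by move=> wf h; apply: (@dfs_agree_gen p q f todo S xpred0) => // v vS _; exact: h.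
Qed.

Lemma card_dfs_S p f todo S : (#|(dfs p f todo S).1.2| <= #|S| + f * Delta)%N.
Proof.
elim: f todo S => [|f IH] [|[[|j] [v w]] td] S //=; rewrite ?leq_addr //.
  by rewrite (leq_trans (IH _ _)) // leq_add2l leq_mul2r leqnSn orbT.
case: ifP => _; apply: (leq_trans (IH _ _)); last first.
  by rewrite leq_add2l leq_mul2r leqnSn orbT.
rewrite mulSn addnA leq_add2r (leq_trans (leq_card_setU _ _)) // leq_add2l.
exact: P_supp_row.
Qed.

(** Entries of [P] are at most 1/2, so each remaining level halves the weight at least; [b] is the
    resulting bound on the frontier. *)
Definition wt_todo (b : R) (todo : seq (nat * ('I_n * R))) :=
  forall i, i \in todo -> 0 <= i.2.2 /\ i.2.2 <= b * 2 ^+ i.1.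

Lemma wt_cons b i td : wt_todo b (i :: td) ->
  [/\ 0 <= i.2.2, i.2.2 <= b * 2 ^+ i.1 & wt_todo b td].
Proof.
move=> h; have [h1 h2] := h i (mem_head _ _); split=> // u ut.
by apply: h; rewrite inE ut orbT.
Qed.

Lemma wt_children b p j v w td : 0 <= w -> w <= b * 2 ^+ j.+1 -> wt_todo b td ->
  wt_todo b (children p j v w ++ td).
Proof.
move=> w0 wb wt i; rewrite mem_cat => /orP[/mapP[u _ ->]|]; last exact: wt.
rewrite /= mulr_ge0 //; split=> //.
apply: le_trans (ler_pM w0 (P_ge0 _ _) wb (P_half _ _)) _.
by rewrite exprS le_eqVlt; apply/orP; left; apply/eqP; field.
Qed.

Lemma dfs_wt b p f todo S i : wt_todo b todo ->
  i \in (dfs p f todo S).1.1 -> 0 <= i.2 /\ i.2 <= b.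
Proof.
elim: f todo S => //= f IH [|[[|j] [v w]] td] S //= /wt_cons[/= w0 wb wt].
  by rewrite inE => /orP[/eqP->/=|]; [move: wb; rewrite expr0 mulr1 | exact: IH].
by case: ifP => dis; apply: IH => //; apply: wt_children.
Qed.

Lemma sum_supp z (g : 'I_n -> R) :
  \sum_(v <- enum (supp z)) P z v * g v = \sum_v P z v * g v.
Proof.
rewrite big_enum [RHS](bigID (fun v => v \in supp z)) /= [X in _ + X]big1 ?addr0 //.
by move=> v; rewrite inE negbK => /eqP ->; rewrite mul0r.
Qed.

(** A potential: the mean of [phi] when every queued vertex is continued for its remaining levels.
    Expanding an item preserves it, and dropping one can only lower it when [phi] and the weights
    are nonnegative. *)
Definition val p (phi : 'I_n -> R) (todo : seq (nat * ('I_n * R))) :=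
  \sum_(i <- todo) i.2.2 * ex p i.1 (p i.2.1) (fun s => phi (endp p (p i.2.1) s)).

Lemma val_children p phi j v w td : val p phi (children p j v w ++ td) =
  val p phi ((j.+1, (v, w)) :: td).
Proof.
rewrite /val big_cat big_cons /=; congr (_ + _).
rewrite big_map /= (eq_bigr (fun v' => w * (P (p v) v' *
   ex p j (p v') (fun s => phi (endp p (p v') s))))); last by move=> u _; rewrite mulrA.
by rewrite -mulr_sumr sum_supp.
Qed.

Lemma dfs_val p phi b f todo S : (forall z, 0 <= phi z) -> wt_todo b todo ->
  \sum_(i <- (dfs p f todo S).1.1) i.2 * phi (p i.1) <= val p phi todo.
Proof.
move=> phi0.
have val0 td : wt_todo b td -> 0 <= val p phi td.
  move=> wt; rewrite /val big_seq; apply: sumr_ge0 => i /wt[w0 _].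
  by rewrite mulr_ge0 // ex_ge0.
elim: f todo S => [|f IH] [|[[|j] [v w]] td] S /=; rewrite ?big_nil; try exact: val0.
  by move=> /wt_cons[/= w0 wb wt]; rewrite /val !big_cons /= lerD2l IH.
move=> /[dup] wt' /wt_cons[/= w0 wb wt]; case: ifP => dis.
  by rewrite -val_children; apply: IH; apply: wt_children.
apply: le_trans (IH _ _ wt) _; rewrite [leRHS]/val big_cons lerDr.
by apply: mulr_ge0 => //; apply: ex_ge0.
Qed.

(** Fuel sufficient to empty the queue, since [1 + Delta * Delta.+1 ^ j <= Delta.+1 ^ j.+1]. *)
Definition cost (todo : seq (nat * ('I_n * R))) := (\sum_(i <- todo) Delta.+1 ^ i.1)%N.

(** Weight disappears only at dead vertices, each carrying at most 1/2; the fuel hypothesis rules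
    out truncation. *)
Lemma dfs_mass p f todo S : (cost todo <= f)%N ->
  (forall i, i \in todo -> 0 <= i.2.2 <= 2^-1) ->
  \sum_(i <- todo) i.2.2 <=
  \sum_(i <- (dfs p f todo S).1.1) i.2 + (dfs p f todo S).2%:R / 2.
Proof.
elim: f todo S => [|f IH] [|[[|j] [v w]] td] S /=; rewrite ?big_nil ?mul0r ?addr0 //.
- by rewrite /cost big_cons leqn0 addn_eq0 expn_eq0.
- by rewrite /cost big_cons leqn0 addn_eq0 expn_eq0.
- rewrite /cost !big_cons /= expn0 add1n ltnS -addrA lerD2l => c h; apply: IH => // i it.
  by apply: h; rewrite inE it orbT.
rewrite /cost !big_cons /= => c h.
have /andP[/= w0 w2] : 0 <= (j.+1, (v, w)).2.2 <= 2^-1 by apply: h; rewrite mem_head.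
have htd i : i \in td -> 0 <= i.2.2 <= 2^-1 by move=> it; apply: h; rewrite inE it orbT.
case: ifP => dis /=.
  apply: le_trans (IH _ _ _ _).
  - rewrite big_cat /= lerD2r big_map /=.
    rewrite (eq_bigr (fun v' => w * (P (p v) v' * 1))); last by move=> u _; rewrite mulr1.
    by rewrite -mulr_sumr sum_supp; under eq_bigr do rewrite mulr1; rewrite P_row mulr1.
  - rewrite /cost big_cat big_map /= big_const_seq count_predT iter_addn_0 -cardE.
    rewrite -ltnS (leq_trans _ c) // -addSn leq_add2r expnS mulSn -add1n.
    by rewrite leq_add ?expn_gt0 // mulnC leq_mul2r P_supp_row orbT.
  move=> i; rewrite mem_cat => /orP[/mapP[u _ ->]|]; last exact: htd.
  rewrite /= mulr_ge0 //=; apply: le_trans w2.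
  rewrite ler_piMr // -(P_row (p v)) (bigD1 u) //= lerDl.
  by apply: sumr_ge0 => *.
rewrite -natr1 mulrDl mul1r addrA addrC; apply: lerD => //.
apply: IH => //; rewrite /cost -ltnS (leq_trans _ c) //.
by rewrite -[X in (X <= _)%N]add1n leq_add2r expn_gt0.
Qed.

Local Notation dead p f td S := (dfs p f td S).2.

(** [v] dies when its image is a predecessor of [S], and each vertex of [S] has at most [Delta]
    predecessors. *)
Lemma dead_step p0 D S v r : v \notin D -> (#|D| <= r)%N -> (#|S| <= r)%N ->
  (r < n)%N ->
  \sum_(q | agree D p0 q) (~~ [disjoint supp (q v) & S])%:R <=
  ((r * Delta)%:R / (n - r)%:R) * nag D p0.
Proof.
move=> vD Dr Sr rn.
have nr0 : 0 < (n - r)%:R :> R by rewrite ltr0n subn_gt0.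
rewrite mulrAC ler_pdivlMr //.
apply: le_trans (_ : _ * (n - #|D|)%:R <= _).
  apply: ler_wpM2l; last by rewrite ler_nat leq_sub2l.
  by apply: sumr_ge0 => q _.
have g0 z : 0 <= (~~ [disjoint supp z & S])%:R :> R by [].
apply: le_trans (agree_swap p0 g0 vD) _.
rewrite mulrC ler_wpM2r ?(ltW (nag_gt0 _ _ _)) //.
apply: le_trans (_ : \sum_z \sum_(v in S) (v \in supp z)%:R <= _).
  apply: ler_sum => z _; case: (boolP [disjoint _ & _]) => [_|]; first exact: sumr_ge0.
  rewrite -setI_eq0 => /set0Pn[u]; rewrite inE => /andP[uz uS].
  by rewrite (bigD1 u) //= uz lerDl sumr_ge0.
rewrite exchange_big /=; apply: le_trans (_ : \sum_(v in S) Delta%:R <= _).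
  apply: ler_sum => u _; rewrite -natr_sum ler_nat.
  apply: leq_trans (P_supp_col u); rewrite -sum1_card [leqRHS]big_mkcond /=.
  by apply: leq_sum => z _; rewrite !inE.
by rewrite sumr_const -[X in X <= _]mulr_natl -natrM ler_nat leq_mul2r Sr orbT.
Qed.

Section DeadProb.
Variables (r : nat).
Hypothesis rn : (r < n)%N.
Let pi0 : R := (r * Delta)%:R / (n - r)%:R.

Let pi0_ge0 : 0 <= pi0. Proof. by rewrite mulr_ge0 // invr_ge0. Qed.

(* Revealing [p v] makes [v] dead with small conditional probability; otherwise
   the exploration goes on in a finer conditioning class. *)
Lemma dead_rec (a b : R) (A : nat -> bool) p0 D f j v w td S :
  0 <= a -> 0 <= b -> (forall k, A k -> A k.+1) ->
  D \subset S -> wf_todo ((j.+1, (v, w)) :: td) S ->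
  (forall u, u \in verts ((j.+1, (v, w)) :: td) -> u \notin D) ->
  (#|S| + f.+1 * Delta <= r)%N ->
  (forall p1 D' td' S', D' \subset S' -> wf_todo td' S' ->
     (forall u, u \in verts td' -> u \notin D') -> (#|S'| + f * Delta <= r)%N ->
     \sum_(q | agree D' p1 q) (A (dead q f td' S'))%:R <= a * nag D' p1) ->
  (forall p1 D' td' S', D' \subset S' -> wf_todo td' S' ->
     (forall u, u \in verts td' -> u \notin D') -> (#|S'| + f * Delta <= r)%N ->
     \sum_(q | agree D' p1 q) (A (dead q f td' S').+1)%:R <= b * nag D' p1) ->
  \sum_(q | agree D p0 q) (A (dead q f.+1 ((j.+1, (v, w)) :: td) S))%:R <=
  (a + b * pi0) * nag D p0.
Proof.
move=> a0 b0 hA DS wf dD Sr ha hb; have [vS vt wf'] := wf_cons wf.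
have vD : v \notin D by apply: dD; rewrite inE eqxx.
have Sr' : (#|S| + f * Delta <= r)%N by apply: leq_trans Sr; rewrite leq_add2l leq_mul2r leqnSn orbT.
have Sr0 : (#|S| <= r)%N by apply: leq_trans Sr'; rewrite leq_addr.
have Dr : (#|D| <= r)%N by apply: leq_trans Sr0; apply: subset_leq_card.
have DS' : v |: D \subset S by rewrite subUset sub1set vS.
have dD' u : u \in verts td -> u \notin v |: D.
  move=> ut; rewrite !inE negb_or dD ?inE ?ut ?orbT // andbT.
  by apply: contraNneq vt => <-.
apply: le_trans (_ : \sum_(q | agree D p0 q)
    ((A (dead q f.+1 ((j.+1, (v, w)) :: td) S))%:R - b * (~~ [disjoint supp (q v) & S])%:R) +
    b * (pi0 * nag D p0) <= _).
  rewrite sumrB -mulr_sumr -addrA lerDl addrC subr_ge0 ler_wpM2l //.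
  exact: dead_step.
rewrite mulrDl mulrA lerD2r.
apply: (agree_avg (D' := v |: D)); first exact: subsetU1.
move=> p1 pp1.
rewrite (eq_bigr (fun q => (A (if [disjoint supp (p1 v) & S] then
    dead q f ([seq (j, (v', w * P (p1 v) v')) | v' <- enum (supp (p1 v))] ++ td) (S :|: supp (p1 v))
  else (dead q f td S).+1))%:R - b * (~~ [disjoint supp (p1 v) & S])%:R)); last first.
  move=> q /agreeP h; rewrite (h v (setU11 _ _)) /=.
  by rewrite /children; case: ifP.
have cst c : \sum_(q | agree (v |: D) p1 q) c = c * nag (v |: D) p1.
  by rewrite nagE mulr_sumr; apply: eq_bigr => q _; rewrite mulr1.
rewrite sumrB cst.
case: (boolP [disjoint _ & _]) => dis /=; rewrite ?mulr0 ?mul0r ?subr0 ?mulr1.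
  apply: ha.
  - by rewrite (subset_trans DS') // subsetUl.
  - exact: (wf_children j w wf' dis).
  - move=> u; rewrite /verts map_cat mem_cat -/(verts td) => /orP[|]; last exact: dD'.
    rewrite -/(children p1 j v w) -/(verts _) verts_children mem_enum => us.
    by apply/negP => /(subsetP DS'); rewrite (disjointFr dis us).
  - apply: leq_trans Sr; rewrite mulSn addnA leq_add2r (leq_trans (leq_card_setU _ _)) //.
    by rewrite leq_add2l P_supp_row.
rewrite lerBlDr; apply: le_trans (hb p1 _ td S DS' wf' dD' Sr') _.
by rewrite lerDr mulr_ge0 // ltW // nag_gt0.
Qed.

Lemma dead_ge1 f p0 D td S : D \subset S -> wf_todo td S ->
  (forall u, u \in verts td -> u \notin D) -> (#|S| + f * Delta <= r)%N ->
  \sum_(q | agree D p0 q) (0 < dead q f td S)%N%:R <= (f%:R * pi0) * nag D p0.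
Proof.
have N0 D' p := ltW (nag_gt0 R D' p).
elim: f p0 D td S => [|f IH] p0 D td S DS wf dD Sr.
  by rewrite mul0r mul0r big1.
case: td wf dD => [|[[|j] [v w]] td] wf dD.
- rewrite big1 => [|q _]; last by [].
  by apply: mulr_ge0 (N0 _ _); apply: mulr_ge0.
- have [_ _ wf'] := wf_cons wf.
  have dD' u : u \in verts td -> u \notin D.
    by move=> ut; apply: dD; rewrite inE ut orbT.
  have Sr' : (#|S| + f * Delta <= r)%N.
    by apply: leq_trans Sr; rewrite leq_add2l leq_mul2r leqnSn orbT.
  apply: le_trans (IH p0 D td S DS wf' dD' Sr') _.
  by rewrite ler_wpM2r ?(ltW (nag_gt0 _ _ _)) // ler_wpM2r // ler_nat.
rewrite -natr1 mulrDl; apply: (@dead_rec _ 1 (fun k => (0 < k)%N)) => //.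
- by rewrite mulr_ge0.
- by move=> *; rewrite mul1r nagE.
Qed.

(** After a first death, the rest of the exploration still runs in a conditioning class and produces
    another one with probability at most [f%:R * pi0]. The square is what pays for the union bound
    over starting points. *)
Lemma dead_ge2 f p0 D td S : D \subset S -> wf_todo td S ->
  (forall u, u \in verts td -> u \notin D) -> (#|S| + f * Delta <= r)%N ->
  \sum_(q | agree D p0 q) (1 < dead q f td S)%N%:R <= (f%:R * pi0) ^+ 2 * nag D p0.
Proof.
have N0 D' p := ltW (nag_gt0 R D' p).
elim: f p0 D td S => [|f IH] p0 D td S DS wf dD Sr.
  by rewrite mul0r expr0n mul0r big1.
case: td wf dD => [|[[|j] [v w]] td] wf dD.
- rewrite big1 => [|q _]; last by [].
  by apply: mulr_ge0 (N0 _ _); apply: exprn_ge0; apply: mulr_ge0.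
- have [_ _ wf'] := wf_cons wf.
  have dD' u : u \in verts td -> u \notin D.
    by move=> ut; apply: dD; rewrite inE ut orbT.
  have Sr' : (#|S| + f * Delta <= r)%N.
    by apply: leq_trans Sr; rewrite leq_add2l leq_mul2r leqnSn orbT.
  apply: le_trans (IH p0 D td S DS wf' dD' Sr') _.
  rewrite ler_wpM2r ?(ltW (nag_gt0 _ _ _)) //.
  apply: lerXn2r; rewrite ?nnegrE; try exact: mulr_ge0.
  by rewrite ler_wpM2r // ler_nat.
apply: le_trans (_ : ((f%:R * pi0) ^+ 2 + f%:R * pi0 * pi0) * nag D p0 <= _).
  apply: (@dead_rec _ _ (fun k => (1 < k)%N)) => //.
  - by rewrite exprn_ge0 // mulr_ge0.
  - by rewrite mulr_ge0.
  - by move=> k; case: k.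
  - by move=> p1 D' td' S' h1 h2 h3 h4; apply: dead_ge1.
rewrite ler_wpM2r ?(ltW (nag_gt0 _ _ _)) // -natr1.
have -> : ((f%:R + 1) * pi0) ^+ 2 =
  (f%:R * pi0) ^+ 2 + f%:R * pi0 * pi0 + (f%:R * pi0 * pi0 + pi0 * pi0) by ring.
rewrite lerDl.
exact: addr_ge0 (mulr_ge0 (mulr_ge0 (ler0n _ _) pi0_ge0) pi0_ge0) (mulr_ge0 pi0_ge0 pi0_ge0).
Qed.

End DeadProb.
End Explore.

(** * Resampling the images of the frontier *)

Section Seeds.
Variables (R : realFieldType) (n : nat).
Hypothesis n_gt0 : (0 < n)%N.
Local Notation seed := {ffun 'I_n -> 'I_n}.
Implicit Types (p q : 'S_n) (v w y z : 'I_n) (S F : {set 'I_n}) (u : seed).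

Definition Eu (f : seed -> R) : R := #|{: seed}|%:R^-1 * \sum_u f u.

Lemma card_seed_neq0 : #|{: seed}|%:R != 0 :> R.
Proof. by rewrite card_ffun card_ord pnatr_eq0 expn_eq0 negb_and -lt0n n_gt0. Qed.

Lemma Eu_le f g : (forall u, f u <= g u) -> Eu f <= Eu g.
Proof. by move=> h; rewrite ler_wpM2l ?invr_ge0 // ler_sum. Qed.

Lemma Eu_eq f g : (forall u, f u = g u) -> Eu f = Eu g.
Proof. by move=> h; congr (_ * _); apply: eq_bigr. Qed.

Lemma EuD f g : Eu (fun u => f u + g u) = Eu f + Eu g.
Proof. by rewrite /Eu big_split mulrDr. Qed.

Lemma EuZ c f : Eu (fun u => c * f u) = c * Eu f.
Proof. by rewrite /Eu -mulr_sumr mulrCA. Qed.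

Lemma Eu_sum (I : Type) (r : seq I) (A : pred I) (f : I -> seed -> R) :
  Eu (fun u => \sum_(i <- r | A i) f i u) = \sum_(i <- r | A i) Eu (f i).
Proof. by rewrite /Eu exchange_big -mulr_sumr. Qed.

Lemma Eu_cst c : Eu (fun=> c) = c.
Proof. by rewrite /Eu sumr_const -[c *+ _]mulr_natl mulrA mulVf ?mul1r ?card_seed_neq0. Qed.

Lemma EuB f g : Eu (fun u => f u - g u) = Eu f - Eu g.
Proof. by rewrite /Eu sumrB mulrBr. Qed.

Definition upd u v z : seed := [ffun y => if y == v then z else u y].

(** Redrawing one seed preserves the uniform law: exchanging the old value with the new one is an
    involution of the pairs formed by a seed function and a value. *)
Lemma Eu_upd v f : Eu f = Eu (fun u => n%:R^-1 * \sum_z f (upd u v z)).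
Proof.
rewrite EuZ /Eu mulrCA; congr (_ * _).
pose h (uz : seed * 'I_n) := (upd uz.1 v uz.2, uz.1 v).
have hK : involutive h.
  move=> [u z]; rewrite /h /=; congr (_, _); last by rewrite ffunE eqxx.
  by apply/ffunP => y; rewrite !ffunE; case: eqP => // ->.
have <- : \sum_u \sum_(z : 'I_n) f u = \sum_u \sum_z f (upd u v z).
  by rewrite !pair_bigA /= (reindex_inj (inv_inj hK)).
under [X in _ = _ * X]eq_bigr do rewrite sumr_const card_ord -mulr_natl.
by rewrite -mulr_sumr mulrA mulVf ?mul1r // pnatr_eq0 -lt0n.
Qed.

Lemma Eu_coord v (g : 'I_n -> R) :
  Eu (fun u => g (u v)) = n%:R^-1 * \sum_z g z.
Proof.
rewrite (Eu_upd v) -[RHS]Eu_cst; apply: Eu_eq => u.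
by congr (_ * _); apply: eq_bigr => z _; rewrite ffunE eqxx.
Qed.

Lemma Eu_coord2 v w (g : 'I_n -> 'I_n -> R) : v != w ->
  Eu (fun u => g (u v) (u w)) = n%:R^-1 * \sum_z (n%:R^-1 * \sum_y g z y).
Proof.
move=> vw; rewrite (Eu_upd w).
under Eu_eq => u do under eq_bigr => z _ do rewrite !ffunE eqxx (negbTE vw).
by rewrite (Eu_coord v (fun x => n%:R^-1 * \sum_z g x z)).
Qed.

Lemma Eu_prod (F : {set 'I_n}) (g : 'I_n -> 'I_n -> R) :
  Eu (fun u => \prod_(v in F) g v (u v)) = \prod_(v in F) (n%:R^-1 * \sum_z g v z).
Proof.
have n0 : n%:R != 0 :> R by rewrite pnatr_eq0 -lt0n.
rewrite [RHS]big_mkcond /=.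
rewrite (eq_bigr (fun v => \sum_z n%:R^-1 * (if v \in F then g v z else 1))); last first.
  move=> v _; case: ifP => _; rewrite -mulr_sumr //.
  by rewrite sumr_const card_ord mulVf.
rewrite bigA_distr_bigA /Eu mulr_sumr; apply: eq_bigr => u _.
rewrite big_split /= prodr_const card_ord card_ffun !card_ord natrX exprVn.
by rewrite -big_mkcond.
Qed.

End Seeds.

Section Swap.
Variables (R : realFieldType) (n : nat).
Hypothesis n_gt0 : (0 < n)%N.
Local Notation seed := {ffun 'I_n -> 'I_n}.
Implicit Types (p q : 'S_n) (v w y z : 'I_n) (S F : {set 'I_n}) (u : seed).
Local Notation Eu := (@Eu R n).

(** For admissible seeds this is the product of the disjoint transpositions exchanging [v] with
    [u v], for [v] in [F]. *)
Definition swap_fun F u y :=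
  if y \in F then u y else
  if [pick v in F | u v == y] is Some v then v else y.

Definition okseed S F u :=
  [forall v in F, u v \notin S] &&
  [forall v in F, forall w in F, (u v == u w) ==> (v == w)].

(** The identity is a default value for seeds that do not make [swap_fun] a bijection. *)
Definition swp F u : 'S_n :=
  odflt 1%g [pick s : 'S_n | [forall y, s y == swap_fun F u y]].

Lemma swap_funK S F u : F \subset S -> okseed S F u -> involutive (swap_fun F u).
Proof.
move=> /subsetP FS /andP[/forall_inP uS /forall_inP uI].
have inj v w : v \in F -> w \in F -> u v = u w -> v = w.
  by move=> vF wF e; apply/eqP; have /forall_inP/(_ w wF) := uI v vF; rewrite e eqxx.
move=> y; rewrite /swap_fun; case: (boolP (y \in F)) => yF.
  rewrite ifN; last by apply: contra (uS y yF); apply: FS.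
  case: pickP => [v /andP[vF /eqP/inj->//]|/(_ y)].
  by rewrite yF eqxx.
case: pickP => [v /andP[vF /eqP uv]|h]; first by rewrite vF.
by rewrite (negbTE yF); case: pickP => // v; rewrite h.
Qed.

Lemma swpE S F u y : F \subset S -> okseed S F u -> swp F u y = swap_fun F u y.
Proof.
move=> FS ok; rewrite /swp; case: pickP => [s /forallP/(_ y)/eqP //|].
move=> /(_ (perm (inv_inj (swap_funK FS ok)))) /negbT/forallP[] z.
by rewrite permE.
Qed.

Lemma swpF S F u v : F \subset S -> okseed S F u -> v \in F -> swp F u v = u v.
Proof. by move=> FS ok vF; rewrite (swpE _ FS ok) /swap_fun vF. Qed.

Lemma swp_out S F u y : F \subset S -> okseed S F u -> y \notin F ->
  y \notin u @: F -> swp F u y = y.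
Proof.
move=> FS ok yF yu; rewrite (swpE _ FS ok) /swap_fun (negbTE yF).
case: pickP => // v /andP[vF /eqP e]; case/negP: yu.
by apply/imsetP; exists v.
Qed.

Lemma swpK S F u : F \subset S -> okseed S F u -> (swp F u * swp F u)%g = 1%g.
Proof.
move=> FS ok; apply/permP => y; rewrite permM perm1 !(swpE _ FS ok).
exact: swap_funK ok y.
Qed.

Lemma swp_fix S F u y : F \subset S -> okseed S F u -> y \in S -> y \notin F ->
  swp F u y = y.
Proof.
move=> FS ok yS yF; apply: (swp_out FS ok) => //.
apply/imsetP => -[v vF e]; move: ok => /andP[/forall_inP/(_ v vF)].
by rewrite -e yS.
Qed.

(** The mean number of violations is at most [#|F| * (#|S| + #|F|) / n], hence at most one half. *)
Lemma Eu_okseed S F : (#|F| * (#|S| + #|F|) * 2 <= n)%N ->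
  2^-1 <= Eu (fun u => (okseed S F u)%:R).
Proof.
move=> hn; have n0 : 0 < n%:R :> R by rewrite ltr0n.
apply: le_trans (_ : 1 - Eu (fun u => \sum_(v in F) (u v \in S)%:R +
    \sum_(v in F) \sum_(w in F | w != v) (u v == u w)%:R) <= _).
  rewrite EuD !Eu_sum lerBrDl -lerBrDr.
  have -> : 1 - 2^-1 = 2^-1 :> R by field.
  apply: le_trans (_ : \sum_(v in F) (#|S|%:R / n%:R) +
     \sum_(v in F) (#|F|%:R / n%:R) <= _).
    apply: lerD; apply: ler_sum => v vF.
      rewrite (Eu_coord n_gt0 v (fun z => (z \in S)%:R)) mulrC ler_wpM2r ?invr_ge0 //.
      by rewrite -natr_sum ler_nat -sum1_card [leqRHS]big_mkcond.
    rewrite Eu_sum; apply: le_trans (_ : \sum_(w in F) n%:R^-1 <= _); last first.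
      by rewrite sumr_const -[X in X <= _]mulr_natl.
    rewrite [leLHS]big_mkcondr; apply: ler_sum => w wF.
    case: ifP => wv; last by rewrite invr_ge0.
    rewrite (Eu_coord2 n_gt0 (fun x y => (x == y)%:R)) 1?eq_sym //.
    rewrite (eq_bigr (fun=> n%:R^-1)); last first.
      move=> z _; rewrite (bigD1 z) //= eqxx big1 ?addr0 ?mulr1 // => y.
      by rewrite eq_sym => /negbTE ->.
    by rewrite sumr_const card_ord -[X in _ * X]mulr_natl divff ?mulr1 // gt_eqF.
  have cst c : \sum_(v in F) c = #|F|%:R * c :> R by rewrite sumr_const mulr_natl.
  rewrite !cst -mulrDr -mulrDl mulrA -natrD -natrM.
  by rewrite ler_pdivrMr // mulrC ler_pdivlMr // -natrM ler_nat.
rewrite -[X in X - _](Eu_cst n_gt0) -EuB; apply: Eu_le => u.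
case: (boolP (okseed S F u)) => [_|].
  rewrite gerBl addr_ge0 // !sumr_ge0 // => v _.
  by rewrite sumr_ge0.
rewrite /okseed negb_and subr_le0 => /orP[/forall_inPn[v vF]|/forall_inPn[v vF]].
  rewrite negbK => uS; apply: ler_wpDr.
    by apply: sumr_ge0 => *; apply: sumr_ge0.
  by rewrite (bigD1 v) //= uS lerDl sumr_ge0.
move=> /forall_inPn[w wF]; rewrite negb_imply => /andP[uvw vw].
apply: ler_wpDl; first exact: sumr_ge0.
rewrite (bigD1 v) //=; apply: ler_wpDr.
  by apply: sumr_ge0 => *; apply: sumr_ge0.
rewrite (bigD1 w) /=; last by rewrite wF eq_sym.
by rewrite uvw lerDl sumr_ge0.
Qed.

(* Swapping the images of the frontier with those of fresh seeds is, for each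
   fixed seed, an involution that preserves the exploration. *)
Lemma resample (Sx Fx : 'S_n -> {set 'I_n}) (G : 'S_n -> R) :
  (forall p, Fx p \subset Sx p) ->
  (forall p q, (forall v, v \in Sx p -> v \notin Fx p -> p v = q v) ->
     Sx q = Sx p /\ Fx q = Fx p) ->
  (forall p, (#|Fx p| * (#|Sx p| + #|Fx p|) * 2 <= n)%N) ->
  (forall p, 0 <= G p) ->
  \sum_p G p <= 2 * \sum_p Eu (fun u =>
    (okseed (Sx p) (Fx p) u)%:R * G (swp (Fx p) u * p)%g).
Proof.
move=> FS loc hn G0.
have -> : \sum_p Eu (fun u => (okseed (Sx p) (Fx p) u)%:R * G (swp (Fx p) u * p)%g) =
    \sum_p Eu (fun u => (okseed (Sx p) (Fx p) u)%:R * G p).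
  rewrite -!Eu_sum; apply: Eu_eq => u.
  pose phi p := if okseed (Sx p) (Fx p) u then (swp (Fx p) u * p)%g else p.
  have inv p : okseed (Sx p) (Fx p) u ->
      Sx (swp (Fx p) u * p)%g = Sx p /\ Fx (swp (Fx p) u * p)%g = Fx p.
    move=> ok; apply: loc => v vS vF.
    by rewrite permM (swp_fix (FS p) ok).
  have phiK : involutive phi.
    move=> p; rewrite /phi; case: (boolP (okseed (Sx p) (Fx p) u)) => ok.
      have [-> ->] := inv p ok; rewrite ok mulgA.
      by rewrite (swpK (FS p) ok) mul1g.
    by rewrite (negbTE ok).
  rewrite [RHS](reindex_inj (inv_inj phiK)); apply: eq_bigr => p _.
  rewrite /phi; case: (boolP (okseed (Sx p) (Fx p) u)) => ok.
    by have [-> ->] := inv p ok; rewrite ok.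
  by rewrite (negbTE ok) !mul0r.
(* The factor 2 compensates for the probability, at least one half, that the seeds are
   admissible. *)
rewrite mulr_sumr; apply: ler_sum => p _.
under Eu_eq do rewrite mulrC.
rewrite EuZ mulrCA ler_peMr // -ler_pdivrMl // mulr1.
exact: Eu_okseed.
Qed.

End Swap.

(** * The ball around a vertex: frontier, weights and dead branches *)

Section Ball.
Variables (R : realFieldType) (n : nat) (P : 'I_n -> 'I_n -> R).
Hypothesis P_ge0 : forall x v, 0 <= P x v.
Hypothesis P_row : forall x, \sum_v P x v = 1.
Hypothesis P_col : forall v, \sum_x P x v = 1.
Variable Delta : nat.
Hypothesis P_supp_row : forall x, (#|[set v | P x v != 0%R]| <= Delta)%N.
Hypothesis P_supp_col : forall v, (#|[set x | P x v != 0%R]| <= Delta)%N.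
Hypothesis P_half : forall x v, P x v <= 2^-1.
Variable h : nat.
Implicit Types (p q : 'S_n) (x y z v : 'I_n) (s : seq 'I_n) (S T D K : {set 'I_n}).
Local Notation ex := (ex P).
Local Notation dist := (dist P).
Local Notation hit := (hit P).
Local Notation seed := {ffun 'I_n -> 'I_n}.
Local Notation Eu := (@Eu R n).

Definition fuel := (Delta * Delta.+1 ^ h)%N.

(** The first pick requires no value of the permutation, so a frontier vertex ends a path of [h.+1]
    picks. *)
Definition root x := [seq (h, (v, P x v)) | v <- enum (supp P x)].

Definition ball x p := dfs P p fuel (root x) (supp P x).
Definition seen x p := (ball x p).1.2.
Definition front x p : {set 'I_n} := [set v in [seq i.1 | i <- (ball x p).1.1]].
Definition wgt x p v : R := \sum_(i <- (ball x p).1.1 | i.1 == v) i.2.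
Definition dead x p := (ball x p).2.
Definition ball_size := (Delta.+1 ^ h.+2)%N.

Lemma wf_root x : wf_todo (root x) (supp P x).
Proof.
have vE : verts (root x) = enum (supp P x) by rewrite /verts -map_comp map_id_in.
by split; rewrite vE ?enum_uniq // => v; rewrite mem_enum.
Qed.

Lemma wt_root x : wt_todo (2 ^- h.+1) (root x).
Proof.
move=> i /mapP[v _ ->] /=; split=> //.
have h0 : 2 ^+ h != 0 :> R by rewrite expf_neq0 // pnatr_eq0.
by rewrite exprS invfM mulfVK.
Qed.

Lemma front_seen x p : front x p \subset seen x p.
Proof.
by apply/subsetP => v; rewrite inE; apply: dfs_F_sub; exact: wf_root.
Qed.

Lemma ball_agree x p q :
  (forall v, v \in seen x p -> v \notin front x p -> p v = q v) ->
  ball x q = ball x p.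
Proof.
move=> hpq; apply: dfs_agree; first exact: wf_root.
by move=> v vS vF; apply: hpq => //; rewrite inE.
Qed.

Lemma fuel_size : (Delta + fuel * Delta <= ball_size)%N.
Proof.
rewrite /ball_size /fuel !expnS; set a := (Delta.+1 ^ h)%N.
have a0 : (0 < a)%N by rewrite expn_gt0.
by nia.
Qed.

Lemma card_seen x p : (#|seen x p| <= ball_size)%N.
Proof.
apply: leq_trans (card_dfs_S P_supp_row _ _ _ _) (leq_trans _ fuel_size).
by rewrite leq_add2r P_supp_row.
Qed.

Lemma card_front x p : (#|front x p| <= ball_size)%N.
Proof. exact: leq_trans (subset_leq_card (front_seen x p)) (card_seen x p). Qed.

Lemma sum_front x p (g : 'I_n -> R) :
  \sum_(v in front x p) wgt x p v * g v = \sum_(i <- (ball x p).1.1) i.2 * g i.1.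
Proof.
have -> : \sum_(v in front x p) wgt x p v * g v = \sum_v wgt x p v * g v.
  rewrite [RHS](bigID (fun v => v \in front x p)) /= [X in _ + X]big1 ?addr0 // => v.
  rewrite inE => vF; rewrite /wgt big_seq_cond big1 ?mul0r // => i /andP[iF /eqP iv].
  by case/negP: vF; apply/mapP; exists i.
under eq_bigr do rewrite /wgt mulr_suml.
rewrite (exchange_big_dep xpredT) //=; apply: eq_bigr => i _.
by rewrite (big_pred1 i.1) // => v; rewrite eq_sym.
Qed.

Lemma wgt_bound x p v : 0 <= wgt x p v <= 2 ^- h.+1.
Proof.
have wt i := @dfs_wt R n P P_ge0 P_half (2 ^- h.+1) p fuel (root x) (supp P x) i (@wt_root x).
have uF : uniq [seq i.1 | i <- (ball x p).1.1] by apply: dfs_F_uniq; exact: wf_root.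
rewrite /wgt -/(ball x p) in wt *.
elim: (ball x p).1.1 uF wt => [|i L IH] /=.
  by rewrite big_nil lexx invr_ge0 exprn_ge0.
move=> /andP[iL uL] wt; rewrite big_cons.
have wtL j : j \in L -> 0 <= j.2 /\ j.2 <= 2 ^- h.+1 by move=> jL; apply: wt; rewrite inE jL orbT.
have {}IH := IH uL wtL; case: eqP => // iv.
rewrite big_seq_cond big1 ?addr0; last first.
  move=> j /andP[jL /eqP jv]; case/negP: iL; apply/mapP; exists j => //.
  by rewrite iv jv.
by have [-> ->] := wt i (mem_head _ _).
Qed.

Lemma wgt_ge0 x p v : 0 <= wgt x p v.
Proof. by have /andP[] := wgt_bound x p v. Qed.

Lemma wgt_le x p v : wgt x p v <= 2 ^- h.+1.
Proof. by have /andP[] := wgt_bound x p v. Qed.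

(** The frontier, moved by [p], represents the part of the walk after [h.+1] steps that was not lost
    at a dead vertex. *)
Lemma front_val x p (phi : 'I_n -> R) : (forall z, 0 <= phi z) ->
  \sum_(v in front x p) wgt x p v * phi (p v) <=
  ex p h.+1 x (fun s => phi (endp p x s)).
Proof.
move=> phi0; rewrite (sum_front x p (fun v => phi (p v))).
apply: le_trans (dfs_val P_ge0 P_row P_half _ _ _ phi0 (@wt_root x)) _.
rewrite /val exS /root big_map /=.
by rewrite (sum_supp P x (fun v => ex p h (p v) (fun s => phi (endp p (p v) s)))).
Qed.

Lemma front_mass_le1 x p : \sum_(v in front x p) wgt x p v <= 1.
Proof.
have := @front_val x p (fun=> 1) (fun=> ler01); rewrite ex_cst //.
by under eq_bigr do rewrite mulr1.
Qed.

Lemma front_mass x p : 1 - (dead x p)%:R / 2 <= \sum_(v in front x p) wgt x p v.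
Proof.
have -> : \sum_(v in front x p) wgt x p v = \sum_(i <- (ball x p).1.1) i.2.
  rewrite (eq_bigr (fun v => wgt x p v * 1)) => [|v _]; last by rewrite mulr1.
  by rewrite (sum_front x p (fun=> 1)); apply: eq_bigr => i _; rewrite mulr1.
rewrite lerBlDr; apply: le_trans (dfs_mass P_ge0 P_row P_supp_row _ _ _ _).
- rewrite /root big_map /=.
  rewrite (eq_bigr (fun v => P x v * 1)) => [|v _]; last by rewrite mulr1.
  by rewrite sum_supp; under eq_bigr do rewrite mulr1; rewrite P_row.
- rewrite /cost big_map /= big_const_seq count_predT iter_addn_0 -cardE mulnC.
  by rewrite leq_mul2r P_supp_row orbT.
- by move=> i /mapP[v _ ->] /=; rewrite P_ge0 P_half.
Qed.

Definition pdead : R := fuel%:R * ((ball_size * Delta)%:R / (n - ball_size)%:R).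

Lemma sum_agree0 (Phi : 'S_n -> R) :
  \sum_(q | agree set0 1%g q) Phi q = \sum_q Phi q.
Proof. by apply: eq_bigl => q; apply/agreeP => v; rewrite inE. Qed.

Lemma nag0 : nag R set0 (1%g : 'S_n) = #|'S_n|%:R.
Proof. by rewrite nagE sum_agree0 sumr_const. Qed.

Lemma prob_dead1 x : (ball_size < n)%N ->
  \sum_p (0 < dead x p)%N%:R <= pdead * #|'S_n|%:R.
Proof.
move=> bn; rewrite -sum_agree0 -nag0; apply: dead_ge1 => //; first exact: sub0set.
- exact: wf_root.
- by move=> u _; rewrite inE.
- by apply: leq_trans fuel_size; rewrite leq_add2r P_supp_row.
Qed.

Lemma prob_dead2 x : (ball_size < n)%N ->
  \sum_p (1 < dead x p)%N%:R <= pdead ^+ 2 * #|'S_n|%:R.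
Proof.
move=> bn; rewrite -sum_agree0 -nag0; apply: dead_ge2 => //; first exact: sub0set.
- exact: wf_root.
- by move=> u _; rewrite inE.
- by apply: leq_trans fuel_size; rewrite leq_add2r P_supp_row.
Qed.

End Ball.

(** * Distance from a typical starting point *)

Section Variance.
Variables (R : realFieldType) (n : nat).
Hypothesis n_gt0 : (0 < n)%N.
Local Notation Eu := (@Eu R n).

(** Once [c] is centred, terms with distinct seeds are orthogonal and only the diagonal remains;
    centring does not increase the second moment. *)
Lemma Eu_var (F : {set 'I_n}) (w c : 'I_n -> R) :
  Eu (fun u => (\sum_(v in F) w v * c (u v) -
    (\sum_(v in F) w v) * (n%:R^-1 * \sum_z c z)) ^+ 2) <=
  (\sum_(v in F) w v ^+ 2) * (n%:R^-1 * \sum_z c z ^+ 2).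
Proof.
have n0 : n%:R != 0 :> R by rewrite pnatr_eq0 -lt0n.
set m := n%:R^-1 * _; pose d z := c z - m.
have sd : \sum_z d z = 0.
  by rewrite sumrB sumr_const card_ord -mulr_natl /m mulVKf ?subrr.
have sd2 : \sum_z d z ^+ 2 <= \sum_z c z ^+ 2.
  have -> : \sum_z d z ^+ 2 = \sum_z c z ^+ 2 - n%:R * m ^+ 2.
    rewrite (eq_bigr (fun z => c z ^+ 2 - (m *+ 2 * c z - m ^+ 2))); last first.
      by move=> z _; rewrite /d; ring.
    rewrite !sumrB -mulr_sumr sumr_const card_ord -[_ *+ n]mulr_natl.
    have -> : \sum_z c z = n%:R * m by rewrite /m mulVKf.
    ring.
  by rewrite gerBl mulr_ge0 // sqr_ge0.
have -> : Eu (fun u => (\sum_(v in F) w v * c (u v) - (\sum_(v in F) w v) * m) ^+ 2) =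
    Eu (fun u => \sum_(v in F) \sum_(v' in F) w v * w v' * (d (u v) * d (u v'))).
  apply: Eu_eq => u; rewrite mulr_suml -sumrB.
  rewrite (eq_bigr (fun v => w v * d (u v))); last by move=> v _; rewrite mulrBr.
  rewrite expr2 big_distrlr /=; apply: eq_bigr => v _; apply: eq_bigr => v' _.
  by rewrite mulrACA.
rewrite Eu_sum mulr_suml; apply: ler_sum => v vF.
rewrite Eu_sum (bigD1 v) //= [X in _ + X]big1 ?addr0; last first.
  move=> v' /andP[_ vv']; rewrite EuZ eq_sym in vv' *.
  rewrite (Eu_coord2 n_gt0 (fun x y => d x * d y)) //.
  by under eq_bigr do rewrite -mulr_sumr sd !mulr0; rewrite big1 ?mulr0.
rewrite EuZ (Eu_coord n_gt0 v (fun z => d z * d z)) -expr2.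
rewrite ler_wpM2l ?sqr_ge0 // ler_wpM2l ?invr_ge0 //.
Qed.

End Variance.

Section Typical.
Variables (R : realFieldType) (n : nat) (P : 'I_n -> 'I_n -> R).
Hypothesis n_gt0 : (0 < n)%N.
Hypothesis P_ge0 : forall x v, 0 <= P x v.
Hypothesis P_row : forall x, \sum_v P x v = 1.
Hypothesis P_col : forall v, \sum_x P x v = 1.
Variable Delta : nat.
Hypothesis P_supp_row : forall x, (#|[set v | P x v != 0%R]| <= Delta)%N.
Hypothesis P_supp_col : forall v, (#|[set x | P x v != 0%R]| <= Delta)%N.
Hypothesis P_half : forall x v, P x v <= 2^-1.
Variable h : nat.
Implicit Types (p q : 'S_n) (x y z v : 'I_n) (s : seq 'I_n) (S T D K : {set 'I_n}).
Local Notation ex := (ex P).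
Local Notation dist := (dist P).
Local Notation hit := (hit P).
Local Notation seed := {ffun 'I_n -> 'I_n}.
Local Notation Eu := (@Eu R n).
Local Notation front := (front P Delta h).
Local Notation seen := (seen P Delta h).
Local Notation wgt := (wgt P Delta h).
Local Notation dead := (dead P Delta h).
Local Notation M := (ball_size Delta h).
Hypothesis M_small : (M * (M + M) * 2 <= n)%N.

(** The only vertices whose images an admissible swap can change. *)
Definition moved x p (u : seed) : {set 'I_n} := front x p :|: u @: front x p.

Local Notation ok x p u := (okseed (seen x p) (front x p) u).
Local Notation swapped x p u := (swp (front x p) u * p)%g.

Lemma swapped_out x p u v : ok x p u -> v \notin moved x p u -> swapped x p u v = p v.
Proof.
move=> okx; rewrite in_setU negb_or => /andP[vF vu].
by rewrite permM (swp_out (front_seen P Delta h x p) okx).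
Qed.

Lemma swapped_front x p u v : ok x p u -> v \in front x p -> swapped x p u v = p (u v).
Proof. by move=> okx vF; rewrite permM (swpF (front_seen P Delta h x p) okx). Qed.

Lemma ball_swapped x p u : ok x p u ->
  ball P Delta h x (swapped x p u) = ball P Delta h x p.
Proof.
move=> okx; apply: ball_agree => v vS vF.
by rewrite permM (swp_fix (front_seen P Delta h x p) okx).
Qed.

Lemma front_swapped x p u : ok x p u -> front x (swapped x p u) = front x p.
Proof. by move=> okx; rewrite /(front _ _) ball_swapped. Qed.

Lemma wgt_swapped x p u v : ok x p u -> wgt x (swapped x p u) v = wgt x p v.
Proof. by move=> okx; rewrite /(wgt _ _ _) ball_swapped. Qed.

Lemma dead_swapped x p u : ok x p u -> dead x (swapped x p u) = dead x p.
Proof. by move=> okx; rewrite /(dead _ _) ball_swapped. Qed.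

Lemma hit_swapped x p u k z : ok x p u ->
  hit (swapped x p u) (moved x p u) k z = hit p (moved x p u) k z.
Proof. by move=> okx; apply: hit_agree => // v; apply: swapped_out. Qed.

Lemma resample_ball x (G : 'S_n -> R) : (forall p, 0 <= G p) ->
  \sum_p G p <= 2 * \sum_p Eu (fun u => (ok x p u)%:R * G (swapped x p u)).
Proof.
move=> G0; apply: (@resample R n n_gt0 (seen x) (front x)) => //.
- exact: front_seen.
- by move=> p q /ball_agree e; rewrite /(seen _ _) /(front _ _) e.
move=> p; apply: leq_trans M_small; rewrite leq_mul2r /=.
by apply: leq_mul; rewrite ?leq_add ?card_front ?card_seen.
Qed.

Lemma card_moved x p u : (#|moved x p u| <= 2 * M)%N.
Proof.
rewrite mul2n -addnn (leq_trans (leq_card_setU _ _)) // leq_add ?card_front //.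
by rewrite (leq_trans (leq_imset_card _ _)) ?card_front.
Qed.

Variables (b : nat) (nice : 'S_n -> 'I_n -> seq 'I_n -> bool).

(* The walk restricted to nice paths; these will be the paths of probability at
   most [expR (- c0)]. *)
Definition sub p z y : R :=
  ex p b z (fun s => (nice p z s)%:R * (endp p z s == y)%:R).
Definition submass p : R := \sum_z \sum_y sub p z y.
Definition sub2 p : R := \sum_z \sum_y sub p z y ^+ 2.
(** The walk attached to a seed starts from the image of that very seed, so its return there is not
    controlled by independence and needs a separate term. *)
Definition ret k p : R := n%:R^-1 * \sum_u hit p [set u] k (p u).

Lemma sub_ge0 p z y : 0 <= sub p z y.
Proof. by apply: ex_ge0 => // s _; rewrite mulr_ge0. Qed.

Lemma ret_ge0 k p : 0 <= ret k p.
Proof. by rewrite mulr_ge0 ?invr_ge0 // sumr_ge0 // => u _; apply: hit_ge0. Qed.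

(** After the swap the walk goes from the frontier vertex [v] to [p (u v)], and until it picks in
    [moved] it behaves as under [p]. Discarding the paths that are not nice only increases the
    deficit. *)
Lemma dist_swapped x p u : ok x p u ->
  dist (swapped x p u) set0 (h.+1 + b) x <=
  \sum_y pp (n%:R^-1 - \sum_(v in front x p) wgt x p v * sub p (p (u v)) y) +
  \sum_(v in front x p) wgt x p v * hit p (moved x p u) b (p (u v)).
Proof.
move=> okx; set q := swapped x p u; set T := moved x p u.
pose lost v y := ex p b (p (u v)) (fun s =>
    (has (mem T) s)%:R * (endp p (p (u v)) s == y)%:R).
have lost0 v y : 0 <= lost v y by apply: ex_ge0 => // s _; rewrite mulr_ge0.
have lostE v : hit p T b (p (u v)) = \sum_y lost v y.
  rewrite (eq_bigr (fun y => lost v y * 1)) => [|y _]; last by rewrite mulr1.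
  by rewrite (ex_endpE P p b _ _ (fun=> 1)); apply: ex_eq => s _; rewrite mulr1.
rewrite dist0E.
apply: le_trans (_ : \sum_y (pp (n%:R^-1 - \sum_(v in front x p) wgt x p v * sub p (p (u v)) y)
   + \sum_(v in front x p) wgt x p v * lost v y) <= _); last first.
  rewrite big_split /= lerD2l exchange_big /=; apply: ler_sum => v _.
  by rewrite -mulr_sumr lostE.
apply: ler_sum => y _.
have wl0 : 0 <= \sum_(v in front x p) wgt x p v * lost v y.
  by apply: sumr_ge0 => v _; rewrite mulr_ge0 // wgt_ge0.
apply: le_trans (_ : pp (n%:R^-1 - \sum_(v in front x p) wgt x p v *
    (sub p (p (u v)) y - lost v y)) <= _); last first.
  under eq_bigr do rewrite mulrBr.
  rewrite sumrB opprB addrA addrAC; apply: le_trans (ppD _ _) _.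
  by rewrite lerD2l; apply: pp_leP.
apply: pp_le; rewrite lerD2l lerN2 ex_cat.
pose phi z := ex q b z (fun s => (endp q z s == y)%:R).
have phi0 z : 0 <= phi z by apply: ex_ge0.
apply: le_trans (_ : ex q h.+1 x (fun s => phi (endp q x s)) <= _); last first.
  by apply: ex_le => // s _; apply: ex_le => // s' _; rewrite endp_cat.
apply: le_trans (@front_val R n P P_ge0 P_row Delta P_half h x q phi phi0).
rewrite front_swapped //; apply: ler_sum => v vF.
rewrite wgt_swapped // ler_wpM2l ?wgt_ge0 // swapped_front //.
set z := p (u v).
apply: le_trans (_ : ex q b z (fun s => (~~ has (mem T) s)%:R * (endp q z s == y)%:R) <= _);
  last by apply: ex_le => // s _; case: has; rewrite ?mul0r ?mul1r.
have qp w : w \notin T -> q w = p w by exact: swapped_out.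
rewrite (@ex_avoid_agree R n P P_row q p T b z (fun y' => (y' == y)%:R) qp) lerBlDr -exD.
apply: ex_le => // s _; rewrite -mulrDl ler_wpM2r //.
by case: has; case: nice; rewrite ?add0r ?addr0.
Qed.

Lemma sub_row_le1 p y : \sum_z sub p z y <= 1.
Proof.
apply: le_trans (_ : \sum_z ex p b z (fun s => (endp p z s == y)%:R) <= _).
  apply: ler_sum => z _; apply: ex_le => // s _.
  by case: nice; rewrite ?mul1r ?mul0r.
rewrite (ex_stationary P_col p b (fun z => (z == y)%:R)).
by rewrite (bigD1 y) //= eqxx big1 ?addr0 // => z /negbTE ->.
Qed.

Lemma hit_moved_le x p u k v : v \in front x p ->
  hit p (moved x p u) k (p (u v)) <= hit p (front x p) k (p (u v)) +
    (hit p [set u v] k (p (u v)) +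
     \sum_(w in front x p | w != v) hit p [set u w] k (p (u v))).
Proof.
move=> vF; apply: le_trans (hitU P_ge0 _ _ _ _ _) _; rewrite lerD2l.
rewrite -(bigD1 (F := fun w => hit p [set u w] k (p (u v))) v vF) /=.
rewrite /(hit _ _ _ _) -ex_sum; apply: ex_le => // s _.
case: hasP => [[y ys]|_]; last exact: sumr_ge0.
move=> /imsetP[w wF yE]; rewrite (bigD1 w) //=.
have -> : has (mem [set u w]) s by apply/hasP; exists y; rewrite // yE /= inE.
by rewrite lerDl sumr_ge0.
Qed.

Lemma Eu_hit_moved x p k :
  Eu (fun u => \sum_(v in front x p) wgt x p v * hit p (moved x p u) k (p (u v))) <=
  (2 * k * M)%:R / n%:R + ret k p.
Proof.
have n0 : n%:R != 0 :> R by rewrite pnatr_eq0 -lt0n.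
have ni0 : 0 <= n%:R^-1 :> R by rewrite invr_ge0.
set c := _ + ret k p.
have c0 : 0 <= c by rewrite addr_ge0 ?ret_ge0 // mulr_ge0.
rewrite Eu_sum; apply: le_trans (_ : \sum_(v in front x p) wgt x p v * c <= _); last first.
  by rewrite -mulr_suml ler_piMl // front_mass_le1.
apply: ler_sum => v vF; rewrite EuZ ler_wpM2l ?wgt_ge0 //.
apply: le_trans (Eu_le (fun u => hit_moved_le u k vF)) _.
rewrite !EuD.
rewrite (Eu_coord n_gt0 v (fun z => hit p [set z] k (p z))) -/(ret k p).
have e1 : Eu (fun u => hit p (front x p) k (p (u v))) <= (k * M)%:R / n%:R.
  rewrite (Eu_coord n_gt0 v (fun z => hit p (front x p) k (p z))).
  rewrite mulrC ler_wpM2r //; apply: le_trans (hit_stationary_perm P_ge0 P_row P_col _ _ _) _.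
  by rewrite ler_nat leq_mul2l card_front ?orbT.
have e2 : Eu (fun u => \sum_(w in front x p | w != v) hit p [set u w] k (p (u v))) <=
    (k * M)%:R / n%:R.
  rewrite Eu_sum; apply: le_trans (_ : \sum_(w in front x p) k%:R / n%:R <= _); last first.
    rewrite sumr_const -[X in X <= _]mulr_natr mulrAC ler_wpM2r //.
    by rewrite -natrM ler_nat leq_mul2l card_front // orbT.
  rewrite [leLHS]big_mkcondr; apply: ler_sum => w wF; case: ifP => wv; last by rewrite mulr_ge0.
  rewrite (Eu_coord2 n_gt0 (fun y z => hit p [set y] k (p z))) //.
  apply: le_trans (_ : n%:R^-1 * \sum_(z < n) (n%:R^-1 * k%:R) <= _).
    rewrite ler_wpM2l //; apply: ler_sum => z _; rewrite ler_wpM2l //.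
    apply: le_trans (hit_stationary_perm P_ge0 P_row P_col _ _ _) _.
    by rewrite cards1 muln1.
  by rewrite sumr_const card_ord -[X in _ * X]mulr_natl mulVKf // mulrC.
have -> : c = (k * M)%:R / n%:R + (k * M)%:R / n%:R + ret k p.
  by rewrite /c -mulrDl -natrD addnn -mul2n mulnA.
lra.
Qed.

(** Averaged over the seeds, the nice mass reaching [y] is at most [1/n], and these averages miss
    [1 - submass p / n] in total. The fluctuation around them comes from independent seeds with
    weights at most [2 ^- h.+1], and this factor is what makes [sub2] harmless. *)
Lemma Eu_dist x p al : 0 < al -> \sum_(v in front x p) wgt x p v = 1 ->
  Eu (fun u => (ok x p u)%:R * dist (swapped x p u) set0 (h.+1 + b) x) <=
  (1 - submass p / n%:R) + al / 2 + 2 ^- h.+1 * sub2 p / (2 * al) +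
  (2 * b * M)%:R / n%:R + ret b p.
Proof.
move=> al0 mass1.
have n0 : n%:R != 0 :> R by rewrite pnatr_eq0 -lt0n.
have ni0 : 0 <= n%:R^-1 :> R by rewrite invr_ge0.
pose A u y := \sum_(v in front x p) wgt x p v * sub p (p (u v)) y.
pose m y := (\sum_(v in front x p) wgt x p v) * (n%:R^-1 * \sum_z sub p (p z) y).
have my y : m y <= n%:R^-1.
  rewrite /m mass1 mul1r ler_piMr // (sum_perm p (fun z => sub p z y)).
  exact: sub_row_le1.
have g0 u y : 0 <= al / 2 * n%:R^-1 + n%:R / (2 * al) * (A u y - m y) ^+ 2.
  apply: addr_ge0; first by rewrite mulr_ge0 // divr_ge0 // ltW.
  by rewrite mulr_ge0 ?sqr_ge0 // divr_ge0 // mulr_ge0 // ltW.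
apply: le_trans (_ : Eu (fun u => \sum_y (n%:R^-1 - m y + (al / 2 * n%:R^-1 +
   n%:R / (2 * al) * (A u y - m y) ^+ 2)) +
  \sum_(v in front x p) wgt x p v * hit p (moved x p u) b (p (u v))) <= _).
  apply: Eu_le => u; case: (boolP (ok x p u)) => okx; last first.
    rewrite mul0r addr_ge0 //; last first.
      by apply: sumr_ge0 => v _; rewrite mulr_ge0 ?wgt_ge0 ?hit_ge0.
    by apply: sumr_ge0 => y _; rewrite addr_ge0 ?g0 // subr_ge0.
  rewrite mul1r; apply: le_trans (dist_swapped okx) _; rewrite lerD2r.
  apply: ler_sum => y _; rewrite -/(A u y).
  (* The free parameter [al] replaces Cauchy-Schwarz and its square roots by a bound linear in the
     variance. *)
  have amgm : A u y - m y <= al / 2 * n%:R^-1 + n%:R / (2 * al) * (A u y - m y) ^+ 2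
     /\ m y - A u y <= al / 2 * n%:R^-1 + n%:R / (2 * al) * (A u y - m y) ^+ 2.
    set t := A u y - m y; rewrite -(opprB (A u y)) -/t.
    have nr : 0 < n%:R :> R by rewrite ltr0n.
    have -> : al / 2 * n%:R^-1 + n%:R / (2 * al) * t ^+ 2 =
      (2 * n%:R * al)^-1 * (al ^+ 2 + (n%:R * t) ^+ 2).
      by field; rewrite n0 gt_eqF.
    have nal : 0 < 2 * n%:R * al by rewrite !mulr_gt0.
    rewrite ![_^-1 * _]mulrC !ler_pdivlMr //.
    have := sqr_ge0 (al - n%:R * t); have := sqr_ge0 (al + n%:R * t).
    by split; nra.
  apply: pp_leP; first by rewrite addr_ge0 ?g0 // subr_ge0.
  have [_ ] := amgm; set Q := (X in _ <= X) => h2; rewrite -/Q; lra.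
rewrite EuD -addrA; apply: lerD; last exact: Eu_hit_moved.
rewrite Eu_sum.
apply: le_trans (_ : \sum_y ((n%:R^-1 - n%:R^-1 * \sum_z sub p z y) + al / 2 * n%:R^-1 +
   n%:R / (2 * al) * (2 ^- h.+1 * (n%:R^-1 * \sum_z sub p z y ^+ 2))) <= _).
  apply: ler_sum => y _; rewrite (EuD (fun=> n%:R^-1 - m y)) (EuD (fun=> al / 2 * n%:R^-1)) (EuZ (n%:R / (2 * al))) !Eu_cst // addrA.
  rewrite {1}/m mass1 mul1r (sum_perm p (fun z => sub p z y)) lerD2l.
  rewrite ler_wpM2l ?divr_ge0 ?mulr_ge0 ?(ltW al0) //.
  apply: le_trans (Eu_var n_gt0 _ _ (fun z => sub p (p z) y)) _.
  rewrite (sum_perm p (fun z => sub p z y ^+ 2)) ler_wpM2r //.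
    by rewrite mulr_ge0 // sumr_ge0 // => z _; rewrite sqr_ge0.
  rewrite -[leRHS]mulr1 -[X in _ * X]mass1 mulr_sumr; apply: ler_sum => v _.
  by rewrite expr2 ler_wpM2r ?wgt_ge0 // wgt_le.
rewrite !big_split /= sumrN -!mulr_sumr [X in X - _](_ : _ = 1); last first.
  by rewrite sumr_const card_ord -[LHS]mulr_natl mulfV.
rewrite sumr_const card_ord -[n%:R^-1 *+ n]mulr_natl mulfV // mulr1.
rewrite /submass /sub2 [in leRHS]exchange_big [X in 2 ^- h.+1 * X]exchange_big /=.
set X1 := \sum_(i < n) _; set X2 := \sum_(i < n) _.
rewrite le_eqVlt; apply/orP; left; apply/eqP.
have h0 : 2 ^+ h.+1 != 0 :> R by rewrite expf_neq0 // pnatr_eq0.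
by field; rewrite n0 h0 gt_eqF.
Qed.

(** Without dead branches the frontier has mass exactly 1; the other permutations are charged
    distance 1. The swap preserves the number of dead branches, so the distinction survives the
    resampling. *)
Lemma typical x al : 0 < al ->
  \sum_p dist p set0 (h.+1 + b) x <=
  \sum_p (0 < dead x p)%N%:R + 2 * \sum_p ((1 - submass p / n%:R) + al / 2 +
     2 ^- h.+1 * sub2 p / (2 * al) + (2 * b * M)%:R / n%:R + ret b p).
Proof.
move=> al0; pose c p : R := (1 - submass p / n%:R) + al / 2 +
  2 ^- h.+1 * sub2 p / (2 * al) + (2 * b * M)%:R / n%:R + ret b p.
have n0 : 0 < n%:R :> R by rewrite ltr0n.
have c0 p : 0 <= c p.
  have s2 : 0 <= sub2 p.
    by apply: sumr_ge0 => z _; apply: sumr_ge0 => y _; rewrite sqr_ge0.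
  have s1 : submass p <= n%:R.
    rewrite /submass exchange_big /= -[leRHS]mulr1 mulr_natl -[in leRHS](card_ord n).
    by rewrite -sumr_const; apply: ler_sum => y _; apply: sub_row_le1.
  apply: addr_ge0 (ret_ge0 _ _); apply: addr_ge0; last by rewrite mulr_ge0 ?invr_ge0.
  apply: addr_ge0; last first.
    by rewrite divr_ge0 // mulr_ge0 ?invr_ge0 ?exprn_ge0 // ltW.
  apply: addr_ge0; last by rewrite divr_ge0 // ltW.
  by rewrite subr_ge0 ler_pdivrMr // mul1r.
pose G p := (dead x p == 0)%N%:R * dist p set0 (h.+1 + b) x.
apply: le_trans (_ : \sum_p (0 < dead x p)%N%:R + \sum_p G p <= _).
  rewrite -big_split /=; apply: ler_sum => p _; rewrite /G lt0n.
  by case: (dead x p == 0)%N; rewrite /= ?mul1r ?add0r // mul0r addr0 dist_le1.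
have G0 p : 0 <= G p by rewrite mulr_ge0 // dist_ge0.
rewrite lerD2l; apply: le_trans (resample_ball x G0) _.
rewrite ler_wpM2l //; apply: ler_sum => p _.
case: (eqVneq (dead x p) 0)%N => [d0|dn0]; last first.
  apply: le_trans (_ : Eu (fun=> 0) <= _); last by rewrite (Eu_cst n_gt0); exact: c0.
  apply: Eu_le => u; case: (boolP (ok x p u)) => okx; last by rewrite mul0r.
  by rewrite /G dead_swapped // (negbTE dn0) mul0r mulr0.
apply: le_trans (_ : Eu (fun u => (ok x p u)%:R * dist (swapped x p u) set0 (h.+1 + b) x) <= _).
  by apply: Eu_le => u; rewrite ler_wpM2l // /G; case: eqP; rewrite ?mul1r ?mul0r ?dist_ge0.
apply: Eu_dist => //; apply/le_anti; rewrite front_mass_le1 //=.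
by have := @front_mass R n P P_ge0 P_row Delta P_supp_row P_half h x p; rewrite d0 mul0r subr0.
Qed.

End Typical.

(** * From typical to worst starting points *)

Section Worst.
Variables (R : realFieldType) (n : nat) (P : 'I_n -> 'I_n -> R).
Hypothesis n_gt0 : (0 < n)%N.
Hypothesis P_ge0 : forall x v, 0 <= P x v.
Hypothesis P_row : forall x, \sum_v P x v = 1.
Hypothesis P_col : forall v, \sum_x P x v = 1.
Variable Delta : nat.
Hypothesis P_supp_row : forall x, (#|[set v | P x v != 0%R]| <= Delta)%N.
Hypothesis P_supp_col : forall v, (#|[set x | P x v != 0%R]| <= Delta)%N.
Hypothesis P_half : forall x v, P x v <= 2^-1.
Variable h : nat.
Implicit Types (p q : 'S_n) (x y z v w : 'I_n) (s : seq 'I_n) (S T D K : {set 'I_n}).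
Local Notation ex := (ex P).
Local Notation dist := (dist P).
Local Notation hit := (hit P).
Local Notation seed := {ffun 'I_n -> 'I_n}.
Local Notation Eu := (@Eu R n).
Local Notation front := (front P Delta h).
Local Notation seen := (seen P Delta h).
Local Notation wgt := (wgt P Delta h).
Local Notation dead := (dead P Delta h).
Local Notation M := (ball_size Delta h).
Local Notation moved := (moved P Delta h).
Local Notation ok x p u := (okseed (seen x p) (front x p) u).
Local Notation swapped x p u := (swp (front x p) u * p)%g.
Hypothesis M_small : (M * (M + M) * 2 <= n)%N.
Variables (t1 : nat) (eps eta : R).
Hypothesis eps_gt0 : 0 < eps.

Let M_gt0 : (0 < M)%N. Proof. by rewrite expn_gt0. Qed.

(* Killing the walk from [p u] at [u] makes this insensitive to the value of
   [p] at [u], which the resampling changes. *)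
Definition psi p v := dist p [set v] t1 (p v).
Definition goodenv p := #|[set v | eps < psi p v]|%:R <= eta * n%:R.
Definition fail x p :=
  eps < \sum_(v in front x p) wgt x p v * (3 * eps < dist p set0 t1 (p v))%R%:R.
(** This set does not depend on the seeds, so a Chernoff bound applies to independent seeds falling
    into it. Interactions between seeds are left to [spoiled]. *)
Definition badset x p : {set 'I_n} :=
  [set v | (2 * eps < psi p v) || (eps / 2 < hit p (front x p) t1 (p v))].
(** A budget of [eps / 2] shared among at most [M] foreign seeds. *)
Definition kap : R := eps / 2 / M%:R.
Definition edge p (u : seed) v w := kap < hit p [set u w] t1 (p (u v)).
Definition spoiled x p (u : seed) v :=
  [exists w in front x p, (w != v) && edge p u v w].

Let kap_gt0 : 0 < kap. Proof. by rewrite !divr_gt0 // ltr0n. Qed.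

Lemma card_markov (g : 'I_n -> R) a c : 0 < a -> (forall z, 0 <= g z) ->
  \sum_z g z <= c -> #|[set z | a < g z]|%:R <= c / a.
Proof.
move=> a0 g0 gc; rewrite ler_pdivlMr // mulrC; apply: le_trans gc.
rewrite -sum1_card natr_sum mulr_sumr [leRHS](bigID (fun z => a < g z)) /=.
apply: ler_wpDr; first exact: sumr_ge0.
rewrite big_mkcond [leRHS]big_mkcond /=; apply: ler_sum => z _.
by rewrite inE; case: ifP => // /ltW; rewrite mulr1.
Qed.

(** The moved set is split into the own seed of [v], the frontier and the other seeds, which cost
    [2 * eps], [eps / 2] and [eps / 2]. *)
Lemma leaf_bad x p u v : ok x p u -> v \in front x p ->
  3 * eps < dist (swapped x p u) set0 t1 (swapped x p u v) ->
  (u v \in badset x p) || spoiled x p u v.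
Proof.
move=> okx vF; apply: contraTT; rewrite negb_or inE negb_or -!leNgt.
move=> /andP[/andP[hpsi hF] /exists_inPn hsp].
rewrite (swapped_front okx vF).
set z := p (u v); set q := swapped x p u.
have uvm : u v \in moved x p u by rewrite in_setU imset_f ?orbT.
have qp w : w \notin moved x p u -> q w = p w by exact: swapped_out.
apply: le_trans (_ : dist q (moved x p u) t1 z <= _).
  by apply: dist_sub => //; exact: sub0set.
rewrite (dist_agree P_row t1 z qp).
apply: le_trans (_ : dist p ([set u v] :|: (front x p :|: u @: (front x p :\ v))) t1 z <= _).
  apply: dist_sub => //; apply/subsetP => w; rewrite in_setU => /orP[wF|/imsetP[w' wF ->]].
    by rewrite !in_setU wF orbT.
  have [->|wv] := eqVneq w' v; first by rewrite in_setU in_set1 eqxx.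
  by rewrite !in_setU imset_f ?orbT // in_setD1 wv.
have h1 := dist_hit P_ge0 P_row p [set u v] (front x p :|: u @: (front x p :\ v)) t1 z.
apply: le_trans h1 _.
have h2 : hit p (front x p :|: u @: (front x p :\ v)) t1 z <=
   hit p (front x p) t1 z + \sum_(w in front x p :\ v) hit p [set u w] t1 z.
  apply: le_trans (hitU P_ge0 _ _ _ _ _) _; rewrite lerD2l.
  rewrite /(hit _ _ _ _) -ex_sum; apply: ex_le => // s _.
  case: hasP => [[y ys]|_]; last exact: sumr_ge0.
  move=> /imsetP[w wF yE]; rewrite (bigD1 w) //=.
  have -> : has (mem [set u w]) s by apply/hasP; exists y; rewrite // yE /= inE.
  by rewrite lerDl sumr_ge0.
have h3 : \sum_(w in front x p :\ v) hit p [set u w] t1 z <= eps / 2.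
  apply: le_trans (_ : \sum_(w in front x p :\ v) kap <= _).
    apply: ler_sum => w; rewrite !inE => /andP[wv wF].
    have := hsp w; rewrite inE wF => /(_ isT); rewrite wv /= /edge -leNgt; exact.
  rewrite sumr_const -[X in X <= _]mulr_natr -[leRHS]mulr1 /kap -mulrA ler_pM2l ?divr_gt0 //.
  rewrite mulrC ler_pdivrMr ?ltr0n // mul1r ler_nat.
  apply: (@leq_trans #|front x p|); last exact: card_front.
  by apply: subset_leq_card; apply: subsetDl.
rewrite -/(psi p (u v)); move: hpsi hF h2 h3; rewrite -/z; lra.
Qed.

Hypothesis slack : 2 * M%:R + 4 * M%:R * t1%:R / eps <= eta * n%:R.

(** The environment is good after the swap, while [badset] is computed before it. A vertex bad for
    [p] has [eps < psi] after the swap, unless it is moved or its walk hits the moved set or the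
    frontier with sizeable probability; [slack] absorbs these exceptions. *)
Lemma card_badset x p u : ok x p u -> goodenv (swapped x p u) ->
  #|badset x p|%:R <= 2 * eta * n%:R.
Proof.
move=> okx; rewrite /goodenv; set q := swapped x p u => hq.
pose A1 := [set v | eps < psi q v].
pose A3 := [set v | eps < hit p (moved x p u) t1 (p v)].
pose A4 := [set v | eps / 2 < hit p (front x p) t1 (p v)].
have sub : badset x p \subset (A1 :|: moved x p u) :|: (A3 :|: A4).
  apply/subsetP => v; rewrite in_set => /orP[hv|hv]; last by rewrite inE [v \in _ :|: A4]inE [v \in A4]inE hv !orbT.
  rewrite in_setU [v \in A1 :|: _]in_setU [v \in A3 :|: A4]in_setU; have [vm|vm] := boolP (v \in moved x p u); first by rewrite !orbT.
  have [v3|v3] := boolP (v \in A3); first by rewrite !orbT.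
  suff -> : v \in A1 by [].
  move: v3; rewrite !inE -leNgt => v3.
  have e : dist p ([set v] :|: moved x p u) t1 (p v) = dist q ([set v] :|: moved x p u) t1 (q v).
    rewrite /q swapped_out //; apply: dist_agree => // w; rewrite in_setU negb_or => /andP[_ wm].
    by rewrite swapped_out.
  have h1 : psi p v <= psi q v + hit q (moved x p u) t1 (q v).
    apply: le_trans (_ : dist q ([set v] :|: moved x p u) t1 (q v) <= _); last exact: dist_hit.
    by rewrite -e; apply: dist_sub => //; exact: subsetUl.
  move: h1; rewrite /q hit_swapped // swapped_out // -/q; lra.
have c3 : #|A3|%:R <= 2 * M%:R * t1%:R / eps.
  apply: card_markov => //; first by move=> z; apply: hit_ge0.
  apply: le_trans (hit_stationary_perm P_ge0 P_row P_col _ _ _) _.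
  by rewrite -!natrM ler_nat mulnC leq_mul2r card_moved ?orbT.
have c4 : #|A4|%:R <= 2 * M%:R * t1%:R / eps.
  have -> : 2 * M%:R * t1%:R / eps = M%:R * t1%:R / (eps / 2) by field; rewrite gt_eqF.
  apply: card_markov => //; first by rewrite divr_gt0.
    by move=> z; apply: hit_ge0.
  apply: le_trans (hit_stationary_perm P_ge0 P_row P_col _ _ _) _.
  by rewrite -!natrM ler_nat mulnC leq_mul2r card_front ?orbT.
have cm : #|moved x p u|%:R <= 2 * M%:R :> R by rewrite -natrM ler_nat card_moved.
apply: le_trans (_ : #|A1|%:R + #|moved x p u|%:R + (#|A3|%:R + #|A4|%:R) <= _).
  rewrite -!natrD ler_nat (leq_trans (subset_leq_card sub)) //.
  by rewrite (leq_trans (leq_card_setU _ _)) // leq_add ?leq_card_setU.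
move: slack hq c3 c4 cm; rewrite -/A1.
rewrite (_ : 4 * M%:R * t1%:R / eps = 2 * (2 * M%:R * t1%:R / eps)); last by ring.
lra.
Qed.

Let del : R := t1%:R / kap / n%:R.

Lemma edge_in p z : n%:R^-1 * \sum_y (kap < hit p [set z] t1 (p y))%R%:R <= del.
Proof.
rewrite /del mulrC ler_wpM2r ?invr_ge0 //.
have -> : \sum_y (kap < hit p [set z] t1 (p y))%R%:R =
    #|[set y | kap < hit p [set z] t1 (p y)]|%:R :> R.
  rewrite -sum1_card natr_sum [RHS]big_mkcond; apply: eq_bigr => y _ /=.
  by rewrite inE; case: ifP.
apply: card_markov => //; first by move=> y; apply: hit_ge0.
apply: le_trans (hit_stationary_perm P_ge0 P_row P_col _ _ _) _.
by rewrite cards1 muln1.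
Qed.

Let del_ge0 : 0 <= del.
Proof. by rewrite !divr_ge0 // ltW. Qed.

Lemma Eu_edge p v w : v != w -> Eu (fun u => (edge p u v w)%:R) <= del.
Proof.
move=> vw; rewrite (Eu_upd n_gt0 v) -[leRHS](Eu_cst n_gt0); apply: Eu_le => u.
rewrite /edge; under eq_bigr => z _ do
  rewrite !ffunE eqxx [w == v]eq_sym (negbTE vw).
exact: edge_in.
Qed.

(** The seed of [v] enters only the first event, through the start of its walk. Redrawing it gives
    that event conditional probability at most [del] given all other seeds. *)
Lemma Eu_edge2 p v w v' w' : v != w -> v' != w' -> v != v' -> v != w' ->
  Eu (fun u => (edge p u v w)%:R * (edge p u v' w')%:R) <= del ^+ 2.
Proof.
move=> vw v'w' vv' vw'; rewrite (Eu_upd n_gt0 v).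
apply: le_trans (_ : Eu (fun u => del * (edge p u v' w')%:R) <= _).
  apply: Eu_le => u; rewrite /edge; under eq_bigr => z _ do
    rewrite !ffunE eqxx [w == v]eq_sym [v' == v]eq_sym [w' == v]eq_sym
      (negbTE vw) (negbTE vv') (negbTE vw').
  by rewrite -mulr_suml mulrA ler_wpM2r // edge_in.
by rewrite EuZ expr2 ler_wpM2l // Eu_edge.
Qed.

(** Two arrows with distinct sources that are not opposite to each other: one source then lies
    outside the other arrow. *)
Definition quad_cond v w v' w' :=
  [&& v != w, v' != w', v != v' & (v != w') || (v' != w)].

Lemma Eu_edge2_cond p v w v' w' : quad_cond v w v' w' ->
  Eu (fun u => (edge p u v w)%:R * (edge p u v' w')%:R) <= del ^+ 2.
Proof.
move=> /and4P[vw v'w' vv' /orP[vw'|v'w]]; first exact: Eu_edge2.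
under Eu_eq do rewrite mulrC.
by apply: Eu_edge2 => //; rewrite eq_sym.
Qed.

Hypothesis wgt_small : 2 * 2 ^- h.+1 <= eps / 2.

(** By [wgt_small], spoiled weight above [eps / 2] needs at least three spoiled vertices [a], [b],
    [c]. The arrows from [a] and [b] satisfy [quad_cond] unless they are opposite, in which case
    those from [a] and [c] do. *)
Lemma spoiled_quads x p u :
  (eps / 2 < \sum_(v in front x p) wgt x p v * (spoiled x p u v)%:R)%R%:R <=
  \sum_(v in front x p) \sum_(w in front x p) \sum_(v' in front x p)
    \sum_(w' in front x p)
    (quad_cond v w v' w')%:R * ((edge p u v w)%:R * (edge p u v' w')%:R) :> R.
Proof.
set F := front x p; case: ltP => [hs|_]; last first.
  by do 4 (apply: sumr_ge0 => ? _); rewrite !mulr_ge0.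
pose A := [set v in F | spoiled x p u v].
have cA : (2 < #|A|)%N.
  rewrite ltnNge; apply/negP => cA2; move: hs; apply/negP; rewrite -leNgt.
  apply: le_trans wgt_small; apply: le_trans (_ : \sum_(v in A) 2 ^- h.+1 <= _).
    rewrite [leRHS]big_mkcond [leLHS]big_mkcond; apply: ler_sum => v _; rewrite [v \in A]inE.
    case: (v \in F) => //=; case: (spoiled x p u v) => /=.
      by rewrite mulr1; exact: wgt_le.
    by rewrite mulr0.
  by rewrite sumr_const -[X in X <= _]mulr_natl ler_wpM2r ?invr_ge0 ?exprn_ge0 // ler_nat.
have part v : v \in A -> v \in F /\ exists w, [/\ w \in F, v != w & edge p u v w].
  rewrite inE => /andP[vF /exists_inP[w wF /andP[wv e]]]; split=> //.
  by exists w; split=> //; rewrite eq_sym.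
suff [v [w [v' [w' [[vF wF v'F w'F] [qc e1 e2]]]]]] : exists v w v' w',
    [/\ v \in F, w \in F, v' \in F & w' \in F] /\
    [/\ quad_cond v w v' w', edge p u v w & edge p u v' w'].
  have big1 (f : 'I_n -> R) i : i \in F -> (forall j, 0 <= f j) -> 1 <= f i ->
      1 <= \sum_(j in F) f j.
    move=> iF f0 f1; rewrite (bigD1 i) //=; apply: le_trans f1 _.
    by rewrite lerDl sumr_ge0.
  have ge0 (i j k l : 'I_n) :
    0 <= (quad_cond i j k l)%:R * ((edge p u i j)%:R * (edge p u k l)%:R) :> R.
    by rewrite !mulr_ge0.
  apply: (big1 _ v vF); first by move=> i; do 3 (apply: sumr_ge0 => ? _).
  apply: (big1 _ w wF); first by move=> i; do 2 (apply: sumr_ge0 => ? _).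
  apply: (big1 _ v' v'F); first by move=> i; apply: sumr_ge0 => ? _.
  apply: (big1 _ w' w'F); first by move=> i.
  by rewrite qc e1 e2 !mulr1.
have /card_gt2P[a [b [c [[aA bA cA'] [ab bc ca]]]]] := cA.
have [aF [a' [a'F aa' ea]]] := part a aA.
have [bF [b' [b'F bb' eb]]] := part b bA.
have [cF [c' [c'F cc' ec]]] := part c cA'.
have [e1|ne] := boolP ((a == b') && (b == a')).
  exists a, a', c, c'; split=> //; split=> //.
  rewrite /quad_cond aa' cc' eq_sym ca /=.
  by move: e1 => /andP[_ /eqP <-]; rewrite [c == b]eq_sym bc orbT.
exists a, a', b, b'; split=> //; split=> //.
by rewrite /quad_cond aa' bb' ab /= -negb_and.
Qed.

Lemma Eu_spoiled x p :
  Eu (fun u => (eps / 2 < \sum_(v in front x p) wgt x p v * (spoiled x p u v)%:R)%R%:R)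
  <= M%:R ^+ 4 * del ^+ 2.
Proof.
apply: le_trans (Eu_le (spoiled_quads x p)) _.
have cF : #|front x p|%:R <= M%:R :> R by rewrite ler_nat card_front.
have bnd (f : 'I_n -> R) c : 0 <= c -> (forall i, f i <= c) ->
    \sum_(i in front x p) f i <= M%:R * c.
  move=> c0 fc; apply: le_trans (_ : \sum_(i in front x p) c <= _); first exact: ler_sum.
  by rewrite sumr_const -[X in X <= _]mulr_natl ler_wpM2r.
have d2 : 0 <= del ^+ 2 by rewrite exprn_ge0.
have c1 : 0 <= M%:R * del ^+ 2 by rewrite mulr_ge0.
have c2 : 0 <= M%:R * (M%:R * del ^+ 2) by rewrite mulr_ge0.
have c3 : 0 <= M%:R * (M%:R * (M%:R * del ^+ 2)) by rewrite mulr_ge0.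
have -> : M%:R ^+ 4 * del ^+ 2 = M%:R * (M%:R * (M%:R * (M%:R * del ^+ 2))) by ring.
rewrite Eu_sum; apply: (bnd) => // v; rewrite Eu_sum; apply: (bnd) => // w.
rewrite Eu_sum; apply: (bnd) => // v'; rewrite Eu_sum; apply: (bnd) => // w'.
rewrite EuZ; have [qc|_] := boolP (quad_cond _ _ _ _); last by rewrite mul0r.
by rewrite mul1r Eu_edge2_cond.
Qed.

Variable cb : R.
Hypothesis chernoff : forall (F B : {set 'I_n}) (w : 'I_n -> R),
  (forall v, 0 <= w v <= 2 ^- h.+1) -> \sum_(v in F) w v <= 1 ->
  #|B|%:R <= 2 * eta * n%:R ->
  Eu (fun u => (eps / 2 < \sum_(v in F) w v * (u v \in B)%:R)%R%:R) <= cb.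

(** After the swap the failing weight splits between seeds in a fixed small set and spoiled
    vertices; one of the two parts must exceed [eps / 2]. *)
Lemma prob_fail x : 0 <= cb ->
  \sum_p (fail x p && goodenv p)%:R <=
  2 * (cb + M%:R ^+ 4 * del ^+ 2) * #|'S_n|%:R.
Proof.
move=> cb0; pose G p : R := (fail x p && goodenv p)%:R.
have G0 p : 0 <= G p by [].
apply: le_trans (resample_ball n_gt0 P_supp_row M_small x G0) _.
rewrite -mulrA ler_wpM2l // mulr_natr -sumr_const; apply: ler_sum => p _.
pose B := badset x p.
apply: le_trans (_ : Eu (fun u => (#|B|%:R <= 2 * eta * n%:R)%R%:R *
   (eps / 2 < \sum_(v in front x p) wgt x p v * (u v \in B)%:R)%R%:R +
   (eps / 2 < \sum_(v in front x p) wgt x p v * (spoiled x p u v)%:R)%R%:R) <= _).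
  apply: Eu_le => u; case: (boolP (ok x p u)) => okx; last by rewrite mul0r addr_ge0 ?mulr_ge0.
  rewrite mul1r /G; have [/andP[hf hg]|_] := boolP (_ && _); last by rewrite addr_ge0 ?mulr_ge0.
  rewrite (card_badset okx hg) mul1r.
  have : eps < \sum_(v in front x p) wgt x p v * (u v \in B)%:R +
     \sum_(v in front x p) wgt x p v * (spoiled x p u v)%:R.
    apply: lt_le_trans hf _; rewrite front_swapped // -big_split /=.
    apply: ler_sum => v vF; rewrite wgt_swapped // -mulrDr ler_wpM2l ?wgt_ge0 //.
    case: ltP => [/(leaf_bad okx vF)|_]; last by rewrite addr_ge0.
    by case: (_ \in _); case: spoiled; rewrite //= ?addr0 ?add0r // lerDl.
  move=> h3; case: ltP => h1; first by rewrite lerDl.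
  case: ltP => h2; first by rewrite lerDr.
  by have := lt_le_trans h3 (lerD h1 h2); rewrite -splitr ltxx.
rewrite EuD; apply: lerD; last exact: Eu_spoiled.
rewrite EuZ; case: (leP #|B|%:R) => hB; last by rewrite mul0r.
rewrite mul1r; apply: chernoff => //; last exact: front_mass_le1.
by move=> v; apply: wgt_bound.
Qed.

(** The frontier keeps mass at least 1/2 and contributes at most [4 * eps]: [3 * eps] from good
    starts and [eps] from the weight of bad ones, where the distance is at most 1. The missing mass
    is charged the worst distance [Dm]. *)
Lemma contraction p (s : nat) Dm : (forall x, (dead x p <= 1)%N && ~~ fail x p) ->
  (t1 <= s)%N -> (forall z, dist p set0 s z <= Dm) ->
  forall x, dist p set0 (h.+1 + s) x <= Dm / 2 + 4 * eps.
Proof.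
move=> hx ts hD x; have /andP[dx fx] := hx x.
have Dm0 : 0 <= Dm by apply: le_trans (hD x); apply: dist_ge0.
apply: le_trans (dist_convex P_ge0 P_row p h.+1 s x) _.
have phi0 z : 0 <= Dm - dist p set0 s z by rewrite subr_ge0.
have := @front_val R n P P_ge0 P_row Delta P_half h x p _ phi0.
rewrite exB ex_cst //; set E := ex _ _ _ _.
under eq_bigr do rewrite mulrBr; rewrite sumrB -mulr_suml.
have mass := @front_mass R n P P_ge0 P_row Delta P_supp_row P_half h x p.
have mass1 := @front_mass_le1 R n P P_ge0 P_row Delta P_half h x p.
set W := \sum_(v in front x p) wgt x p v in mass mass1 *.
have hd : (dead x p)%:R <= 1 :> R by rewrite lern1.
have : \sum_(v in front x p) wgt x p v * dist p set0 s (p v) <= 4 * eps.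
  apply: le_trans (_ : \sum_(v in front x p) (wgt x p v * (3 * eps) +
     wgt x p v * (3 * eps < dist p set0 t1 (p v))%R%:R) <= _).
    apply: ler_sum => v _; rewrite -mulrDr ler_wpM2l ?wgt_ge0 //.
    apply: le_trans (dist_mono_le P_ge0 P_row P_col p _ ts) _.
    case: ltP => [_|]; last by rewrite addr0.
    rewrite addrC; apply: ler_wpDr; first by rewrite mulr_ge0 // ltW.
    exact: dist_le1.
  rewrite big_split /= -mulr_suml -/W.
  move: fx; rewrite /fail -leNgt => fx.
  have : W * (3 * eps) <= 3 * eps by rewrite ler_piMl // mulr_ge0 // ltW.
  lra.
have : Dm * (1 - W) <= Dm * (1 / 2) by rewrite ler_wpM2l //; lra.
lra.
Qed.

End Worst.

(** * Entropy of the walk *)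

Section Entropy.
Variables (R : realType) (n : nat) (P : 'I_n -> 'I_n -> R).
Hypothesis n_gt0 : (0 < n)%N.
Hypothesis P_ge0 : forall x v, 0 <= P x v.
Hypothesis P_row : forall x, \sum_v P x v = 1.
Hypothesis P_col : forall v, \sum_x P x v = 1.
Implicit Types (p q : 'S_n) (x y z v w : 'I_n) (s : seq 'I_n) (S D : {set 'I_n}).
Local Notation ex := (ex P).
Local Notation dist := (dist P).
Local Notation N := (#|'S_n|%:R : R).

(** Impossible picks have information 0, because [0^-1] and [ln 0] are both 0. *)
Definition info x v : R := ln (P x v)^-1.

Fixpoint lw p x s : R :=
  if s is v :: s' then info x v + lw p (p v) s' else 0.

Fixpoint pw p x s : R :=
  if s is v :: s' then P x v * pw p (p v) s' else 1.

Definition ent x : R := \sum_v P x v * info x v.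
Definition avent : R := n%:R^-1 * \sum_x ent x.
Local Notation H := avent.

Variable L : R.
Hypothesis info_le : forall x v, info x v <= L.

Lemma P_le1 x v : P x v <= 1.
Proof.
by rewrite -(P_row x) (bigD1 v) //= lerDl sumr_ge0.
Qed.

Lemma info_ge0 x v : 0 <= info x v.
Proof.
rewrite /info; have [p0|] := boolP (P x v == 0).
  by rewrite (eqP p0) invr0 ln0.
move=> p0; apply: ln_ge0; rewrite invr_ge1 ?P_le1 ?unitfE //.
by rewrite lt_neqAle eq_sym p0 P_ge0.
Qed.

Lemma P_expR x v : P x v != 0 -> P x v = expR (- info x v).
Proof.
move=> p0; have pp : 0 < P x v by rewrite lt_neqAle eq_sym p0 P_ge0.
by rewrite /info lnV ?posrE // opprK lnK.
Qed.

Lemma P_le_expR x v : P x v <= expR (- info x v).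
Proof.
by have [->|/P_expR->//] := eqVneq (P x v) 0; rewrite expR_ge0.
Qed.

Lemma pw_le p x s : pw p x s <= expR (- lw p x s).
Proof.
elim: s x => [|v s IH] x /=; first by rewrite oppr0 expR0.
rewrite opprD expRD; apply: ler_pM => //; last exact: P_le_expR.
by elim: s (p v) {IH} => //= w s IH y; rewrite mulr_ge0.
Qed.

Lemma ex_pw p k x s : size s = k -> ex p k x (fun s' => (s' == s)%:R) = pw p x s.
Proof.
elim: k x s => [|k IH] x [|v s] //= [hs].
rewrite (bigD1 v) //= [X in _ + X]big1 ?addr0.
  congr (_ * _); rewrite -IH //; apply: ex_eq => s' _.
  by rewrite eqseq_cons eqxx.
move=> w wv; rewrite (@ex_eq R n P _ _ _ _ (fun=> 0)) ?ex_cst ?mulr0 // => s' _.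
by rewrite eqseq_cons (negbTE wv).
Qed.

Lemma ent_ge0 x : 0 <= ent x.
Proof. by apply: sumr_ge0 => v _; rewrite mulr_ge0 ?info_ge0. Qed.

Lemma ent_le x : ent x <= L.
Proof.
rewrite -[leRHS]mul1r -(P_row x) mulr_suml; apply: ler_sum => v _.
by rewrite ler_wpM2l.
Qed.

Lemma L_ge0 : 0 <= L.
Proof. by have x := Ordinal n_gt0; apply: le_trans (ent_ge0 x) (ent_le x). Qed.

Lemma avent_ge0 : 0 <= H.
Proof. by rewrite mulr_ge0 ?invr_ge0 // sumr_ge0 // => x _; exact: ent_ge0. Qed.

Lemma avent_le : H <= L.
Proof.
rewrite /avent ler_pdivrMl ?ltr0n // mulr_natl -[X in _ *+ X](card_ord n) -sumr_const.
by apply: ler_sum => x _; exact: ent_le.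
Qed.

Lemma sum_ent : \sum_x ent x = n%:R * H.
Proof. by rewrite /avent mulVKf // pnatr_eq0 -lt0n. Qed.

(** Chain rule: given the past, the next pick contributes on average the entropy of the current
    row. *)
Lemma ex_lw p k x :
  ex p k x (lw p x) = \sum_(i < k) ex p i x (fun s => ent (endp p x s)).
Proof.
elim: k x => [|k IH] x; first by rewrite big_ord0.
rewrite big_ord_recl exS /=.
under eq_bigr => v _ do rewrite exD ex_cst // IH mulrDr.
rewrite big_split /=; congr (_ + _).
by under eq_bigr do rewrite mulr_sumr; rewrite exchange_big.
Qed.

Lemma sum_lw p k : \sum_x ex p k x (lw p x) = k%:R * (n%:R * H).
Proof.
under eq_bigr do rewrite ex_lw.
rewrite exchange_big /=; under eq_bigr => i _ do rewrite (ex_stationary P_col p i ent) sum_ent.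
by rewrite sumr_const card_ord [RHS]mulr_natl.
Qed.

(** Annealed bound on the mean entropy of the row reached after [k] picks: an average over
    unrevealed images, plus [L] times the collision probability. *)
Definition entup k : R :=
  n%:R * H / (n - k.+1)%:R + k%:R * (L * (k.+1%:R / (n - k.+1)%:R)).

Lemma annealed_ent k v : (k.+1 < n)%N ->
  \sum_p ex p k (p v) (fun s => ent (endp p (p v) s)) <= entup k * N.
Proof.
move=> kn; have g0 : 0 <= n%:R * H / (n - k.+1)%:R.
  by apply: divr_ge0 => //; apply: mulr_ge0 => //; exact: avent_ge0.
have hG p0 D S w : D \subset S -> set0 \subset S -> [disjoint set0 & D] ->
    w \in S -> w \notin D -> w \notin (set0 : {set 'I_n}) -> (#|S| <= k.+1)%N ->
    \sum_(q | agree D p0 q) (fun _ _ z => ent z) q S (q w) <=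
      n%:R * H / (n - k.+1)%:R * nag R D p0.
  move=> DS _ _ _ wD _ Sk /=.
  have nk : 0 < (n - k.+1)%:R :> R by rewrite ltr0n subn_gt0.
  rewrite mulrAC ler_pdivlMr // -sum_ent [leRHS]mulrC.
  apply: le_trans (agree_swap p0 ent_ge0 wD).
  rewrite ler_wpM2l ?sumr_ge0 // => [q _|]; first exact: ent_ge0.
  by rewrite ler_nat leq_sub2l // (leq_trans (subset_leq_card DS)).
have := @annealed R n P P_ge0 P_row P_col k.+1 k.+1 set0 L _ (fun _ _ z => ent z)
  L_ge0 g0 (leqnn _) kn hG k 1%g set0 [set v] v.
rewrite (sum_agree0 (fun q => ex q k (q v) _)) nag0 cards1 add1n => h.
apply: le_trans (h _ _ _ _ _ _ _); rewrite ?sub0set ?in_set1 ?inE //; last first.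
  by rewrite -setI_eq0 set0I.
apply: ler_sum => p _; apply: ex_le => // s _.
by case: coll; rewrite ?ent_le.
Qed.

Lemma entup_mono i k : (i <= k)%N -> (k.+1 < n)%N -> entup i <= entup k.
Proof.
move=> ik kn; have nk j : (j <= k)%N -> 0 < (n - j.+1)%:R :> R.
  by move=> jk; rewrite ltr0n subn_gt0 (leq_ltn_trans _ kn).
have inv : (n - i.+1)%:R^-1 <= (n - k.+1)%:R^-1 :> R.
  by rewrite lef_pV2 ?posrE ?nk // ler_nat leq_sub2l.
apply: lerD.
  by apply: ler_wpM2l => //; apply: mulr_ge0 => //; exact: avent_ge0.
apply: ler_pM => //.
- by apply: mulr_ge0; [exact: L_ge0 | exact: divr_ge0].
- by rewrite ler_nat.
by apply: ler_wpM2l; [exact: L_ge0 | apply: ler_pM; rewrite ?ler_nat ?invr_ge0].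
Qed.

Lemma entup_ge0 k : 0 <= entup k.
Proof.
apply: addr_ge0; first by apply: divr_ge0 => //; apply: mulr_ge0 => //; exact: avent_ge0.
apply: mulr_ge0 => //; apply: mulr_ge0; [exact: L_ge0 | exact: divr_ge0].
Qed.

Lemma annealed_lw k v : (k.+1 < n)%N ->
  \sum_p ex p k (p v) (lw p (p v)) <= k%:R * (entup k * N).
Proof.
move=> kn; under eq_bigr do rewrite ex_lw.
rewrite exchange_big /= mulr_natl -[X in _ *+ X](card_ord k) -sumr_const.
apply: ler_sum => i _; have ik : (i <= k)%N by apply: ltnW.
apply: le_trans (annealed_ent _ _) _; first exact: leq_ltn_trans kn.
by rewrite ler_wpM2r // entup_mono.
Qed.

(** The square is expanded at the first pick; the cross term involves the mean of the remaining walk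
    from the image of a fixed vertex, which [annealed_lw] controls. An upper bound is enough for the
    variance, since the first moment is exact by stationarity. *)
Lemma second_moment k K : (k <= K)%N -> (K.+1 < n)%N ->
  \sum_p \sum_x ex p k x (fun s => lw p x s ^+ 2) <=
  (k%:R * (L * H) + k%:R ^+ 2 * (H * entup K)) * (n%:R * N).
Proof.
move=> kK Kn; elim: k kK => [|k IH] kK.
  by rewrite big1 ?mul0r ?expr0n ?mul0r ?addr0 ?mul0r // => p _; rewrite big1 // => x _; rewrite /= expr0n.
have {}IH := IH (ltnW kK).
have step p x : ex p k.+1 x (fun s => lw p x s ^+ 2) =
   \sum_v P x v * info x v ^+ 2 +
   \sum_v P x v * info x v *+ 2 * ex p k (p v) (lw p (p v)) +
   \sum_v P x v * ex p k (p v) (fun s => lw p (p v) s ^+ 2).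
  rewrite exS -!big_split /=; apply: eq_bigr => v _.
  rewrite -mulrnAr -mulrA -!mulrDr; congr (_ * _).
  rewrite -exZ -[X in _ = X + _ + _](ex_cst P_row p k (p v)) -!exD.
  by apply: ex_eq => s _; ring.
under eq_bigr do under eq_bigr do rewrite step.
under eq_bigr do rewrite !big_split /=.
rewrite !big_split /=.
have t1 : \sum_(p : 'S_n) \sum_x \sum_v P x v * info x v ^+ 2 <= L * H * (n%:R * N).
  rewrite sumr_const -[X in X <= _]mulr_natr mulrA ler_wpM2r // -mulrA [H * _]mulrC -sum_ent mulr_sumr.
  apply: ler_sum => x _; rewrite mulr_sumr; apply: ler_sum => v _.
  rewrite expr2 mulrCA; apply: ler_wpM2r => //; apply: mulr_ge0 => //; exact: info_ge0.
have t3 : \sum_p \sum_x \sum_v P x v * ex p k (p v) (fun s => lw p (p v) s ^+ 2) =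
    \sum_p \sum_x ex p k x (fun s => lw p x s ^+ 2).
  apply: eq_bigr => p _.
  rewrite (sum_step P_col (fun v => ex p k (p v) (fun s => lw p (p v) s ^+ 2))).
  by rewrite (sum_perm p (fun z => ex p k z (fun s => lw p z s ^+ 2))).
have t2 : \sum_p \sum_x \sum_v P x v * info x v *+ 2 * ex p k (p v) (lw p (p v)) <=
    2 * k%:R * (H * entup K) * (n%:R * N).
  rewrite exchange_big /=; apply: le_trans (_ : \sum_x \sum_v P x v * info x v *+ 2 *
     (k%:R * (entup K * N)) <= _).
    apply: ler_sum => x _; rewrite exchange_big /=; apply: ler_sum => v _.
    rewrite -mulr_sumr; apply: ler_wpM2l.
      by apply: mulrn_wge0; apply: mulr_ge0 => //; exact: info_ge0.
    apply: le_trans (annealed_lw _ _) _; first by apply: leq_ltn_trans Kn; exact: ltnW.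
    apply: ler_wpM2l => //; apply: ler_wpM2r => //.
    by apply: entup_mono => //; exact: ltnW.
  under eq_bigr do rewrite -mulr_suml sumrMnl.
  rewrite -mulr_suml sumrMnl -/(ent _) -[X in X *+ 2]/(\sum_x ent x) sum_ent.
  by rewrite le_eqVlt; apply/orP; left; apply/eqP; ring.
apply: le_trans (lerD (lerD t1 t2) (eq_ind_r (fun X => X <= _) IH t3)) _.
rewrite -!mulrDl ler_wpM2r ?mulr_ge0 // -natr1.
have a0 : 0 <= H * entup K by rewrite mulr_ge0 ?avent_ge0 ?entup_ge0.
rewrite -subr_ge0 (_ : _ - _ = H * entup K) //; ring.
Qed.

Definition varb k : R := k%:R * (L * H) + k%:R ^+ 2 * (H * (entup k - H)).

Lemma variance k : (k.+1 < n)%N ->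
  \sum_p \sum_x ex p k x (fun s => (lw p x s - k%:R * H) ^+ 2) <=
  varb k * (n%:R * N).
Proof.
move=> kn.
have e p x : ex p k x (fun s => (lw p x s - k%:R * H) ^+ 2) =
   ex p k x (fun s => lw p x s ^+ 2) - k%:R * H *+ 2 * ex p k x (lw p x) + (k%:R * H) ^+ 2.
  rewrite -exZ -[X in _ = _ + X](ex_cst P_row p k x) -exB -exD.
  by apply: ex_eq => s _; ring.
under eq_bigr do under eq_bigr do rewrite e.
have sumn c : \sum_(x < n) c = n%:R * c :> R by rewrite sumr_const card_ord mulr_natl.
have sumN c : \sum_(p : 'S_n) c = N * c :> R by rewrite sumr_const mulr_natl.
under eq_bigr do rewrite big_split sumrB /= -mulr_sumr sum_lw sumn.
rewrite big_split sumrB /= !sumN.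
apply: le_trans (lerD (lerB (second_moment (leqnn k) kn) (lexx _)) (lexx _)) _.
by rewrite le_eqVlt; apply/orP; left; apply/eqP; rewrite /varb; ring.
Qed.

Lemma chebyshev k a : (k.+1 < n)%N -> 0 < a ->
  \sum_p \sum_x ex p k x (fun s => (a <= `|lw p x s - k%:R * H|)%R%:R) <=
  varb k / a ^+ 2 * (n%:R * N).
Proof.
move=> kn a0; have a2 : 0 < a ^+ 2 by rewrite exprn_gt0.
rewrite mulrAC ler_pdivlMr //; apply: le_trans (variance kn).
rewrite mulr_suml; apply: ler_sum => p _; rewrite mulr_suml; apply: ler_sum => x _.
rewrite mulrC -exZ; apply: ex_le => // s _.
case: (leP a) => h; last by rewrite mulr0 sqr_ge0.
by rewrite mulr1 -[leRHS]real_normK ?num_real // lerXn2r ?nnegrE // ltW.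
Qed.

Variable b : nat.
Variable c0 : R.
Definition typ p z s := c0 <= lw p z s.
Local Notation sub := (sub P b typ).
Local Notation sub2 := (sub2 P b typ).
Local Notation submass := (submass P b typ).

Lemma submassE p : submass p = \sum_z ex p b z (fun s => (typ p z s)%:R).
Proof.
apply: eq_bigr => z _.
rewrite (eq_bigr (fun y => sub p z y * 1)) => [|y _]; last by rewrite mulr1.
by rewrite (ex_endpE P p b z _ (fun=> 1)); apply: ex_eq => s _; rewrite mulr1.
Qed.

Lemma submass_bound : (b.+1 < n)%N -> c0 < b%:R * H ->
  \sum_p (1 - submass p / n%:R) <= varb b / (b%:R * H - c0) ^+ 2 * N.
Proof.
move=> bn hc; have n0 : n%:R != 0 :> R by rewrite pnatr_eq0 -lt0n.
rewrite -(ler_pM2r (x := n%:R)) ?ltr0n // -[leRHS]mulrA [X in _ <= _ * X]mulrC.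
apply: le_trans (chebyshev bn _); last by rewrite subr_gt0.
rewrite mulr_suml; apply: ler_sum => p _.
rewrite mulrBl mul1r mulfVK // submassE -[X in X - _]mulr1 mulr_natl -[X in _ *+ X](card_ord n).
rewrite -sumr_const -sumrB; apply: ler_sum => z _.
rewrite -[X in X - _](ex_cst P_row p b z) -exB; apply: ex_le => // s _.
rewrite /typ; case: (leP c0) => h; first by rewrite subrr.
rewrite subr0 ler1n lt0b distrC ger0_norm; first by rewrite lerD2l lerN2 ltW.
by rewrite subr_ge0 ltW // (lt_trans h).
Qed.

(** The squares are dominated by the event that two independent walks from a common start end at the
    same vertex, the first along a nice path. Either the paths are equal, which has probability at
    most [expR (- c0)] given the first, or they collide. The condition [0 < b] provides a last
    pick. *)
Lemma sub2_bound : (0 < b)%N -> (b.*2.+1 < n)%N ->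
  \sum_p sub2 p <=
  (expR (- c0) + b.*2.*2%:R * (b.*2.+1%:R / (n - b.*2.+1)%:R)) * (n%:R * N).
Proof.
move=> b0 bn.
have h1 p z u : p u = z -> \sum_y sub p z y ^+ 2 <= expR (- c0) +
    ex p b z (fun s => ex p b z (fun s' => (pcoll [set u] s s')%:R)).
  move=> _.
  apply: le_trans (_ : ex p b z (fun s => (typ p z s)%:R * ex p b z (fun s' =>
     (endp p z s' == endp p z s)%:R)) <= _).
    rewrite -(ex_endpE P p b z (fun s => (typ p z s)%:R)
      (fun y => ex p b z (fun s' => (endp p z s' == y)%:R))).
    apply: ler_sum => y _; rewrite expr2; apply: ler_wpM2l; first exact: sub_ge0.
    by apply: ex_le => // s _; case: typ; rewrite ?mul1r ?mul0r.
  rewrite -[X in _ <= X + _](ex_cst P_row p b z) -exD; apply: ex_le => // s ss.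
  have [ts|_] := boolP (typ p z s); last first.
    by rewrite mul0r addr_ge0 ?expR_ge0 //; apply: ex_ge0.
  rewrite mul1r; apply: le_trans (_ : pw p z s +
    ex p b z (fun s' => (pcoll [set u] s s')%:R) <= _); last first.
    by rewrite lerD2r (le_trans (pw_le _ _ _)) // ler_expR lerN2.
  rewrite -(ex_pw p z ss) -exD; apply: ex_le => // s' ss'.
  have [-> |ne] := eqVneq s' s; first by rewrite ler_wpDr // lern1 leq_b1.
  rewrite add0r; case: eqP => // e.
  case: s ss ts ne e => [|v s] ss ts ne e; first by move: b0; rewrite -ss.
  case: s' ss' ne e => [|v' s'] ss' ne e; first by move: b0; rewrite -ss'.
  rewrite pcoll_last //.
  - by move: ss; rewrite -ss' => -[].
  - by rewrite eq_sym.
  - by apply: (@perm_inj _ p); rewrite -!(endp_last p z).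
apply: le_trans (_ : \sum_p \sum_u (expR (- c0) +
    ex p b (p u) (fun s => ex p b (p u) (fun s' => (pcoll [set u] s s')%:R))) <= _).
  apply: ler_sum => p _; rewrite /sub2 -(sum_perm p); apply: ler_sum => u _.
  exact: h1.
rewrite exchange_big /=; have -> : forall X Y, (X + Y) * (n%:R * N) =
  \sum_(u < n) (X * N + Y * N) by move=> X Y; rewrite sumr_const card_ord -mulrDl -[RHS]mulr_natl; ring.
apply: ler_sum => u _; rewrite big_split /= sumr_const -[X in X + _]mulr_natr lerD2l.
rewrite -(sum_agree0 (fun q => ex q b (q u) _)) -nag0; apply: annealed_pcoll => //.
- exact: sub0set.
- by rewrite inE.
- by rewrite inE.
- by rewrite cards1 add1n.
Qed.

Lemma ret_bound k : (k.+1 < n)%N ->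
  \sum_p ret P k p <= k%:R * (k.+1%:R / (n - k.+1)%:R) * N.
Proof.
move=> kn; have n0 : 0 < n%:R :> R by rewrite ltr0n.
rewrite /ret -mulr_sumr ler_pdivrMl // exchange_big /=.
have sumn c : n%:R * c = \sum_(x < n) c :> R by rewrite sumr_const card_ord mulr_natl.
rewrite sumn; apply: ler_sum => u _.
rewrite -(sum_agree0 (fun q => hit P q _ k (q u))) -nag0.
apply: le_trans (annealed_coll P_ge0 P_row P_col (k := k) 1%g (D := set0) (S := [set u]) (v := u) kn _ _ _ _).
- apply: ler_sum => q _; apply: ex_le => // s _.
  by case: (boolP (has _ s)) => // /(has_coll (subxx _)) ->.
- exact: sub0set.
- by rewrite inE.
- by rewrite inE.
- by rewrite cards1 add1n.
Qed.

End Entropy.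

(** * Lower bound on the distance *)

Section Lower.
Variables (R : realType) (n : nat) (P : 'I_n -> 'I_n -> R).
Hypothesis n_gt0 : (0 < n)%N.
Hypothesis P_ge0 : forall x v, 0 <= P x v.
Hypothesis P_row : forall x, \sum_v P x v = 1.
Implicit Types (p : 'S_n) (x y z v : 'I_n) (s : seq 'I_n).
Local Notation ex := (ex P).

(** A single path to [y] with probability at least [expR (- c)] already gives [y] that much mass. *)
Lemma ex_light p k x c y :
  let q := ex p k x (fun s => (lw P p x s <= c)%R%:R * (endp p x s == y)%:R) in
  q = 0 \/ expR (- c) <= q.
Proof.
elim: k x c => [|k IH] x c /=.
  case: leP => c0; last by left; rewrite mul0r.
  case: eqP => _; last by left; rewrite mulr0.
  by right; rewrite mulr1 -[leRHS]expR0 ler_expR oppr_le0.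
have q0 v c' : 0 <= ex p k v (fun s => (lw P p v s <= c')%R%:R * (endp p v s == y)%:R).
  by apply: ex_ge0 => // s _; rewrite mulr_ge0.
have e v : ex p k (p v) (fun s => (info P x v + lw P p (p v) s <= c)%R%:R *
    (endp p (p v) s == y)%:R) =
  ex p k (p v) (fun s => (lw P p (p v) s <= c - info P x v)%R%:R * (endp p (p v) s == y)%:R).
  by apply: ex_eq => s _; rewrite lerBrDl.
under eq_bigr do rewrite e.
have [h|] := boolP [forall v, P x v * ex p k (p v) (fun s =>
    (lw P p (p v) s <= c - info P x v)%R%:R * (endp p (p v) s == y)%:R) == 0].
  by left; apply: big1 => v _; apply/eqP; apply: (forallP h).
move=> /forallPn[v]; rewrite mulf_eq0 negb_or => /andP[p0 qn0].
right; rewrite (bigD1 v) //=; apply: ler_wpDr.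
  by apply: sumr_ge0 => w _; rewrite mulr_ge0.
have [/eqP|h] := IH (p v) (c - info P x v); first by rewrite (negbTE qn0).
have -> : expR (- c) = P x v * expR (- (c - info P x v)).
  by rewrite {1}(P_expR P_ge0 p0) -expRD; congr expR; ring.
by rewrite ler_wpM2l.
Qed.

(** By [ex_light], paths of probability at least [expR (- c)] reach at most [expR c] vertices, each
    excused for [1/n]; all other vertices are fed only by paths with [c < lw]. *)
Lemma dist_ge p t x c :
  1 - expR c / n%:R - ex p t x (fun s => (c < lw P p x s)%R%:R) <= dist P p set0 t x.
Proof.
have n0 : 0 < n%:R :> R by rewrite ltr0n.
pose q1 y := ex p t x (fun s => (lw P p x s <= c)%R%:R * (endp p x s == y)%:R).
pose q2 y := ex p t x (fun s => (c < lw P p x s)%R%:R * (endp p x s == y)%:R).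
have q20 y : 0 <= q2 y by apply: ex_ge0 => // s _; rewrite mulr_ge0.
have q10 y : 0 <= q1 y by apply: ex_ge0 => // s _; rewrite mulr_ge0.
have e2 : \sum_y q2 y = ex p t x (fun s => (c < lw P p x s)%R%:R).
  rewrite (eq_bigr (fun y => q2 y * 1)) => [|y _]; last by rewrite mulr1.
  by rewrite (ex_endpE P p t x _ (fun=> 1)); apply: ex_eq => s _; rewrite mulr1.
have e1 : \sum_y q1 y <= 1.
  rewrite (eq_bigr (fun y => q1 y * 1)) => [|y _]; last by rewrite mulr1.
  rewrite (ex_endpE P p t x _ (fun=> 1)) -[leRHS](ex_cst P_row p t x).
  by apply: ex_le => // s _; rewrite mulr1 lern1 leq_b1.
rewrite dist0E -e2.
pose A := [set y | q1 y != 0].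
have cA : #|A|%:R <= expR c.
  rewrite -[leRHS]mulr1 -[c]opprK expRN -ler_pdivrMl ?invr_gt0 ?expR_gt0 // invrK mulrC.
  apply: le_trans e1; rewrite mulr_natl -sumr_const.
  rewrite [leRHS](bigID (fun y => y \in A)) /=; apply: ler_wpDr; first exact: sumr_ge0.
  apply: ler_sum => y; rewrite inE => qn0.
  by have [/eqP|//] := ex_light p t x c y; rewrite -/(q1 y) (negbTE qn0).
apply: le_trans (_ : \sum_y (n%:R^-1 - (y \in A)%:R * n%:R^-1 - q2 y) <= _); last first.
  apply: ler_sum => y _; have [yA|yA] := boolP (y \in A).
    by rewrite mul1r subrr sub0r (le_trans _ (pp_ge0 _)) // oppr_le0.
  rewrite mul0r subr0; apply: le_trans (le_pp _); rewrite lerD2l lerN2.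
  move: yA; rewrite inE negbK => /eqP q1y.
  rewrite -[leRHS]add0r -q1y -exD; apply: ex_le => // s _; rewrite -mulrDl.
  by case: (leP _ c); rewrite ?addr0 ?add0r mul1r.
rewrite sumrB sumrB lerD2r (sum_unif R x) lerD2l lerN2 -mulr_suml ler_wpM2r ?invr_ge0 //.
by apply: le_trans cA; rewrite -natr_sum ler_nat -sum1_card [leqRHS]big_mkcond.
Qed.

End Lower.

(** * Quantitative bounds for fixed size *)

Section Chernoff.
Variables (R : realType) (n : nat).
Hypothesis n_gt0 : (0 < n)%N.

Lemma expR_le_half (x : R) : 0 <= x <= 2^-1 -> expR x <= 1 + 2 * x.
Proof.
move=> /andP[x0 x2]; have x1 : 0 < 1 - x by lra.
have h : 1 - x <= expR (- x) by have := expR_ge1Dx (- x).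
rewrite -[x]opprK expRN; apply: le_trans (_ : (1 - x)^-1 <= _).
  by rewrite lef_pV2 ?posrE ?expR_gt0.
rewrite -[leLHS]mul1r ler_pdivrMr // opprK; nra.
Qed.

(** Exponential moment at [la = (2 * om)^-1], which keeps [la * w v] below 1/2, where
    [expR x <= 1 + 2 * x]. *)
Lemma chernoff (F B : {set 'I_n}) (w : 'I_n -> R) (om be a : R) : 0 < om -> 0 <= be ->
  (forall v, 0 <= w v <= om) -> \sum_(v in F) w v <= 1 -> #|B|%:R <= be * n%:R ->
  Eu (fun u : {ffun 'I_n -> 'I_n} =>
    (a < \sum_(v in F) w v * (u v \in B)%:R)%R%:R) <=
  expR (- ((a - 2 * be) / (2 * om))).
Proof.
move=> om0 be0 wom w1 cB; set la := (2 * om)^-1.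
have la0 : 0 < la by rewrite invr_gt0 mulr_gt0.
have n0 : 0 < n%:R :> R by rewrite ltr0n.
apply: le_trans (_ : Eu (fun u : {ffun 'I_n -> 'I_n} => expR (- (la * a)) *
   \prod_(v in F) expR (la * (w v * (u v \in B)%:R))) <= _).
  apply: Eu_le => u; rewrite -expR_sum -expRD -mulr_sumr.
  case: ltP => h; last exact: expR_ge0.
  by rewrite -[leLHS]expR0 ler_expR addrC -mulrBr mulr_ge0 ?subr_ge0 // ltW.
rewrite EuZ (Eu_prod n_gt0 F (fun v z => expR (la * (w v * (z \in B)%:R)))).
apply: le_trans (_ : expR (- (la * a)) * \prod_(v in F) expR (2 * be * la * w v) <= _).
  apply: ler_wpM2l; first exact: expR_ge0.
  apply: ler_prod => v vF; apply/andP; split.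
    by rewrite mulr_ge0 ?invr_ge0 // sumr_ge0 // => z _; exact: expR_ge0.
  apply: le_trans (expR_ge1Dx _); have /andP[w0 wo] := wom v.
  have lw2 : 0 <= la * w v <= 2^-1.
    rewrite mulr_ge0 ?(ltW la0) //= /la mulrC ler_pdivrMr ?mulr_gt0 //; lra.
  apply: le_trans (_ : n%:R^-1 * \sum_z (1 + (z \in B)%:R * (2 * (la * w v))) <= _).
    rewrite ler_wpM2l ?invr_ge0 //; apply: ler_sum => z _; case: (z \in B).
      by rewrite mulr1 mul1r expR_le_half.
    by rewrite !mulr0 mul0r expR0 addr0.
  rewrite big_split /= sumr_const card_ord -mulr_suml mulrDr mulVf ?gt_eqF // lerD2l.
  have -> : \sum_z (z \in B)%:R = #|B|%:R :> R.
    by rewrite -natr_sum -sum1_card [in RHS]big_mkcond.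
  rewrite [leLHS]mulrA (_ : 2 * be * la * w v = be * (2 * (la * w v))); last by ring.
  apply: ler_wpM2r; first by rewrite mulr_ge0 //; case/andP: lw2.
  by rewrite mulrC ler_pdivrMr.
rewrite -expR_sum -expRD ler_expR -mulr_sumr /la.
rewrite -/la; have : 2 * be * la * \sum_(v in F) w v <= 2 * be * la.
  by rewrite ler_piMr // !mulr_ge0 // ltW.
set Sw := _ * \sum_(v in F) _ => hS; rewrite mulrBl opprB [a * la]mulrC; lra.
Qed.

End Chernoff.

Section Finite.
Variables (R : realType) (n : nat) (P : 'I_n -> 'I_n -> R).
Hypothesis P_ge0 : forall x v, 0 <= P x v.
Hypothesis P_row : forall x, \sum_v P x v = 1.
Hypothesis P_col : forall v, \sum_x P x v = 1.
Variable Delta : nat.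
Hypothesis P_supp_row : forall x, (#|[set v | P x v != 0%R]| <= Delta)%N.
Hypothesis P_supp_col : forall v, (#|[set x | P x v != 0%R]| <= Delta)%N.
Hypothesis P_half : forall x v, P x v <= 2^-1.
Variable h : nat.
Local Notation M := (ball_size Delta h).
Local Notation m := (M%:R : R).
Local Notation N := (#|'S_n|%:R : R).
Local Notation H := (avent P).
Local Notation dist := (dist P).
Hypothesis M_ge2 : (2 <= M)%N.
Hypothesis M20 : (M ^ 20 <= n)%N.
Variable L : R.
Hypothesis info_le : forall x v, info P x v <= L.
Hypothesis L_le : L <= m.

Let M_pow (i : nat) : (i < 20)%N -> (2 * M ^ i <= n)%N.
Proof.
move=> i20; apply: leq_trans M20; apply: (@leq_trans (M ^ i.+1)).
  by rewrite expnS leq_mul2r M_ge2 orbT.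
by rewrite leq_exp2l // ltnW.
Qed.

Let n_gt0 : (0 < n)%N.
Proof. by have := M_pow (isT : 0 < 20)%N; rewrite expn0; apply: leq_trans. Qed.

Let n0 : 0 < n%:R :> R. Proof. by rewrite ltr0n. Qed.
Let m0 : 0 < m. Proof. by rewrite ltr0n (leq_trans _ M_ge2). Qed.
Let N0 : 0 < N.
Proof. by rewrite ltr0n; apply/card_gt0P; exists 1%g. Qed.

Let M_lt_n : (M < n)%N.
Proof.
have := M_pow (isT : 1 < 20)%N; rewrite expn1; apply: leq_trans.
by rewrite mul2n -addnn -add1n leq_add2r (leq_trans _ M_ge2).
Qed.

Let sub_gt0 r : (r <= M)%N -> 0 < (n - r)%:R :> R.
Proof. by move=> rM; rewrite ltr0n subn_gt0 (leq_ltn_trans rM). Qed.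

(** [M] serves as the common scale: with [M ^ 20 <= n], every error of the form [M ^ i / n] met
    below is at most [1/M]. *)
Lemma frac_le a r : (r <= M)%N -> (a <= M ^ 18)%N -> a%:R / (n - r)%:R <= m^-1.
Proof.
move=> rM aM; rewrite ler_pdivrMr ?sub_gt0 // ler_pdivlMl // -natrM ler_nat.
apply: (@leq_trans (M ^ 19)); first by rewrite expnS leq_mul2l aM orbT.
rewrite leq_subRL; last by rewrite ltnW // (leq_ltn_trans rM).
apply: leq_trans (M_pow (isT : 19 < 20)%N).
rewrite mul2n -addnn leq_add2r (leq_trans rM) // -[X in (X <= _)%N]expn1.
by rewrite leq_exp2l // ltnW.
Qed.

Lemma frac_le0 a : (a <= M ^ 18)%N -> a%:R / n%:R <= m^-1.
Proof. by move=> aM; have := frac_le (leq0n M) aM; rewrite subn0. Qed.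

Lemma ratio_le2 r : (r <= M)%N -> n%:R / (n - r)%:R <= 2 :> R.
Proof.
move=> rM; rewrite ler_pdivrMr ?sub_gt0 // -natrM ler_nat mulnBr leq_subRL.
  by have := M_pow (isT : 1 < 20)%N; rewrite expn1; lia.
by rewrite leq_mul2l ltnW ?orbT // (leq_ltn_trans rM).
Qed.

(** The excess [entup P L k - H] equals [k.+1 * (H + k * L) / (n - k.+1)], so the correlations
    between steps are negligible. *)
Lemma varb_le k : (k < M)%N -> varb P L k <= k%:R * (L * H) + m^-1.
Proof.
move=> kM; rewrite /varb lerD2l.
have H0 : 0 <= H by apply: avent_ge0.
have HL : H <= L by apply: avent_le.
have L0 : 0 <= L by apply: le_trans HL.
have km : k%:R <= m by rewrite ler_nat ltnW.
set D := (n - k.+1)%:R : R.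
have D0 : 0 < D by exact: sub_gt0.
have e : entup P L k - H = (k.+1%:R * (H + k%:R * L)) / D.
  have nD : n%:R = D + k.+1%:R by rewrite /D -natrD subnK // (leq_trans kM) // ltnW.
  by rewrite /entup -/D nD; field; rewrite gt_eqF.
rewrite e; apply: le_trans (frac_le (a := (M ^ 3 * (M * (M + M * M)))%N) kM _).
  have natE c : (c ^ 3 * (c * (c + c * c)))%:R =
      c%:R ^+ 2 * (c%:R * (c%:R * (c%:R + c%:R * c%:R))) :> R.
    by rewrite natrM natrX natrM natrD natrM; ring.
  have -> : k%:R ^+ 2 * (H * (k.+1%:R * (H + k%:R * L) / D)) =
    k%:R ^+ 2 * (H * (k.+1%:R * (H + k%:R * L))) / D by ring.
  rewrite natE ler_pM2r ?invr_gt0 //.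
  apply: ler_pM; rewrite ?exprn_ge0 //.
  - by apply: mulr_ge0 => //; rewrite mulr_ge0 // addr_ge0 // mulr_ge0.
  - by apply: lerXn2r; rewrite ?nnegrE.
  apply: ler_pM => //; first by rewrite mulr_ge0 // addr_ge0 // mulr_ge0.
    exact: le_trans L_le.
  apply: ler_pM => //; first by rewrite addr_ge0 // mulr_ge0.
    by rewrite ler_nat.
  apply: lerD; last exact: ler_pM.
  exact: le_trans L_le.
have natle c : (2 <= c)%N -> (c ^ 3 * (c * (c + c * c)) <= c ^ 18)%N.
  move=> c2; apply: (@leq_trans (c ^ 7)); last by rewrite leq_exp2l.
  rewrite (expnD c 3 4) leq_mul2l; apply/orP; right.
  rewrite !expnS expn0 muln1 leq_mul2l; apply/orP; right.
  apply: (@leq_trans (2 * (c * c))); last first.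
    by rewrite leq_mul2r c2 orbT.
  by rewrite mul2n -addnn leq_add2r leq_pmulr // ltnW.
exact: natle.
Qed.

Let sumN c : \sum_(p : 'S_n) c = c * N :> R.
Proof. by rewrite sumr_const mulr_natr. Qed.

Let M_small : (M * (M + M) * 2 <= n)%N.
Proof.
have h3 : (M * (M + M) * 2 = 2 * 2 * (M * M))%N by ring.
rewrite h3; apply: leq_trans (M_pow (isT : 3 < 20)%N); rewrite -mulnA leq_mul2l /=.
by rewrite !expnS expn0 muln1 leq_mul2r M_ge2 orbT.
Qed.

Let fuel_M : (fuel Delta h <= M)%N.
Proof.
have := fuel_size Delta h; have : Delta = 0%N -> fuel Delta h = 0%N by rewrite /fuel => ->.
move: (fuel Delta h) => f; case: Delta => [->//|D _ hf]; apply: leq_trans hf.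
by rewrite mulnS addnCA leq_addr.
Qed.

Let Delta_M : (Delta <= M)%N.
Proof. by apply: leq_trans (fuel_size Delta h); rewrite leq_addr. Qed.

Let pdeadE : pdead R n Delta h = (fuel Delta h * (M * Delta))%:R / (n - M)%:R.
Proof. by rewrite /pdead mulrA -natrM. Qed.

Let fuel3 : (fuel Delta h * (M * Delta) <= M ^ 3)%N.
Proof. by rewrite !expnS expn0 muln1; apply: leq_mul => //; apply: leq_mul. Qed.

Lemma pdead_le : pdead R n Delta h <= m^-1.
Proof.
rewrite pdeadE; apply: frac_le => //; apply: leq_trans fuel3 _.
by rewrite leq_exp2l // ltnW.
Qed.

Lemma pdead2_le : n%:R * pdead R n Delta h ^+ 2 <= m^-1.
Proof.
rewrite pdeadE; set a := (fuel _ _ * _)%N.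
have a3 : (a <= M ^ 3)%N by exact: fuel3.
apply: le_trans (frac_le (a := (2 * a * a)%N) (leqnn M) _).
  have -> : n%:R * (a%:R / (n - M)%:R) ^+ 2 =
    a%:R * a%:R * (n%:R / (n - M)%:R) / (n - M)%:R :> R by ring.
  rewrite ler_pM2r ?invr_gt0 ?sub_gt0 //.
  have -> : (2 * a * a)%:R = a%:R * a%:R * 2 :> R by rewrite natrM natrM; ring.
  by rewrite ler_wpM2l ?ratio_le2 // mulr_ge0.
apply: (@leq_trans (M * (M ^ 3 * M ^ 3))); last by rewrite -expnD -expnS leq_exp2l // ltnW.
by rewrite -mulnA; apply: leq_mul => //; apply: leq_mul.
Qed.

(** In order: dead branches; then, under the factor 2 of the resampling, atypical paths, the
    parameter [al], fluctuations, hits of moved vertices, returns to the own seed. *)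
Definition avgb b c0 al : R :=
  m^-1 + 2 * ((b%:R * (L * H) + m^-1) / (b%:R * H - c0) ^+ 2 + al / 2 +
    2 ^- h.+1 * (1 + 2 * (b.*2.*2 * b.*2.+1)%:R) / (2 * al) + m^-1 + m^-1).

Lemma avg_dist b c0 al x : (0 < b)%N -> (b.*2.+1 <= M)%N -> c0 < b%:R * H ->
  n%:R * expR (- c0) <= 1 -> 0 < al ->
  \sum_p dist p set0 (h.+1 + b) x <= avgb b c0 al * N.
Proof.
move=> b0 bM hc hn al0.
have bM1 : (b.+1 <= M)%N by apply: leq_trans bM; rewrite ltnS -addnn leq_addr.
have lt_n k : (k <= M)%N -> (k < n)%N by move=> kM; exact: leq_ltn_trans kM M_lt_n.
apply: le_trans (typical n_gt0 P_ge0 P_row P_col P_supp_row P_half M_small b (typ P c0) x al0) _.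
rewrite /avgb [leRHS]mulrDl; apply: lerD.
  apply: le_trans (prob_dead1 P_supp_row P_supp_col x M_lt_n) _.
  by rewrite ler_wpM2r ?(ltW N0) // pdead_le.
rewrite -mulrA ler_wpM2l // 4!big_split /=.
set V := _ / (b%:R * H - c0) ^+ 2; set Y := _ / (2 * al).
have -> : (V + al / 2 + Y + m^-1 + m^-1) * N =
  V * N + al / 2 * N + Y * N + m^-1 * N + m^-1 * N by ring.
rewrite {}/V {}/Y.
apply: lerD; last first.
  apply: le_trans (ret_bound n_gt0 P_ge0 P_row P_col (lt_n _ bM1)) _.
  rewrite ler_wpM2r ?(ltW N0) // mulrA -natrM; apply: frac_le => //.
  apply: (@leq_trans (M ^ 2)); last by rewrite leq_exp2l // ltnW.
  by rewrite !expnS expn0 muln1; apply: leq_mul => //; exact: ltnW.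
apply: lerD; last first.
  rewrite sumN ler_wpM2r ?(ltW N0) //; apply: frac_le0.
  apply: (@leq_trans (M ^ 2)); last by rewrite leq_exp2l // ltnW.
  by rewrite !expnS expn0 muln1 leq_mul2r mul2n (ltnW bM) orbT.
apply: lerD; last first.
  rewrite -mulr_suml -mulr_sumr.
  apply: le_trans (_ : 2 ^- h.+1 * ((1 + 2 * (b.*2.*2 * b.*2.+1)%:R) * N) / (2 * al) <= _);
    last by rewrite le_eqVlt; apply/orP; left; apply/eqP; ring.
  rewrite ler_wpM2r ?invr_ge0 ?mulr_ge0 ?(ltW al0) // ler_wpM2l ?invr_ge0 ?exprn_ge0 //.
  apply: le_trans (sub2_bound P_ge0 P_row P_col c0 b0 (lt_n _ bM)) _.
  rewrite mulrA ler_wpM2r ?(ltW N0) // mulrDl; apply: lerD; first by rewrite mulrC.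
  have := ratio_le2 bM; set r := n%:R / _ => hr.
  have -> : b.*2.*2%:R * (b.*2.+1%:R / (n - b.*2.+1)%:R) * n%:R =
    (b.*2.*2 * b.*2.+1)%:R * r by rewrite natrM /r; ring.
  by rewrite mulrC ler_wpM2r.
apply: lerD; last by rewrite sumN.
apply: le_trans (submass_bound n_gt0 P_ge0 P_row P_col info_le (lt_n _ bM1) hc) _.
rewrite ler_wpM2r ?(ltW N0) // ler_wpM2r ?invr_ge0 ?sqr_ge0 //.
exact: varb_le.
Qed.

(** [8 * e1] is the fixed point of the contraction sending [D] to [D / 2 + 4 * e1], iterated [K]
    times from the trivial bound 1 at time [t1]. The exceptional events are a bad environment, a
    start with two dead branches, and a failing frontier in a good environment. *)
Lemma upper_bound b c0 al e1 K (t1 := (h.+1 + b)%N) :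
  (0 < b)%N -> (b.*2.+1 <= M)%N -> c0 < b%:R * H ->
  n%:R * expR (- c0) <= 1 -> 0 < al ->
  m^-1 <= e1 -> 2 / 2 ^+ h.+1 <= e1 / 2 -> (t1 < M)%N ->
  \sum_p [exists x, 2 ^- K + 8 * e1 < dist p set0 (K * h.+1 + t1) x]%R%:R <=
  (16 * (avgb b c0 al + m^-1) / e1 ^+ 2 + m^-1 +
   2 * (n%:R * expR (- (2 ^+ h * e1 / 4)) + m^-1)) * N.
Proof.
move=> b0 bM hc hn al0 me h2 t1M.
have mi : 0 < m^-1 by rewrite invr_gt0.
have e10 : 0 < e1 by apply: lt_le_trans me.
have e1m : e1^-1 <= m by rewrite -[leRHS]invrK lef_pV2 // posrE.
(* With bad density [2 * eta = e1 / 8] and threshold [e1 / 2], the Chernoff exponent is [e1 / 4]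
   divided by [2 * 2 ^- h.+1 = 2 ^- h]. *)
pose eta : R := e1 / 16.
have t1m : t1%:R <= m by rewrite ler_nat ltnW.
have slack : 2 * m + 4 * m * t1%:R / e1 <= eta * n%:R.
  have hm : 16 * (2 * m + 4 * m * m * m) * m <= n%:R.
    have : (16 * (2 * M + 4 * M * M * M) * M <= n)%N.
      apply: leq_trans (M_pow (isT : 11 < 20)%N).
      apply: (@leq_trans (M ^ 4 * M ^ 6 * M)); last first.
        by rewrite -expnD -expnSr leq_pmull.
      rewrite leq_mul2r; apply/orP; right; apply: leq_mul.
        by rewrite -[16%N]/(2 ^ 4)%N leq_exp2r.
      have aux c : (2 <= c)%N -> (2 * c + 4 * c * c * c <= c ^ 6)%N.
        move=> c2; have c1 : (0 < c)%N by exact: ltnW.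
        apply: (@leq_trans (2 * c ^ 5)); last by rewrite [(c ^ 6)%N]expnS leq_mul2r c2 orbT.
        rewrite [X in (_ <= X)%N]mul2n -addnn leq_add //.
          rewrite expnSr leq_mul2r; apply/orP; right.
          by rewrite (leq_trans c2) // -{1}(expn1 c) leq_exp2l.
        rewrite !expnSr expn0 mul1n !leq_mul2r; do 3 (apply/orP; right).
        exact: (@leq_mul 2 2).
      exact: aux.
    by rewrite -(ler_nat R) !(natrM, natrD).
  have ei0 : 0 <= e1^-1 by rewrite invr_ge0 ltW.
  apply: le_trans (_ : 2 * m + 4 * m * (m * m) <= _).
    rewrite lerD2l -!mulrA ler_wpM2l // ler_wpM2l //.
    exact: ler_pM.
  apply: le_trans (_ : m^-1 / 16 * n%:R <= _); last first.
    by rewrite /eta ler_wpM2r // ler_wpM2r ?invr_ge0.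
  have -> : m^-1 / 16 * n%:R = n%:R / (16 * m) by field; rewrite gt_eqF.
  rewrite ler_pdivlMr ?mulr_gt0 //.
  by apply: le_trans hm; rewrite le_eqVlt; apply/orP; left; apply/eqP; ring.
pose del : R := t1%:R / kap Delta h e1 / n%:R.
have hdel : n%:R * (m ^+ 4 * del ^+ 2) <= m^-1.
  have -> : n%:R * (m ^+ 4 * del ^+ 2) = m ^+ 6 * (t1%:R * t1%:R * 4 * (e1^-1 * e1^-1)) / n%:R.
    by rewrite /del /kap; field; rewrite !gt_eqF.
  apply: le_trans (frac_le0 (a := (M ^ 6 * (M * M * 4 * (M * M)))%N) _).
    rewrite ler_pM2r ?invr_gt0 // natrM natrX ler_wpM2l ?exprn_ge0 //.
    rewrite natrM natrM natrM; have ei0 : 0 <= e1^-1 by rewrite invr_ge0 ltW.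
    apply: ler_pM; rewrite ?mulr_ge0 //; last exact: ler_pM.
    by rewrite ler_wpM2r //; exact: ler_pM.
  apply: (@leq_trans (M ^ 12)); last by rewrite leq_exp2l // ltnW.
  rewrite (_ : (M ^ 12 = M ^ 6 * (M * M * (M * M) * (M * M)))%N); last by rewrite !expnS; ring.
  rewrite leq_mul2l; apply/orP; right; rewrite leq_mul2r; apply/orP; right.
  by rewrite leq_mul2l; apply/orP; right; apply: (@leq_mul 2 2).
have h1 x : (1 < n%:R * (n%:R * (m ^+ 4 * del ^+ 2))) || true by rewrite orbT.
pose cb : R := expR (- (2 ^+ h * e1 / 4)).
have cb0 : 0 <= cb by exact: expR_ge0.
have chern (F B : {set 'I_n}) (w : 'I_n -> R) : (forall v, 0 <= w v <= 2 ^- h.+1) ->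
    \sum_(v in F) w v <= 1 -> #|B|%:R <= 2 * eta * n%:R ->
    Eu (fun u : {ffun 'I_n -> 'I_n} =>
      (e1 / 2 < \sum_(v in F) w v * (u v \in B)%:R)%R%:R) <= cb.
  move=> hw w1 cB.
  have om0 : 0 < 2 ^- h.+1 :> R by rewrite invr_gt0 exprn_gt0.
  have be0 : 0 <= 2 * eta by rewrite mulr_ge0 // divr_ge0 // ltW.
  apply: le_trans (chernoff n_gt0 (e1 / 2) om0 be0 hw w1 cB) _.
  rewrite ler_expR lerN2 le_eqVlt; apply/orP; left; apply/eqP.
  have hp : 2 ^+ h != 0 :> R by rewrite expf_neq0 // pnatr_eq0.
  by rewrite /eta exprS; field.
apply: le_trans (_ : \sum_p ((~~ goodenv P t1 e1 eta p)%:R +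
   \sum_x (1 < dead P Delta h x p)%N%:R +
   \sum_x (fail P Delta h t1 e1 x p && goodenv P t1 e1 eta p)%:R) <= _).
  apply: ler_sum => p _.
  have s1 : 0 <= \sum_x (1 < dead P Delta h x p)%N%:R :> R by apply: sumr_ge0.
  have s2 : 0 <= \sum_x (fail P Delta h t1 e1 x p && goodenv P t1 e1 eta p)%:R :> R.
    by apply: sumr_ge0.
  have [hg|_] := boolP (goodenv P t1 e1 eta p); last first.
    rewrite -addrA; apply: ler_wpDr; first by apply: addr_ge0 => //; apply: sumr_ge0.
    by rewrite ler_nat leq_b1.
  rewrite add0r; case: existsP => [[x hx]|_]; last by apply: addr_ge0 => //; apply: sumr_ge0.
  have [hall|] := boolP [forall y, (dead P Delta h y p <= 1)%N && ~~ fail P Delta h t1 e1 y p].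
    suff hK i y : dist p set0 (i * h.+1 + t1) y <= 2 ^- i + 8 * e1.
      by have := hK K x; rewrite leNgt hx.
    elim: i y => [|i IH] y.
      rewrite expr0 invr1; apply: ler_wpDr; first by rewrite mulr_ge0 // ltW.
      exact: dist_le1.
    have hy z := forallP hall z.
    have := contraction P_ge0 P_row P_col P_supp_row P_half e10 hy _ IH y.
    rewrite mulSn -addnA => /(_ (leq_addl _ _)) /le_trans; apply.
    rewrite exprS le_eqVlt; apply/orP; left; apply/eqP.
    have hp : 2 ^+ i != 0 :> R by rewrite expf_neq0 // pnatr_eq0.
    by field.
  move=> /forallPn[y]; rewrite negb_and negbK -ltnNge => /orP[hd|hf].
    apply: ler_wpDr; first exact: sumr_ge0.
    by rewrite (bigD1 y) //= hd lerDl sumr_ge0.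
  by apply: ler_wpDl => //; rewrite (bigD1 y) //= hf andbT lerDl sumr_ge0.
rewrite !big_split /=; set B1 := _ / e1 ^+ 2; set B3 := 2 * _.
have -> : (B1 + m^-1 + B3) * N = B1 * N + m^-1 * N + B3 * N by ring.
rewrite {}/B1 {}/B3; apply: lerD; first apply: lerD.
(* Markov over starting points and over permutations; killing at the own pick adds at most the
   return probability to the distance. *)
- have et0 : 0 < e1 ^+ 2 / 16 * n%:R by rewrite mulr_gt0 // divr_gt0 // exprn_gt0.
  rewrite -(ler_pM2l et0) mulr_sumr.
  apply: le_trans (_ : \sum_p \sum_v psi P t1 p v <= _).
    apply: ler_sum => p _; have [|hg] := boolP (goodenv P t1 e1 eta p).
      by rewrite mulr0 sumr_ge0 // => v _; apply: dist_ge0.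
    rewrite mulr1; move: hg; rewrite /goodenv -ltNge => hg.
    have h3 := card_markov e10 (fun v => dist_ge0 P p [set v] t1 (p v)) (lexx _).
    have : eta * n%:R < (\sum_v psi P t1 p v) / e1 by apply: lt_le_trans hg h3.
    rewrite ltr_pdivlMr // => /ltW; apply: le_trans.
    by rewrite /eta le_eqVlt; apply/orP; left; apply/eqP; field.
  apply: le_trans (_ : n%:R * ((avgb b c0 al + m^-1) * N) <= _); last first.
    rewrite le_eqVlt; apply/orP; left; apply/eqP; by field; rewrite !gt_eqF.
  apply: le_trans (_ : \sum_p (\sum_x dist p set0 t1 x + n%:R * ret P t1 p) <= _).
    apply: ler_sum => p _; rewrite /ret mulVKf ?gt_eqF // -[X in _ <= X + _](sum_perm p) -big_split.
    apply: ler_sum => v _; rewrite /psi -[X in dist _ X](set0U [set v]).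
    exact: dist_hit.
  rewrite big_split /= -mulr_sumr mulrDl mulrDr; apply: lerD.
    rewrite exchange_big mulr_natl -[X in _ *+ X](card_ord n) -sumr_const.
    by apply: ler_sum => x _; apply: avg_dist.
  rewrite ler_wpM2l //; apply: le_trans (ret_bound n_gt0 P_ge0 P_row P_col _) _.
    exact: leq_ltn_trans t1M M_lt_n.
  rewrite ler_wpM2r ?(ltW N0) // mulrA -natrM; apply: frac_le => //.
  apply: (@leq_trans (M ^ 2)); last by rewrite leq_exp2l // ltnW.
  by rewrite !expnS expn0 muln1; apply: leq_mul => //; exact: ltnW.
- rewrite exchange_big /=; apply: le_trans (_ : \sum_(x < n) (pdead R n Delta h ^+ 2 * N) <= _).
    by apply: ler_sum => x _; apply: prob_dead2.
  rewrite sumr_const card_ord -[X in X <= _]mulr_natl mulrA ler_wpM2r ?(ltW N0) //.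
  exact: pdead2_le.
rewrite exchange_big /=.
apply: le_trans (_ : \sum_(x < n) (2 * (cb + m ^+ 4 * del ^+ 2) * N) <= _).
  by apply: ler_sum => x _; apply: prob_fail.
rewrite sumr_const card_ord -[X in X <= _]mulr_natl mulrA ler_wpM2r ?(ltW N0) //.
by rewrite mulrCA ler_wpM2l // mulrDr lerD2l.
Qed.

(** If all distances are at most [eps], then by [dist_ge] every walk has [c < lw] with probability
    at least [(1 - eps) / 2]; Chebyshev and Markov bound the proportion of such permutations. *)
Lemma lower_bound t c eps : (t < M)%N -> t%:R * H < c -> eps < 1 ->
  expR c / n%:R <= (1 - eps) / 2 ->
  \sum_p [forall x, dist p set0 t x <= eps]%R%:R <=
  (t%:R * (L * H) + m^-1) / (c - t%:R * H) ^+ 2 / ((1 - eps) / 2) * N.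
Proof.
move=> tM hc e1 hn.
have g0 : 0 < (1 - eps) / 2 by lra.
have tn : (t.+1 < n)%N by exact: leq_ltn_trans M_lt_n.
have a0 : 0 < c - t%:R * H by rewrite subr_gt0.
rewrite mulrAC ler_pdivlMr // -(ler_pM2r n0).
apply: le_trans (_ : \sum_p \sum_x ex P p t x (fun s =>
    (c - t%:R * H <= `|lw P p x s - t%:R * H|)%R%:R) <= _); last first.
  apply: le_trans (chebyshev n_gt0 P_ge0 P_row P_col info_le tn a0) _.
  rewrite -[leRHS]mulrA (mulrC N) ler_wpM2r ?mulr_ge0 ?(ltW n0) ?(ltW N0) //.
  by rewrite ler_wpM2r ?invr_ge0 ?sqr_ge0 // varb_le.
rewrite -mulrA mulr_suml; apply: ler_sum => p _.
have nn x : 0 <= ex P p t x (fun s => (c - t%:R * H <= `|lw P p x s - t%:R * H|)%R%:R).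
  by apply: ex_ge0.
case: forallP => [hp|_]; last by rewrite mul0r sumr_ge0.
rewrite mul1r mulr_natr -[X in _ *+ X](card_ord n) -sumr_const; apply: ler_sum => x _.
have := dist_ge n_gt0 P_ge0 P_row p t x c; set E := ex _ _ _ _ _ => hd.
have hx := hp x.
have : E <= ex P p t x (fun s => (c - t%:R * H <= `|lw P p x s - t%:R * H|)%R%:R).
  apply: ex_le => // s _; case: (ltP c) => // hcs.
  rewrite ler1n lt0b; apply: le_trans (ler_norm _); rewrite lerD2r; exact: ltW.
lra.
Qed.

End Finite.

(** * Choice of the parameters *)

Section Numeric.
Variable R : realType.

Lemma ln2_ge_half : 2^-1 <= ln 2 :> R.
Proof.
rewrite -ler_expR lnK ?posrE //; apply: le_trans (expR_le_half _) _; lra.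
Qed.

Lemma ln_le_id (x : R) : 0 < x -> ln x <= x.
Proof.
move=> x0; have := expR_ge1Dx (ln x); rewrite lnK ?posrE //; lra.
Qed.

Lemma truncn_bounds (x : R) : 0 <= x ->
  (Num.truncn x)%:R <= x /\ x < (Num.truncn x).+1%:R.
Proof. by move=> x0; have /andP[] := truncn_itv x0. Qed.

Lemma expRN_le (x : R) : 0 < x -> expR (- x) <= x^-1.
Proof.
move=> x0; rewrite expRN lef_pV2 ?posrE ?expR_gt0 //.
by have := expR_ge1Dx x; lra.
Qed.

(** [b * H] is just above [(1 + de / 2) * l] and [tl * H] just below [(1 - de) * l]. The thresholds
    [(1 + de / 4) * l] and [(1 - de / 2) * l] separate them from [l], with gaps of at least
    [de * l / 4] for Chebyshev. *)
Lemma parameters (n Delta K : nat) (H de rho e1 g L l ll : R) :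
  L = ln Delta%:R -> l = ln n%:R -> ll = ln l ->
  (2 <= Delta)%N -> (0 < n)%N -> 2^-1 <= H -> H <= L ->
  0 < de -> de <= 1 -> 0 < rho -> rho <= 1 -> 0 < e1 -> e1 <= 1 -> 0 < g -> g <= 1 ->
  1 <= ll ->
  1000 * K.+1%:R / (rho ^+ 2 * de ^+ 2) * (L * ll) <= l ->
  1000 / (rho ^+ 2 * de ^+ 2 * e1 * g) <= l ->
  exists h b tl : nat, let m := (ball_size Delta h)%:R : R in
  [/\ [/\ (2 <= ball_size Delta h)%N, (ball_size Delta h ^ 20 <= n)%N & L <= m],
      [/\ (0 < b)%N, (b.*2.+1 <= ball_size Delta h)%N, (1 + de / 4) * l < b%:R * H,
          n%:R * expR (- ((1 + de / 4) * l)) <= 1 & (h.+1 + b < ball_size Delta h)%N],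
      [/\ m^-1 <= e1, 2 / 2 ^+ h.+1 <= e1 / 2, m^-1 <= rho,
          (b%:R * (L * H) + m^-1) / (b%:R * H - (1 + de / 4) * l) ^+ 2 <= rho &
          2 ^- h.+1 * (1 + 2 * (b.*2.*2 * b.*2.+1)%:R) / (2 * (2 * rho)) <= rho],
      [/\ n%:R * expR (- (2 ^+ h * e1 / 4)) <= rho &
          H * (K * h.+1 + (h.+1 + b))%:R <= (1 + de) * l] &
      [/\ (tl < ball_size Delta h)%N, tl%:R * H < (1 - de / 2) * l,
          (1 - de) * l < tl.+1%:R * H, expR ((1 - de / 2) * l) / n%:R <= g &
          (tl%:R * (L * H) + m^-1) / ((1 - de / 2) * l - tl%:R * H) ^+ 2 <= rho]].
Proof.
move=> LE lE llE D2 n_gt0 H2 HL de0 de1 rho0 rho1 e10 e11 g0 g1 ll1 hk hl.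
have H0 : 0 < H by clear -H2; lra.
have L0 : 0 < L by clear -H0 HL; lra.
have n0 : 0 < n%:R :> R by rewrite ltr0n.
have r20 : 0 < rho ^+ 2 by rewrite exprn_gt0.
have d20 : 0 < de ^+ 2 by rewrite exprn_gt0.
have r21 : rho ^+ 2 <= 1 by rewrite expr_le1 // ltW.
have d21 : de ^+ 2 <= 1 by rewrite expr_le1 // ltW.
have rd0 : 0 < rho ^+ 2 * de ^+ 2 by rewrite mulr_gt0.
have Lll0 : 0 <= L * ll by rewrite mulr_ge0 //; [exact: ltW | clear -ll1; lra].
have hkc c : c * (rho ^+ 2 * de ^+ 2) <= 1000 * K.+1%:R -> c * (L * ll) <= l.
  move=> hc; apply: le_trans hk; rewrite ler_wpM2r // ler_pdivlMr //.
have prod0 : 0 < rho ^+ 2 * de ^+ 2 * e1 * g by rewrite !mulr_gt0.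
have l00 : 0 <= l.
  by rewrite lE ln_ge0 // ler1n.
have hlx x : rho ^+ 2 * de ^+ 2 * e1 * g <= x -> 1000 <= l * x.
  move=> hx; move: hl; rewrite ler_pdivrMr // => /le_trans; apply.
  by rewrite ler_wpM2l.
have K1 : 1 <= K.+1%:R :> R by rewrite ler1n.
have le1M (x y : R) : 0 <= x -> 0 <= y -> x <= 1 -> y <= 1 -> x * y <= 1.
  by move=> *; rewrite mulr_ile1.
have rd1 : rho ^+ 2 * de ^+ 2 <= 1 by rewrite le1M // ltW.
have rde : rho ^+ 2 * de ^+ 2 * e1 <= rho ^+ 2 * de ^+ 2 by rewrite ler_piMr // ltW.
have rdg : rho ^+ 2 * de ^+ 2 * e1 * g <= rho ^+ 2 * de ^+ 2 * e1.
  by rewrite ler_piMr // !mulr_ge0 // ltW.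
have l1000 : 1000 <= l.
  by rewrite -[leRHS]mulr1; apply: hlx; apply: le_trans rdg (le_trans rde rd1).
have l0 : 0 < l by clear -l1000; lra.
have Lll1000 : 1000 * K.+1%:R * (L * ll) <= l.
  by apply: hkc; rewrite ler_piMr // mulr_ge0.
have Lll' : 1000 * (L * ll) <= l.
  apply: le_trans Lll1000; rewrite ler_wpM2r // ler_peMr //.
have Lle : L <= L * ll by rewrite ler_peMr // ltW.
have L1000 : 1000 * L <= l by clear -Lll' Lle; lra.
have e2 : expR l = n%:R by rewrite lE lnK // posrE.
(* [2 ^ h] must dominate both the square of the walk length, of order at most [l ^+ 2], and the
   exponent [l] of the union bound, so it is taken at least [l ^+ 3]. It is also at most [l ^+ 4],
   which makes [h] of order [ll]. *)
pose N3 := (Num.truncn (l ^+ 3)).+1.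
have l30 : 0 <= l ^+ 3 by rewrite exprn_ge0 // ltW.
have [tr1 tr2] := truncn_bounds l30.
have l31 : 1 <= l ^+ 3 by rewrite exprn_ege1 //; clear -l1000; lra.
have N31 : (1 < N3)%N.
  by rewrite ltnS truncn_gt0.
pose h := up_log 2 N3.
have /andP[hlo hhi] := up_log_bounds (isT : 1 < 2)%N N31.
have h_gt0 : (0 < h)%N by rewrite up_log_gt0.
have hl3 : l ^+ 3 <= 2 ^+ h.
  by apply: le_trans (ltW tr2) _; rewrite -natrX ler_nat.
have hl4 : 2 ^+ h <= l ^+ 4.
  rewrite -(prednK h_gt0) exprS; apply: le_trans (_ : 2 * (l ^+ 3 + 1) <= _).
    rewrite ler_wpM2l //; apply: le_trans (_ : N3%:R <= _).
      by rewrite -natrX ler_nat ltnW.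
    by rewrite /N3 -natr1 lerD2r.
  have -> : l ^+ 4 = l * l ^+ 3 by rewrite exprS.
  move: l31 l1000 l30; move: (l ^+ 3) => c3; clear -l0 => c31 l1 c30.
  have h4 : 4 * c3 <= l * c3 by rewrite ler_wpM2r //; lra.
  lra.
have hll : h%:R <= 8 * ll.
  have := hl4; rewrite -ler_ln ?posrE ?exprn_gt0 // !lnXn // -[ln 2 *+ h]mulr_natl -llE.
  rewrite (_ : ll *+ 4 = 4 * ll); last by rewrite mulr_natl.
  have hh : h%:R * 2^-1 <= h%:R * ln 2 :> R by rewrite ler_wpM2l // ln2_ge_half.
  move: hh; set w := _ * ln 2; move: w; clear => w; lra.
have h2ll : (h.+2)%:R <= 10 * ll.
  by rewrite -addn2 natrD; move: hll ll1; move: (h%:R) => hr; clear => h1 h2; lra.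
have lll : ll <= l by rewrite llE ln_le_id.
have sq0 : 0 < l ^+ 2 by rewrite exprn_gt0.
have l3E : l ^+ 3 = l * l ^+ 2 by rewrite exprS.
have ll2 : l <= l ^+ 2 by rewrite expr2 ler_peMl // ; clear -l1000; lra.
have l3big : 20 * l <= l ^+ 3.
  rewrite l3E mulrC ler_wpM2l //; apply: le_trans ll2; clear -l1000; lra.
have l3l2 : l ^+ 2 <= l ^+ 3 by rewrite l3E ler_peMl ?(ltW sq0) //; clear -l1000; lra.
set M := ball_size Delta h; pose m : R := M%:R.
have m2h : 2 ^+ h <= m.
  rewrite -natrX ler_nat /M /ball_size; apply: (@leq_trans (Delta.+1 ^ h)%N).
    by rewrite leq_exp2r // (leq_trans D2).
  by rewrite leq_exp2l ?ltnS 1?ltnW // !leqW.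
have hm3 : l ^+ 3 <= m by apply: le_trans m2h.
have m0 : 0 < m by apply: lt_le_trans hm3; rewrite exprn_gt0.
have M2 : (2 <= M)%N.
  rewrite -(ler_nat R) -/m; apply: le_trans hm3; apply: le_trans l3big.
  by clear -l1000; lra.
have D0 : 0 < Delta%:R :> R by rewrite ltr0n ltnW.
have lnD1 : ln Delta.+1%:R <= 2 * L.
  rewrite LE mulr_natl -lnXn // ler_ln ?posrE ?exprn_gt0 // -natrX ler_nat.
  rewrite expnS expn1; apply: (@leq_trans (Delta + Delta)); first by rewrite -addn1 leq_add2l ltnW.
  by rewrite addnn -mul2n leq_mul2r D2 orbT.
have lnm : ln m <= 20 * (L * ll).
  rewrite /m /M /ball_size natrX lnXn // -[_ *+ h.+2]mulr_natl.
  have h3 : h.+2%:R * ln Delta.+1%:R <= 10 * ll * (2 * L) :> R.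
    by apply: ler_pM => //; apply: ln_ge0; rewrite ler1n.
  apply: le_trans h3 _; rewrite le_eqVlt; apply/orP; left; apply/eqP; clear; ring.
(* Here the smallness of [L * ll] against [l], that is, the growth condition on the exponent of the
   walk, makes the ball a small power of [n]. *)
have M20 : (M ^ 20 <= n)%N.
  rewrite -(ler_nat R) natrX -/m -ler_ln ?posrE ?exprn_gt0 // lnXn // -lE.
  rewrite (_ : ln m *+ 20 = 20 * ln m); last by rewrite mulr_natl.
  apply: le_trans Lll'; move: lnm Lll0; move: (ln m) (L * ll) => a c.
  by clear => h1 h2; lra.
have Lm : L <= m.
  apply: le_trans hm3; apply: le_trans l3big; clear -L1000 l0; lra.
have mi : m^-1 <= (l ^+ 2)^-1.
  by rewrite lef_pV2 ?posrE //; exact: le_trans hm3.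
have miR x : rho ^+ 2 * de ^+ 2 * e1 * g <= x -> 0 < x -> m^-1 <= x / 1000.
  move=> hx x0; apply: le_trans mi _; apply: le_trans (_ : l^-1 <= _).
    by rewrite lef_pV2 ?posrE.
  rewrite -[leLHS]mul1r ler_pdivrMr // mulrAC ler_pdivlMr // mul1r mulrC; exact: hlx.
have x1 : 0 <= (1 + de / 2) * l / H by rewrite divr_ge0 ?mulr_ge0 ?addr_ge0 ?divr_ge0 // ltW.
have [tb1 tb2] := truncn_bounds x1.
set b := (Num.truncn ((1 + de / 2) * l / H)).+1.
have hb1 : (1 + de / 2) * l < b%:R * H by rewrite -ltr_pdivrMr.
have lH : l * 2^-1 <= l * H by rewrite ler_wpM2l.
have hb2 : b%:R * H <= (1 + de / 2) * l + H.
  by rewrite /b -natr1 mulrDl mul1r lerD2r -ler_pdivlMr.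
have hb3 : b%:R <= 4 * l.
  rewrite /b -natr1; apply: le_trans (_ : 3 * l + 1 <= _); last by clear -l1000; lra.
  rewrite lerD2r; apply: le_trans tb1 _; rewrite ler_pdivrMr //.
  have dl : de * l <= l by rewrite ler_piMl // ltW.
  by clear -lH dl; lra.
have ml20 : 20 * l <= m by apply: le_trans hm3.
have hb4 : (b.*2.+1 <= M)%N.
  rewrite -(ler_nat R) -natr1 -muln2 natrM -/m; apply: le_trans ml20.
  by clear -hb3 l1000; lra.
have hhb : h.+2%:R + b%:R <= 14 * l :> R by clear -h2ll hb3 lll; lra.
have ht1 : (h.+1 + b < M)%N.
  rewrite -addSn -(ler_nat R) natrD -/m; apply: le_trans ml20; clear -hhb l0; lra.
set tl := Num.truncn ((1 - de) * l / H).
have x2 : 0 <= (1 - de) * l / H by rewrite divr_ge0 ?mulr_ge0 ?subr_ge0 // ltW.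
have [tt1 tt2] := truncn_bounds x2.
have ht2 : tl%:R * H <= (1 - de) * l by rewrite -ler_pdivlMr.
have ht3 : (1 - de) * l < tl.+1%:R * H by rewrite -ltr_pdivrMr.
have ht4 : (tl < M)%N.
  rewrite -(ltr_nat R) -/m; apply: le_lt_trans tt1 _; rewrite ltr_pdivrMr //.
  have dl : 0 <= de * l by rewrite mulr_ge0 // ltW.
  have mH : 20 * l * 2^-1 <= m * H by rewrite ler_pM // ?mulr_ge0 ?invr_ge0 // ltW.
  by clear -mH dl l0; lra.
have linv x : rho ^+ 2 * de ^+ 2 * e1 * g <= x -> 0 < x -> l^-1 <= x / 1000.
  move=> hx x0; rewrite -[leLHS]mul1r ler_pdivrMr // mulrAC ler_pdivlMr // mul1r mulrC.
  exact: hlx.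
have le1000 (x : R) : 0 < x -> x / 1000 <= x by clear => x0; lra.
have pe1 : rho ^+ 2 * de ^+ 2 * e1 * g <= e1.
  by apply: le_trans rdg _; rewrite ler_piMl // ltW.
have prho : rho ^+ 2 * de ^+ 2 * e1 * g <= rho.
  apply: le_trans rdg (le_trans rde _); apply: le_trans (_ : rho ^+ 2 <= _).
    by rewrite ler_piMr // ltW.
  by rewrite expr2 ler_piMl // ltW.
have pr2 : rho ^+ 2 * de ^+ 2 * e1 * g <= rho ^+ 2.
  by apply: le_trans rdg (le_trans rde _); rewrite ler_piMr // ltW.
have prd2 : rho ^+ 2 * de ^+ 2 * e1 * g <= rho * de ^+ 2.
  apply: le_trans rdg (le_trans rde _); rewrite ler_wpM2r ?(ltW d20) //.
  by rewrite expr2 ler_piMl // ltW.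
have pdg : rho ^+ 2 * de ^+ 2 * e1 * g <= de * g.
  rewrite ler_wpM2r ?(ltW g0) //; apply: le_trans rde _.
  apply: le_trans (_ : de ^+ 2 <= _); first by rewrite ler_piMl // ltW.
  by rewrite expr2 ler_piMl // ltW.
have dl0 : 0 < de * l by rewrite mulr_gt0.
(* Variance, of order [L * l], against the squared gap: [l] must be large compared with [L]. *)
have big : 3 * (L * l) + 1 <= rho * (de * l / 4) ^+ 2.
  have h1 : 96 * L <= rho * de ^+ 2 * l.
    have : 96 / (rho * de ^+ 2) * (L * ll) <= l.
      apply: hkc; rewrite (_ : _ * _ = 96 * rho); last by field; rewrite !gt_eqF.
      by clear -rho1 rho0 K1; lra.
    rewrite mulrAC ler_pdivrMr ?mulr_gt0 // => hh; rewrite [leRHS]mulrC.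
    by apply: le_trans hh; rewrite ler_wpM2l.
  have h2 : 1000 <= l * (rho * de ^+ 2) by apply: hlx.
  have -> : rho * (de * l / 4) ^+ 2 = rho * de ^+ 2 * l * l / 16 by field.
  move: h1 h2; rewrite [l * (rho * _)]mulrC; move: (rho * de ^+ 2 * l) => w h1 h2.
  have h3 : 96 * L * l <= w * l by rewrite ler_wpM2r.
  have h4 : 1000 * l <= w * l by rewrite ler_wpM2r.
  by clear -h3 h4 l1000; lra.
have sqle (x : R) : de * l / 4 <= x -> (de * l / 4) ^+ 2 <= x ^+ 2.
  move=> hx; apply: lerXn2r => //; rewrite nnegrE ?divr_ge0 ?(ltW dl0) //.
  by apply: le_trans hx; rewrite divr_ge0 ?(ltW dl0).
have quot (num x : R) : num <= 3 * (L * l) + 1 -> de * l / 4 <= x -> num / x ^+ 2 <= rho.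
  move=> hn hx; have x0 : 0 < x by apply: lt_le_trans hx; rewrite divr_gt0.
  rewrite ler_pdivrMr ?exprn_gt0 //; apply: le_trans hn (le_trans big _).
  by rewrite ler_wpM2l ?(ltW rho0) // sqle.
have mi1 : m^-1 <= 1.
  apply: le_trans (miR 1 _ ltr01) _; last by clear; lra.
  by apply: le_trans prho rho1.
have Ll : L <= l by clear -L1000 L0; lra.
exists h, b, tl => /=; split; split => //; rewrite -/M -/m.
- by clear -hb1 dl0; lra.
- rewrite -e2 -expRD -[leRHS]expR0 ler_expR; clear -dl0; lra.
- exact: le_trans (miR _ pe1 e10) (le1000 _ e10).
- apply: le_trans (_ : l^-1 <= _).
    have hp : 2 ^+ h != 0 :> R by rewrite expf_neq0 // pnatr_eq0.
    have -> : 2 / 2 ^+ h.+1 = (2 ^+ h)^-1 :> R by rewrite exprS; field.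
    rewrite lef_pV2 ?posrE ?exprn_gt0 //.
    by apply: le_trans hl3; apply: le_trans l3l2.
  by apply: le_trans (linv _ pe1 e10) _; clear -e10; lra.
- exact: le_trans (miR _ prho rho0) (le1000 _ rho0).
- apply: quot; last by clear -hb1 dl0; lra.
  apply: lerD => //.
  rewrite (_ : b%:R * (L * H) = L * (b%:R * H)); last by clear; ring.
  rewrite (_ : 3 * (L * l) = L * (3 * l)); last by clear; ring.
  have h1 : b%:R * H <= 3 * l.
    have dl : de * l <= l by rewrite ler_piMl // ltW.
    by clear -hb2 HL Ll dl l0; lra.
  by rewrite ler_wpM2l // ltW.
- have nb : 1 + 2 * (b.*2.*2 * b.*2.+1)%:R <= 289 * l ^+ 2.
    have -> : (b.*2.*2 * b.*2.+1)%:R = b%:R * 2 * 2 * (b%:R * 2 + 1) :> R by rewrite -[b.*2.+1]addn1 -!muln2 !natrM natrD !natrM.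
    have h1 : b%:R * 2 * 2 * (b%:R * 2 + 1) <= 16 * l * (9 * l).
      apply: ler_pM; rewrite ?mulr_ge0 ?addr_ge0 ?mulr_ge0 //; first by clear -hb3; lra.
      by clear -hb3 l1000; lra.
    have h2 : 1 <= l ^+ 2 by apply: le_trans ll2; clear -l1000; lra.
    have h3 : 16 * l * (9 * l) = 144 * l ^+ 2 by clear; ring.
    move: h1 h2; rewrite h3; move: (l ^+ 2) (b%:R * 2 * 2 * (b%:R * 2 + 1)) => u w.
    by clear => h1 h2; lra.
  rewrite ler_pdivrMr ?mulr_gt0 //.
  apply: le_trans (_ : (l * l ^+ 2)^-1 * (289 * l ^+ 2) <= _).
    apply: ler_pM => //; first by rewrite invr_ge0 exprn_ge0.
      by rewrite addr_ge0 // mulr_ge0.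
    rewrite lef_pV2 ?posrE ?exprn_gt0 ?mulr_gt0 // -l3E; apply: le_trans hl3 _.
    by rewrite exprS ler_peMl ?exprn_ge0 // ler1n.
  have -> : (l * l ^+ 2)^-1 * (289 * l ^+ 2) = 289 / l by field; rewrite gt_eqF.
  rewrite ler_pdivrMr //; have h1 : 1000 <= l * rho ^+ 2 by apply: hlx.
  rewrite (_ : rho * (2 * (2 * rho)) * l = 4 * (l * rho ^+ 2)); last by clear; ring.
  by move: h1; move: (l * _) => w; clear => h1; lra.
- rewrite -e2 -expRD; apply: le_trans (_ : expR (- l) <= _).
    rewrite ler_expR; have h1 : 1000 <= l * e1 by apply: hlx.
    have h2 : 8 * l <= 2 ^+ h * e1.
      apply: le_trans (_ : l ^+ 3 * e1 <= _); last by rewrite ler_wpM2r // ltW.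
      rewrite (_ : l ^+ 3 * e1 = l ^+ 2 * (l * e1)); last by clear; ring.
      apply: le_trans (_ : l * (l * e1) <= _); last by rewrite ler_wpM2r // mulr_ge0 // ltW.
      by rewrite mulrC ler_wpM2l //; apply: le_trans h1; clear; lra.
    by clear -h2; lra.
  by apply: le_trans (expRN_le l0) (le_trans (linv _ prho rho0) (le1000 _ rho0)).
- have h1 : 22 * K.+1%:R * (L * ll) <= de * l.
    have : 22 * K.+1%:R / de * (L * ll) <= l.
      apply: hkc; rewrite (_ : _ * _ = 22 * K.+1%:R * (rho ^+ 2 * de)); last by field; rewrite gt_eqF.
      apply: le_trans (_ : 22 * K.+1%:R <= _).
        by rewrite ler_piMr ?mulr_ge0 // le1M // ltW.
      by rewrite ler_wpM2r //; clear; lra.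
    by rewrite mulrAC ler_pdivrMr // [l * de]mulrC.
  have -> : H * (K * h.+1 + (h.+1 + b))%:R = K.+1%:R * (H * h.+1%:R) + b%:R * H.
    by rewrite !natrD natrM -[K.+1%:R]natr1; clear; ring.
  have h2 : H * h.+1%:R <= 10 * (L * ll).
    rewrite (_ : 10 * (L * ll) = L * (10 * ll)); last by clear; ring.
    apply: ler_pM => //; first exact: ltW.
    by apply: le_trans h2ll; rewrite ler_nat.
  have h3 : K.+1%:R * (H * h.+1%:R) <= 10 * K.+1%:R * (L * ll).
    by rewrite (_ : 10 * K.+1%:R * (L * ll) = K.+1%:R * (10 * (L * ll))) ?ler_wpM2l //; clear; ring.
  have h4 : L * ll <= K.+1%:R * (L * ll) by rewrite ler_peMl.
  move: h1 h3 h4; rewrite -!mulrA; move: (K.+1%:R * (L * ll)) (K.+1%:R * (H * _)) => w1 w2.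
  by clear -hb2 HL Lle; lra.
- by apply: le_lt_trans ht2 _; clear -dl0; lra.
- rewrite -e2 -expRN -expRD (_ : (1 - de / 2) * l - l = - (de * l / 2)); last by clear; ring.
  apply: le_trans (expRN_le _) _; first by rewrite divr_gt0.
  rewrite invfM invrK mulrC ler_pdivrMr //.
  have h1 : 1000 <= l * (de * g) by apply: hlx.
  rewrite (_ : g * (de * l) = l * (de * g)); last by clear; ring.
  by apply: le_trans h1; clear; lra.
- apply: quot; last by clear -ht2 dl0; lra.
  apply: lerD => //.
  rewrite (_ : tl%:R * (L * H) = L * (tl%:R * H)); last by clear; ring.
  rewrite (_ : 3 * (L * l) = L * (3 * l)); last by clear; ring.
  have h1 : tl%:R * H <= 3 * l by clear -ht2 dl0 l0; lra.
  by rewrite ler_wpM2l // ltW.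
Qed.

End Numeric.

(** 197 is [16 * 12 + 5]: each error is at most [rho], and twelve of them stand under the factor
    16. *)
Lemma upper_const (R : realFieldType) (m e1 rho A B U : R) :
  0 < e1 -> e1 <= 1 -> 0 < rho -> m <= rho -> A <= rho -> B <= rho -> U <= rho ->
  16 * (m + 2 * (A + 2 * rho / 2 + B + m + m) + m) / e1 ^+ 2 + m + 2 * (U + m)
    <= 197 * rho / e1 ^+ 2.
Proof.
move=> e10 e11 rho0 mr Ar Br Ur.
have e2 : 0 < e1 ^+ 2 by rewrite exprn_gt0.
have h1 : e1 ^+ 2 <= 1 by rewrite exprn_ile1 // ltW.
rewrite ler_pdivlMr // 2!mulrDl divfK ?gt_eqF //.
have h2 : (m + 2 * (U + m)) * e1 ^+ 2 <= 5 * rho.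
  apply: le_trans (_ : 5 * rho * e1 ^+ 2 <= _).
    by rewrite ler_pM2r //; clear -mr Ur; lra.
  by rewrite ler_piMr // mulr_ge0 // ltW.
by move: h2; rewrite mulrDl; move: (m * _) (2 * _ * e1 ^+ 2) => u v h2; clear -h2 mr Ar Br Ur rho0; lra.
Qed.

(** [e1 = eps / 16] gives half of [eps] to the limit [8 * e1] of the contraction and leaves half to
    [2 ^- K]. *)
Lemma eps_bounds (R : realFieldType) (eps : R) : 0 < eps -> eps < 1 ->
  [/\ 0 < eps / 16, eps / 16 <= 1, 0 < (1 - eps) / 2, (1 - eps) / 2 <= 1 &
      eps / 2 + 8 * (eps / 16) = eps].
Proof. by move=> e0 e1; split; try (move: e0 e1; clear; lra); field. Qed.

Section Window.
Variables (R : realType) (n : nat) (P : 'I_n -> 'I_n -> R).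
Hypotheses (P_ge0 : forall x v, 0 <= P x v) (P_row : forall x, \sum_v P x v = 1)
  (P_col : forall v, \sum_x P x v = 1).
Variable Delta : nat.
Hypotheses (P_supp_row : forall x, (#|[set v | P x v != 0%R]| <= Delta)%N)
  (P_supp_col : forall v, (#|[set x | P x v != 0%R]| <= Delta)%N)
  (P_half : forall x v, P x v <= 2^-1)
  (info_le : forall x v, info P x v <= ln Delta%:R).
Local Notation H := (avent P).

Lemma window (eps de rho l : R) (K : nat) :
  l = ln n%:R -> (2 <= Delta)%N -> (0 < n)%N -> 2^-1 <= H ->
  0 < eps -> eps < 1 -> 0 < de -> de <= 1 -> 0 < rho -> rho <= 1 ->
  2 ^- K <= eps / 2 -> 1 <= ln l ->
  1000 * K.+1%:R / (rho ^+ 2 * de ^+ 2) * (ln Delta%:R * ln l) <= l ->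
  1000 / (rho ^+ 2 * de ^+ 2 * (eps / 16) * ((1 - eps) / 2)) <= l ->
  exists tl tu : nat,
  [/\ (1 - de) * l < tl.+1%:R * H, H * tu%:R <= (1 + de) * l,
      \sum_p ([exists x, eps < dist P p set0 tu x]%:R : R)
        <= 197 * rho / (eps / 16) ^+ 2 * #|'S_n|%:R &
      \sum_p ([forall x, dist P p set0 tl x <= eps]%:R : R)
        <= rho / ((1 - eps) / 2) * #|'S_n|%:R].
Proof.
move=> lE D2 n0 H2 eps0 eps1 de0 de1 rho0 rho1 Keps ll1 hK hl.
have [e0 e1 g0 g1 e816] := eps_bounds eps0 eps1.
have HL : H <= ln Delta%:R by apply: avent_le.
have [h [b [tl /=]]] := parameters (erefl _) lE (erefl _) D2 n0 H2 HL de0 de1 rho0 rho1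
  e0 e1 g0 g1 ll1 hK hl.
move=> [[M2 M20 Lm] [b0 bM bH c0n t1M] [me1 he1 mrho A_le B_le] [U_le tu_le] [tlM tlH tlH' gl C_le]].
exists tl, (K * h.+1 + (h.+1 + b))%N; split => //.
  (* The choice [al = 2 * rho] turns the term [al / 2] into [rho]. *)
  have al0 : 0 < 2 * rho by rewrite mulr_gt0.
  have := upper_bound P_ge0 P_row P_col P_supp_row P_supp_col P_half M2 M20 info_le Lm
    K b0 bM bH c0n al0 me1 he1 t1M.
  move=> ub; apply: le_trans (le_trans ub _).
    apply: ler_sum => p _; rewrite ler_nat; case: (@existsP _ (fun x => eps < _)) => // -[x hx].
    rewrite (_ : [exists _, _]) //; apply/existsP; exists x; apply: le_lt_trans hx.
    by rewrite -[leRHS]e816 lerD2r.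
  by rewrite ler_wpM2r //; apply: upper_const.
have lb := lower_bound P_ge0 P_row P_col M2 M20 info_le Lm tlM tlH eps1 gl.
apply: le_trans lb _.
by rewrite ler_wpM2r // ler_wpM2r // invr_ge0 ltW.
Qed.

End Window.

(** * Powers of the walk on a regular digraph *)

Section Walks.
Variables (n d : nat) (E : rel 'I_n).
Hypothesis E_reg : regular_digraph d E.

Fixpoint walks k (u v : 'I_n) : nat :=
  if k is k'.+1 then (\sum_w E u w * walks k' w v)%N else u == v.

Lemma out_degree u : (\sum_v E u v)%N = d.
Proof. by rewrite -(E_reg.1 u) -sum1dep_card [RHS]big_mkcond /=; apply: eq_bigr => v _; case: (E u v). Qed.

Lemma in_degree v : (\sum_u E u v)%N = d.
Proof. by rewrite -(E_reg.2 v) -sum1dep_card [RHS]big_mkcond /=; apply: eq_bigr => u _; case: (E u v). Qed.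

Lemma walks_row k u : (\sum_v walks k u v)%N = (d ^ k)%N.
Proof.
elim: k u => [|k IHk] u /=.
  by rewrite (bigD1 u) //= eqxx big1 // => v /negbTE; rewrite eq_sym => ->.
rewrite exchange_big /=; transitivity (\sum_w E u w * d ^ k)%N.
  by apply: eq_bigr => w _; rewrite -big_distrr /= IHk.
by rewrite -big_distrl /= out_degree expnS.
Qed.

Lemma walks_col k v : (\sum_u walks k u v)%N = (d ^ k)%N.
Proof.
elim: k => [|k IHk] /=.
  by rewrite (bigD1 v) //= eqxx big1 // => u /negbTE ->.
rewrite exchange_big /= expnS -IHk big_distrr /=.
by apply: eq_bigr => w _; rewrite -big_distrl /= in_degree.
Qed.

(** Forgetting the first edge leaves at most all walks of length [k] into [v]. The entries of the
    power are therefore at most [1/d]. *)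
Lemma walks_le k u v : (walks k.+1 u v <= d ^ k)%N.
Proof. by rewrite -(walks_col k v); apply: leq_sum => w _; case: (E u w); rewrite ?mul1n. Qed.

Variable R : realType.

Lemma srw_powE k u v : (srw R d E ^+ k) u v = (d ^ k)%:R^-1 * (walks k u v)%:R.
Proof.
elim: k u v => [|k IHk] u v.
  by rewrite expr0 expn0 invr1 mul1r /= !mxE.
rewrite exprS mxE natr_sum mulr_sumr; apply: eq_bigr => w _.
by rewrite IHk !mxE natrM expnS natrM invfM; ring.
Qed.

Hypothesis d_ge2 : (2 <= d)%N.
Variable k : nat.
Hypothesis k_gt0 : (0 < k)%N.
Let P u v := (srw R d E ^+ k) u v.

Let dk_gt0 : 0 < (d ^ k)%:R :> R.
Proof. by rewrite ltr0n expn_gt0 (ltnW d_ge2). Qed.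

Lemma srw_pow_ge0 u v : 0 <= P u v.
Proof. by rewrite /P srw_powE mulr_ge0 // invr_ge0. Qed.

Lemma srw_pow_row u : \sum_v P u v = 1.
Proof.
under eq_bigr do rewrite /P srw_powE.
by rewrite -mulr_sumr -natr_sum walks_row mulVf // gt_eqF.
Qed.

Lemma srw_pow_col v : \sum_u P u v = 1.
Proof.
under eq_bigr do rewrite /P srw_powE.
by rewrite -mulr_sumr -natr_sum walks_col mulVf // gt_eqF.
Qed.

Lemma srw_pow_neq0 u v : P u v != 0 -> (0 < walks k u v)%N.
Proof. by rewrite /P srw_powE lt0n; apply: contraNneq => ->; rewrite mulr0. Qed.

Lemma srw_pow_supp_row u : (#|[set v | P u v != 0%R]| <= d ^ k)%N.
Proof.
rewrite -(walks_row k u) -sum1dep_card [leqRHS](bigID (fun v => P u v != 0%R)) /=.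
by apply: leq_trans (leq_addr _ _); apply: leq_sum => v /srw_pow_neq0.
Qed.

Lemma srw_pow_supp_col v : (#|[set u | P u v != 0%R]| <= d ^ k)%N.
Proof.
rewrite -(walks_col k v) -sum1dep_card [leqRHS](bigID (fun u => P u v != 0%R)) /=.
by apply: leq_trans (leq_addr _ _); apply: leq_sum => u /srw_pow_neq0.
Qed.

Lemma srw_pow_half u v : P u v <= 2^-1.
Proof.
rewrite /P srw_powE mulrC ler_pdivrMr // mulrC ler_pdivlMr // -natrM ler_nat.
rewrite -(prednK k_gt0) expnS mulnC; apply: leq_mul => //; exact: walks_le.
Qed.

(** A nonzero entry counts at least one walk, so it is at least [1 / d ^ k]. *)
Lemma srw_pow_info_le u v : info P u v <= ln (d ^ k)%:R.
Proof.
rewrite /info; have [->|P0] := eqVneq (P u v) 0.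
  by rewrite invr0 ln0 // ln_ge0 // ler1n expn_gt0 (ltnW d_ge2).
have w0 := srw_pow_neq0 P0; have P_gt0 : 0 < P u v by rewrite lt_def P0 srw_pow_ge0.
rewrite ler_ln ?posrE ?invr_gt0 // invf_ple ?posrE // /P srw_powE.
by rewrite ler_peMr ?invr_ge0 ?ler1n // ltW.
Qed.

Lemma srw_pow_avent_ge : (0 < n)%N -> 2^-1 <= avent P.
Proof.
move=> n0; apply: le_trans (ln2_ge_half R) _.
rewrite /avent mulrC ler_pdivlMr ?ltr0n //.
rewrite (_ : _ * _ = \sum_(u < n) ln 2); last by rewrite sumr_const card_ord mulr_natr.
apply: ler_sum => u _; have -> : ln 2 = (\sum_v P u v) * ln 2 :> R by rewrite srw_pow_row mul1r.
rewrite mulr_suml.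
apply: ler_sum => v _; have [->|P0] := eqVneq (P u v) 0; first by rewrite !mul0r.
have P_gt0 : 0 < P u v by rewrite lt_def P0 srw_pow_ge0.
rewrite ler_pM2l // ler_ln ?posrE ?invr_gt0 //.
rewrite -[leLHS]invrK lef_pV2 ?posrE ?invr_gt0 //.
exact: srw_pow_half.
Qed.

End Walks.

(** * Mixing time of the permuted chain *)

Lemma permuted_chain_powE (R : realType) (n : nat) (M : 'M[R]_n) k s t x y :
  (permuted_chain M k s ^+ t) x y =
  ex (fun u v => (M ^+ k) u v) s t x (fun w => (endp s x w == y)%:R).
Proof.
elim: t x => [|t IHt] x; first by rewrite expr0 /= mxE.
rewrite exprS mxE exS (reindex_inj (@perm_inj _ s)) /=; apply: eq_bigr => v _.
rewrite IHt /permuted_chain mxE (bigD1 v) //= big1 ?addr0 => [|w wv].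
  by rewrite !mxE eqxx mulr1.
by rewrite !mxE (inj_eq perm_inj) (negbTE wv) mulr0.
Qed.

Section Mixing.
Variables (R : realType) (n : nat) (M : 'M[R]_n) (k : nat) (s : 'S_n).
Let P u v := (M ^+ k) u v.
Let Q := permuted_chain M k s.

Lemma unif_distE t : unif_dist Q t = \big[Num.max/0]_(x < n) dist P s set0 t x.
Proof.
apply: eq_bigr => x _; rewrite dist0E; apply: eq_bigr => y _.
by rewrite permuted_chain_powE.
Qed.

(** The condition [0 <= eps] matches the default value 0 of the maximum. *)
Lemma unif_dist_le t eps : 0 <= eps ->
  (unif_dist Q t <= eps) = [forall x, dist P s set0 t x <= eps].
Proof.
move=> e0; rewrite unif_distE; apply/idP/forallP => [h x|h].
  by apply: le_trans h; apply: le_bigmax.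
by apply/bigmax_leP.
Qed.

Hypotheses (P_ge0 : forall x v, 0 <= P x v) (P_row : forall x, \sum_v P x v = 1)
  (P_col : forall v, \sum_x P x v = 1).

(** The distance is nonincreasing in time, so a time where it exceeds [eps] somewhere and one where
    it is at most [eps] everywhere enclose the minimum. *)
Lemma mixing_time_window (eps : R) (tl tu : nat) : 0 <= eps ->
  [exists x, eps < dist P s set0 tl x] -> [forall x, dist P s set0 tu x <= eps] ->
  exists N, [/\ mixing_time Q eps = N%:R%:E, (tl < N)%N & (N <= tu)%N].
Proof.
move=> e0 /existsP[x hx] htu; rewrite /mixing_time; case: pselect => [ex_t|]; last first.
  by case; exists tu; rewrite unif_dist_le.
case: ex_minnP => N; rewrite unif_dist_le // => /forallP hN minN.
exists N; split => //; last by apply: minN; rewrite unif_dist_le.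
rewrite ltnNge; apply/negP => Ntl; move: hx; rewrite ltNge => /negP; apply.
by apply: le_trans (hN x); apply: dist_mono_le.
Qed.

End Mixing.

From mathcomp Require Import all_classical all_reals all_analysis.
From mathcomp Require Import finset.
Import numFieldNormedType.Exports.

(** * Convergence in probability *)

Lemma ratio_dist_le (R : realFieldType) (H l de : R) (tl N tu : nat) :
  0 < l -> 0 <= H -> (tl < N)%N -> (N <= tu)%N ->
  (1 - de) * l < tl.+1%:R * H -> H * tu%:R <= (1 + de) * l ->
  `|H * N%:R / l - 1| <= de.
Proof.
move=> l0 H0 tlN Ntu lo hi.
rewrite -[X in _ - X](divff (lt0r_neq0 l0)) -mulrBl normrM normfV (gtr0_norm l0).
have h1 : H * tl.+1%:R <= H * N%:R by rewrite ler_wpM2l // ler_nat.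
have h2 : H * N%:R <= H * tu%:R by rewrite ler_wpM2l // ler_nat.
rewrite ler_pdivrMr // ler_norml; move: h1 h2 lo hi; rewrite [tl.+1%:R * H]mulrC.
by move: (H * tl.+1%:R) (H * N%:R) (H * tu%:R) => a b c; clear; lra.
Qed.

Section Deviation.
Variables (R : realType) (n : nat) (M : 'M[R]_n) (k : nat).
Let P u v := (M ^+ k) u v.
Hypotheses (P_ge0 : forall x v, 0 <= P x v) (P_row : forall x, \sum_v P x v = 1)
  (P_col : forall v, \sum_x P x v = 1).
Variables (H l eps de delta a b : R) (tl tu : nat).
Hypotheses (l_gt0 : 0 < l) (H_ge0 : 0 <= H) (eps_ge0 : 0 <= eps) (de_le : de <= delta)
  (lo : (1 - de) * l < tl.+1%:R * H) (hi : H * tu%:R <= (1 + de) * l)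
  (up : \sum_p ([exists x, eps < dist P p set0 tu x]%:R : R) <= a * #|'S_n|%:R)
  (dn : \sum_p ([forall x, dist P p set0 tl x <= eps]%:R : R) <= b * #|'S_n|%:R).

Lemma deviation_prob :
  unif_prob R [pred s : 'S_n |
    (delta%:E < `|H%:E * mixing_time (permuted_chain M k s) eps / l%:E - 1%:E|)%E] <= a + b.
Proof.
have N0 : 0 < #|'S_n|%:R :> R by rewrite ltr0n; apply/card_gt0P; exists 1%g.
rewrite /unif_prob ler_pdivrMr // mulrDl; apply: le_trans (lerD up dn).
rewrite -big_split /= -sum1_card natr_sum big_mkcond /=; apply: ler_sum => s _.
rewrite inE; case: ltP => // dev.
case: forallP => [_|/forallP low]; first by rewrite lerDr.
case: existsP => [_|high]; first by rewrite lerDl.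
exfalso; move: dev; rewrite ltNge => /negP; apply.
have [|| N [-> tlN Ntu]] := @mixing_time_window R n M k s P_ge0 P_row P_col eps tl tu eps_ge0.
- by move: low; rewrite negb_forall => /existsP[x]; rewrite -ltNge => hx; apply/existsP; exists x.
- by apply/forallP => x; rewrite leNgt; apply/negP => hx; apply: high; exists x.
rewrite inver gt_eqF // -!EFinM -EFinB abse_EFin lee_fin.
exact: le_trans (ratio_dist_le l_gt0 H_ge0 tlN Ntu lo hi) de_le.
Qed.

End Deviation.

Local Open Scope classical_set_scope.

Lemma near_ln_ge (R : realType) (C : R) : \forall n \near \oo, C <= ln n%:R.
Proof.
near=> n; rewrite -ler_expR lnK; first by near: n; apply: nbhs_infty_ger.
by rewrite posrE; apply: lt_le_trans (expR_gt0 C) _; near: n; apply: nbhs_infty_ger.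
Unshelve. all: by end_near. Qed.

Lemma halving_exponent (R : realType) (eps : R) : 0 < eps -> exists K, 2 ^- K <= eps / 2.
Proof.
move=> e0; exists (Num.trunc (2 / eps)).+1.
rewrite -[leRHS]invf_div lef_pV2 ?posrE ?exprn_gt0 ?divr_gt0 //.
have := truncnS_gt (2 / eps); move=> /ltW h; apply: le_trans h _.
by rewrite -natrX ler_nat ltnW // ltn_expl.
Qed.

Theorem corollary2 (R : realType) (d : nat) (hd : (2 <= d)%N)
  (E : forall n : nat, rel 'I_n)
  (hE : forall n : nat, (d <= n)%N -> regular_digraph d (E n))
  (k : nat -> nat)
  (hk_pos : forall n : nat, (d <= n)%N -> (0 < k n)%N)
  (hk : (fun n : nat => (k n)%:R : R^o) =o_\oo
        (fun n : nat => ln n%:R / ln (ln n%:R) : R^o))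
  (eps : R) (heps0 : 0 < eps) (heps1 : eps < 1) :
  cvg_in_unif_prob (T := fun n : nat => 'S_n)
    (fun (n : nat) (s : 'S_n) =>
       let M := srw R d (E n) in
       let H := avg_entropy (M ^+ k n) in
       let Q := permuted_chain M (k n) s in
       (H%:E * mixing_time Q eps / (ln n%:R)%:E)%E)
    1.
Proof.
move=> delta delta0; apply/cvgr0Pnorm_le => tau tau0.
pose de := Num.min delta 1; have de0 : 0 < de by rewrite lt_min delta0 ltr01.
have de1 : de <= 1 by rewrite ge_min lexx orbT.
have [e0 e1 g0 g1 _] := eps_bounds heps0 heps1.
(* The two exceptional events given by [window] have total probability at most [rho * C]. *)
pose C := 197 / (eps / 16) ^+ 2 + ((1 - eps) / 2)^-1.
have C0 : 0 < C by rewrite addr_gt0 ?divr_gt0 ?exprn_gt0 ?invr_gt0.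
pose rho := Num.min (tau / C) 1.
have rho0 : 0 < rho by rewrite lt_min divr_gt0 ?ltr01.
have rho1 : rho <= 1 by rewrite ge_min lexx orbT.
have rhoC : rho * C <= tau by rewrite -ler_pdivlMr // ge_min lexx.
have [K hK] := halving_exponent heps0.
have lnd : 0 < ln d%:R :> R by rewrite ln_gt0 // ltr1n.
have [c cE c0] : exists2 c : R, c = 1000 * K.+1%:R / (rho ^+ 2 * de ^+ 2) & 0 < c.
  eexists; first by []; apply: divr_gt0; last by rewrite mulr_gt0 // exprn_gt0.
  by apply: mulr_gt0; rewrite ltr0n.
(* With this constant the growth hypothesis on [k] becomes the condition [small_k] on
   [ln (d ^ k n)]. *)
have c_gt0 : 0 < (c * ln d%:R)^-1 by rewrite invr_gt0 mulr_gt0.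
have hk' := (eqoP _ _ _).1 hk _ c_gt0.
near=> n.
have dn : (d <= n)%N by near: n; apply: nbhs_infty_ge.
have n0 : (0 < n)%N by apply: leq_trans dn; apply: ltnW.
have ll1 : 1 <= ln (ln n%:R) :> R.
  have h : expR 1 <= ln n%:R :> R by near: n; apply: near_ln_ge.
  by rewrite -ler_expR lnK // posrE; apply: lt_le_trans (expR_gt0 1) h.
have l_big : 1000 / (rho ^+ 2 * de ^+ 2 * (eps / 16) * ((1 - eps) / 2)) <= ln n%:R.
  by near: n; apply: near_ln_ge.
have l0 : 0 < ln n%:R :> R.
  apply: lt_le_trans l_big; apply: divr_gt0; first by rewrite ltr0n.
  by do 2!(apply: mulr_gt0 => //); apply: mulr_gt0; apply: exprn_gt0.
have ll0 : 0 < ln (ln n%:R) :> R by apply: lt_le_trans ll1.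
have k0 := hk_pos n dn; have En := hE n dn.
have dk2 : (2 <= d ^ k n)%N.
  by rewrite -(prednK k0) expnS (leq_trans hd) // leq_pmulr // expn_gt0 (ltnW hd).
have small_k : c * (ln (d ^ k n)%:R * ln (ln n%:R)) <= ln n%:R.
  have h : (k n)%:R <= (c * ln d%:R)^-1 * (ln n%:R / ln (ln n%:R)) :> R.
    rewrite -[leLHS]normr_nat -[X in _ * X]ger0_norm; last by rewrite divr_ge0 // ltW.
    by near: n.
  move: h; rewrite [leRHS]mulrC ler_pdivlMr ?mulr_gt0 // ler_pdivlMr //.
  rewrite natrX lnXn ?ltr0n ?(ltnW hd) // -mulr_natr.
  by move=> h; apply: le_trans h; rewrite le_eqVlt; apply/orP; left; apply/eqP; ring.
rewrite cE in small_k.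
have P_ge0 := srw_pow_ge0 d (E n) R (k n).
have P_row := srw_pow_row En R hd (k n).
have P_col := srw_pow_col En R hd (k n).
have H2 := srw_pow_avent_ge En R hd k0 n0.
have [tl [tu [lo hi up low]]] := window P_ge0 P_row P_col
  (srw_pow_supp_row En R (k n)) (srw_pow_supp_col En R (k n))
  (srw_pow_half En R hd k0) (srw_pow_info_le (E n) R hd (k n))
  (erefl _) dk2 n0 H2 heps0 heps1 de0 de1 rho0 rho1 hK ll1 small_k l_big.
have de_le : de <= delta by rewrite ge_min lexx.
have H0 : 0 <= avent (fun u v => (srw R d (E n) ^+ k n) u v).
  by apply: le_trans H2.
have := deviation_prob P_ge0 P_row P_col l0 H0 (ltW heps0) de_le lo hi up low.
rewrite ger0_norm => [dev|]; last by rewrite divr_ge0.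
apply: le_trans dev (le_trans _ rhoC).
by rewrite mulrDr; apply: lerD => //; rewrite mulrA [rho * _]mulrC.
Unshelve. all: by end_near.
Qed.
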